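(* Let $n\ge k\ge 1$ be integers, and let $\mathfrak{S}_n$ act on the uniform matroid $\mathrm{U}_{k,n}$ (rank $k$ on $n$ elements) by permuting the ground set. Write the equivariant inverse $Z$-polynomial as $Y_{\mathrm{U}_{k,n}}^{\mathfrak{S}_n}(t)=\sum_{i=0}^k C_it^i$ with $C_i\in\mathrm{VRep}(\mathfrak{S}_n)$. Then the sequence $C_0,\dots,C_k$ is strongly inductively log-concave with respect to $(\mathfrak{S}_{2n},\mathfrak{S}_n\times\mathfrak{S}_n,\mathrm{id})$; that is, for all $1\le i\le j\le k-1$, $$\mathrm{Ind}_{\mathfrak{S}_n\times\mathfrak{S}_n}^{\mathfrak{S}_{2n}}\bigl(C_i\boxtimes C_j\bigr)-\mathrm{Ind}_{\mathfrak{S}_n\times\mathfrak{S}_n}^{\mathfrak{S}_{2n}}\bigl(C_{i-1}\boxtimes C_{j+1}\bigr)\in\mathrm{Rep}(\mathfrak{S}_{2n}).$$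
   Context: All representations are finite-dimensional over $\mathbb{C}$. For a finite group $W$, $\mathrm{VRep}(W)$ is the Grothendieck ring of virtual representations of $W$, $\mathrm{Rep}(W)\subseteq\mathrm{VRep}(W)$ is the subset of honest representations, $\mathrm{grVRep}(W)=\mathrm{VRep}(W)\otimes_{\mathbb{Z}}\mathbb{Z}[t]$, and $\tau_W$ is the trivial representation. Strong induced log-concavity: a sequence $C_0,\dots,C_m$ of virtual representations of a finite group $W$ is strongly inductively log-concave with respect to a finite group $G$, a subgroup $H\le G$ and a homomorphism $\phi:H\to W\times W$ if $\mathrm{Ind}_H^G(C_i\boxtimes C_j)-\mathrm{Ind}_H^G(C_{i-1}\boxtimes C_{j+1})\in\mathrm{Rep}(G)$ for all $1\le i\le j\le m-1$, where the external tensor product $\boxtimes$ is viewed as a representation of $H$ by pullback along $\phi$. An equivariant matroid $W\curvearrowright \mathrm{M}$ is a matroid $\mathrm{M}$ on a finite set $E$ together with an action of a finite group $W$ on $E$ preserving the set of bases. $\mathcal{L}(\mathrm{M})$ is the lattice of flats, $\mathrm{rk}$ the rank function. For a flat $F$, $W_F=\{w\in W: wF=F\}$, and $W_F$ acts on the restriction $\mathrm{M}|_F$ and on the contraction $\mathrm{M}/F$. Sums over $[F]\in\mathcal{L}(\mathrm{M})/W$ take one representative $F$ from each $W$-orbit of flats; tensor product and induction are applied coefficientwise in $t$. For loopless $\mathrm{M}$ define: - the equivariant Möbius invariant $\mu^W_{\mathrm{M}}\in\mathrm{VRep}(W)$: $\mu^W_{\mathrm{M}}=\tau_W$ if $\mathrm{rk}(\mathrm{M})=0$,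 and recursively $\sum_{[F]\in\mathcal{L}(\mathrm{M})/W}\mathrm{Ind}_{W_F}^W\mu^{W_F}_{\mathrm{M}|_F}=0$ if $\mathrm{rk}(\mathrm{M})>0$; - the equivariant characteristic polynomial $H^W_{\mathrm{M}}(t)=\sum_{[F]}t^{\mathrm{rk}(\mathrm{M})-\mathrm{rk}(F)}\,\mathrm{Ind}_{W_F}^W\mu^{W_F}_{\mathrm{M}|_F}$; - the equivariant Kazhdan--Lusztig polynomials $P^W_{\mathrm{M}}(t)\in\mathrm{grVRep}(W)$: the unique assignment with $P^W_{\mathrm{M}}=\tau_W$ if $\mathrm{rk}(\mathrm{M})=0$, $\deg P^W_{\mathrm{M}}<\mathrm{rk}(\mathrm{M})/2$ if $\mathrm{rk}(\mathrm{M})>0$, and $t^{\mathrm{rk}(\mathrm{M})}P^W_{\mathrm{M}}(t^{-1})=\sum_{[F]}\mathrm{Ind}_{W_F}^W\bigl(H^{W_F}_{\mathrm{M}|_F}(t)\otimes P^{W_F}_{\mathrm{M}/F}(t)\bigr)$; - the equivariant inverse Kazhdan--Lusztig polynomials $Q^W_{\mathrm{M}}(t)\in\mathrm{grVRep}(W)$: $Q^W_{\mathrm{M}}=\tau_W$ if $\mathrm{rk}(\mathrm{M})=0$, and $\sum_{[F]}(-1)^{\mathrm{rk}(F)}\mathrm{Ind}_{W_F}^W\bigl(P^{W_F}_{\mathrm{M}|_F}(t)\otimes Q^{W_F}_{\mathrm{M}/F}(t)\bigr)=0$ if $\mathrm{rk}(\mathrm{M})>0$; - the equivariant inverse $Z$-polynomial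 (of degree at most $\mathrm{rk}(\mathrm{M})$) $$Y^{W}_{\mathrm{M}}(t)=(-1)^{\mathrm{rk}(\mathrm{M})}\sum_{[F]\in\mathcal{L}(\mathrm{M})/W}(-1)^{\mathrm{rk}(F)}t^{\mathrm{rk}(\mathrm{M}/F)}\,\mathrm{Ind}^{W}_{W_F}\bigl(Q^{W_F}_{\mathrm{M}|_F}(t)\otimes\mu^{W_F}_{\mathrm{M}/F}\bigr).$$ *)

(* Defs.v *)
From HB Require Import structures.
From mathcomp Require Import all_boot all_order all_fingroup all_algebra.
From mathcomp Require Import all_solvable all_field all_character.

Set Implicit Arguments.
Unset Strict Implicit.
Unset Printing Implicit Defensive.

Import GroupScope GRing.Theory.
Local Open Scope ring_scope.

(* Virtual representations are handled through their characters: VRep(W) is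
   the subring 'Z[irr W] of 'CF(W), with tensor product the product of class
   functions and tau_W = 1; membership in Rep(W) is [\is a character];
   grVRep(W) is {poly 'CF(W)} with coefficients in 'Z[irr W]. *)

(* A matroid whose ground set is a subset E of a fixed finite type, given by
   its independent sets: all minors of a matroid then live on the same type. *)
Section Matroids.
Variable T : finType.
Implicit Types A B F : {set T}.

Definition matroid_axiom (EJ : {set T} * {set {set T}}) : bool :=
  let: (E, J) := EJ in
  [&& set0 \in J,
      [forall A in J, A \subset E],
      [forall A in J, forall B : {set T}, (B \subset A) ==> (B \in J)]
    & [forall A in J, forall B in J, (#|A| < #|B|)%N ==>
         [exists x in B :\: A, (x |: A) \in J]]].

Record matroid := Matroid {
  matroid_val : {set T} * {set {set T}};
  _ : matroid_axiom matroid_val }.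

HB.instance Definition _ := [isSub for matroid_val].

Definition ground (M : matroid) : {set T} := (matroid_val M).1.
Definition indep (M : matroid) : {set {set T}} := (matroid_val M).2.

Lemma matroid_axiomP (E : {set T}) (I : {set {set T}}) :
  reflect [/\ set0 \in I,
              forall A, A \in I -> A \subset E,
              forall A B, A \in I -> B \subset A -> B \in I
            & forall A B, A \in I -> B \in I -> (#|A| < #|B|)%N ->
                exists x, [/\ x \in B, x \notin A & (x |: A) \in I]]
          (matroid_axiom (E, I)).
Proof.
apply: (iffP and4P) => -[I0 IE ID IX]; split=> //.
- by move=> A AI; apply: (forall_inP IE).
- by move=> A B AI /(implyP (forallP (forall_inP ID A AI) B)).
- move=> A B AI BI ltAB.
  have /exists_inP[x] := implyP (forall_inP (forall_inP IX A AI) B BI) ltAB.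
  by rewrite inE => /andP[nxA xB] xAI; exists x.
- by apply/forall_inP.
- by apply/forall_inP=> A AI; apply/forallP=> B; apply/implyP; apply: ID.
- apply/forall_inP=> A AI; apply/forall_inP=> B BI; apply/implyP=> ltAB.
  have [x [xB nxA xAI]] := IX A B AI BI ltAB.
  by apply/exists_inP; exists x; rewrite // inE nxA.
Qed.

Definition bases (M : matroid) : {set {set T}} :=
  [set B : {set T} | maxset [pred A : {set T} | A \in indep M] B].

Definition rk (M : matroid) (A : {set T}) : nat :=
  \max_(B in indep M | B \subset A) #|B|.

Definition mrank (M : matroid) : nat := rk M (ground M).

Definition loopless (M : matroid) : bool :=
  [forall x in ground M, [set x] \in indep M].

Definition flats (M : matroid) : {set {set T}} :=
  [set F : {set T} | (F \subset ground M) &&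
     [forall x in ground M :\: F, (rk M F < rk M (x |: F))%N]].

Fact restrict_subproof (M : matroid) F :
  matroid_axiom (ground M :&: F, [set A in indep M | A \subset F]).
Proof.
case: M => -[E I] /= MP; rewrite /ground /indep /=.
have [I0 IE ID IX] := matroid_axiomP _ _ MP.
apply/matroid_axiomP; split=> [|A|A B|A B]; rewrite ?inE.
- by rewrite I0 sub0set.
- by case/andP=> /IE sAE sAF; rewrite subsetI sAE.
- by case/andP=> AI sAF sBA; rewrite (ID A B) ?(subset_trans sBA).
case/andP=> AI sAF /andP[BI sBF] /(IX A B AI BI)[x [xB nxA xAI]].
exists x; split=> //; rewrite inE xAI subUset sAF sub1set.
by rewrite (subsetP sBF).
Qed.

Definition restrict (M : matroid) F : matroid :=
  Matroid (restrict_subproof M F).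

(* A is independent in M / F iff A :|: J is independent in M for some basis J
   of F, i.e. some independent J contained in F with #|J| = rk M F. *)
Fact contract_subproof (M : matroid) F :
  matroid_axiom (ground M :\: F,
    [set A : {set T} | (A \subset ground M :\: F) &&
       [exists J : {set T}, [&& J \subset F, #|J| == rk M F
                              & (A :|: J) \in indep M]]]).
Proof.
case: M => -[E I] /= MP; rewrite /rk /ground /indep /=.
have [I0 IE ID IX] := matroid_axiomP _ _ MP.
apply/matroid_axiomP; split=> [|A|A B|A B]; rewrite ?inE.
- rewrite sub0set /=; pose P B := (B \in I) && (B \subset F).
  have P0 : P set0 by rewrite /P I0 sub0set.
  rewrite (bigmax_eq_arg set0 P0).
  case: arg_maxnP => // J /andP[JI sJF] _.
  by apply/existsP; exists J; rewrite sJF eqxx set0U.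
- by case/andP.
- case/andP=> sAE /existsP[J /and3P[sJF cJ AJI]] sBA.
  rewrite (subset_trans sBA sAE); apply/existsP; exists J.
  by rewrite sJF cJ (ID _ _ AJI) ?setSU.
case/andP=> sAE /existsP[J /and3P[sJF /eqP cJ AJI]].
case/andP=> sBE /existsP[K /and3P[sKF /eqP cK BKI]] ltAB.
have card_disj (C L : {set T}) : C \subset E :\: F -> L \subset F ->
    #|C :|: L| = (#|C| + #|L|)%N.
  move=> sCE sLF; apply/eqP; rewrite (leq_card_setU C L).2.
  rewrite disjoint_subset; apply/subsetP=> y yC; rewrite inE.
  have := subsetP sCE y yC; rewrite inE => /andP[nyF _].
  by apply: contra nyF; apply: (subsetP sLF).
have [] := IX _ _ AJI BKI.
  by rewrite !card_disj // cJ cK ltn_add2r.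
move=> x [xBK nxAJ xAJI].
have nxF : x \notin F.
  apply/negP=> xF.
  have xJI : (x |: J) \in I by apply: ID xAJI _; rewrite setUCA subsetUr.
  have sxJF : x |: J \subset F by rewrite subUset sub1set xF.
  have := @leq_bigmax_cond _ (fun B : {set T} => (B \in I) && (B \subset F))
            (fun B : {set T} => #|B|) (x |: J).
  rewrite xJI sxJF -cJ cardsU1 => /(_ isT).
  by move: nxAJ; rewrite inE negb_or => /andP[_ ->]; rewrite ltnn.
have xB : x \in B.
  by move: xBK; rewrite inE => /orP[//|/(subsetP sKF)]; rewrite (negPf nxF).
exists x; split=> //; first by apply: contra nxAJ => xA; rewrite inE xA.
rewrite inE subUset sAE sub1set (subsetP sBE) //=.
by apply/existsP; exists J; rewrite sJF cJ eqxx -setUA.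
Qed.

Definition contract (M : matroid) F : matroid :=
  Matroid (contract_subproof M F).

End Matroids.

Fact uniform_subproof (n k : nat) :
  matroid_axiom ([set: 'I_n], [set A : {set 'I_n} | (#|A| <= k)%N]).
Proof.
apply/matroid_axiomP; split=> [|A _|A B|A B]; rewrite ?inE ?cards0 ?subsetT //.
- by move=> cA /subset_leq_card/leq_trans; apply.
move=> cA cB ltAB; case: (boolP (B \subset A)) => [/subset_leq_card|].
  by rewrite leqNgt ltAB.
case/subsetPn=> x xB nxA; exists x; split=> //.
by rewrite inE cardsU1 nxA (leq_trans ltAB).
Qed.

Definition uniform (n k : nat) : matroid 'I_n :=
  Matroid (uniform_subproof n k).

Section Equivariant.
Variables (gT : finGroupType) (T : finType) (to : {action gT &-> T}).
Implicit Types (W : {group gT}) (M : matroid T) (F : {set T}).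

Definition equivariant W M : bool :=
  [acts W, on ground M | to] && [acts W, on bases M | to^*].

Definition flat_reps W M : {set {set T}} :=
  orbit_transversal to^* W (flats M).

Local Notation stab W F := 'N_W(F | to)%G.

Definition grInd W (H : {group gT}) (p : {poly 'CF(H)}) : {poly 'CF(W)} :=
  map_poly 'Ind[W] p.

(* 't^d p(t^-1)', for p of degree at most d. *)
Definition poly_reverse (R : nzRingType) (d : nat) (p : {poly R}) : {poly R} :=
  \poly_(i < d.+1) p`_(d - i).

Definition mobius_family := forall W, matroid T -> 'CF(W).
Definition poly_family := forall W, matroid T -> {poly 'CF(W)}.

Definition is_equivariant_mobius (mu : mobius_family) : Prop :=
  forall W M, equivariant W M -> loopless M ->
  [/\ mu W M \in 'Z[irr W],
      mrank M = 0%N -> mu W M = 1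
    & (0 < mrank M)%N ->
      \sum_(F in flat_reps W M) 'Ind[W] (mu (stab W F) (restrict M F)) = 0].

Definition equivariant_char_poly (mu : mobius_family) : poly_family :=
  fun W M =>
  \sum_(F in flat_reps W M)
    ('Ind[W] (mu (stab W F) (restrict M F)))%:P * 'X^(mrank M - rk M F).

(* (size p).-1 is the degree of p, or 0 when p = 0. *)
Definition is_equivariant_KL (mu : mobius_family) (P : poly_family) : Prop :=
  forall W M, equivariant W M -> loopless M ->
  [/\ P W M \is a polyOver 'Z[irr W],
      mrank M = 0%N -> P W M = 1,
      (0 < mrank M)%N -> (((size (P W M)).-1).*2 < mrank M)%N
    & poly_reverse (mrank M) (P W M) =
      \sum_(F in flat_reps W M)
        grInd W (equivariant_char_poly mu (stab W F) (restrict M F) *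
                 P (stab W F) (contract M F))].

Definition is_equivariant_inverse_KL (P Q : poly_family) : Prop :=
  forall W M, equivariant W M -> loopless M ->
  [/\ Q W M \is a polyOver 'Z[irr W],
      mrank M = 0%N -> Q W M = 1
    & (0 < mrank M)%N ->
      \sum_(F in flat_reps W M)
        (-1) ^+ rk M F * grInd W (P (stab W F) (restrict M F) *
                                  Q (stab W F) (contract M F)) = 0].

Definition inverse_Z_poly (mu : mobius_family) (Q : poly_family) :
    poly_family := fun W M =>
  (-1) ^+ mrank M *
  \sum_(F in flat_reps W M)
    (-1) ^+ rk M F * 'X^(mrank (contract M F)) *
    grInd W (Q (stab W F) (restrict M F) * (mu (stab W F) (contract M F))%:P).

End Equivariant.

Section InducedLogConcavity.
Variables (wT gT : finGroupType).

(* Pullback along f, for f mapping H to W: cfMorph expects a class function on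
   the image f @* H, whence the restriction. *)
Definition cfPull (aT rT : finGroupType) (D : {group aT})
    (f : {morphism D >-> rT}) (H : {group aT}) (W : {group rT})
    (a : 'CF(W)) : 'CF(H) :=
  cfMorph ('Res[f @* H] a).

Definition box_tensor (a b : 'CF([set: wT])) : 'CF([set: wT * wT]) :=
  cfPull (@fst_morphism wT wT) _ a * cfPull (@snd_morphism wT wT) _ b.

Definition strongly_inductively_log_concave (H : {group gT})
    (phi : {morphism H >-> wT * wT}) (m : nat)
    (C : nat -> 'CF([set: wT])) : Prop :=
  forall i j : nat, (1 <= i)%N -> (i <= j)%N -> (j <= m - 1)%N ->
  'Ind[[set: gT]] (cfPull phi H (box_tensor (C i) (C j)))
  - 'Ind[[set: gT]] (cfPull phi H (box_tensor (C i.-1) (C j.+1))) \is a character.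

End InducedLogConcavity.

Section YoungSubgroup.
Variable n : nat.

Definition young_fun (st : 'S_n * 'S_n) (x : 'I_(n + n)) : 'I_(n + n) :=
  match split x with
  | inl i => lshift n (st.1 i)
  | inr i => rshift n (st.2 i)
  end.

Fact young_fun_inj st : injective (young_fun st).
Proof.
move=> x y; rewrite /young_fun.
case: split_ordP => i ->; case: split_ordP => j -> /eqP;
  by rewrite ?eq_lshift ?eq_rshift ?eq_lrshift ?eq_rlshift // => /eqP/perm_inj->.
Qed.

Definition young_perm st : 'S_(n + n) := perm (@young_fun_inj st).

Fact young_permM :
  {in [set: 'S_n * 'S_n] &, {morph young_perm : x y / (x * y)%g}}.
Proof.
move=> s t _ _; apply/permP=> x; rewrite permM !permE /young_fun.
case: (split_ordP x) => i _ /=.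
  by case: split_ordP => j /eqP; rewrite ?eq_lshift ?eq_lrshift // => /eqP<-;
    rewrite permM.
by case: split_ordP => j /eqP; rewrite ?eq_rshift ?eq_rlshift // => /eqP<-;
  rewrite permM.
Qed.

Definition young_morphism : {morphism [set: 'S_n * 'S_n] >-> 'S_(n + n)} :=
  Morphism young_permM.

Fact young_injm : 'injm young_morphism.
Proof.
apply/injmP=> s t _ _ /permP eq_st; apply/eqP; rewrite -pair_eqE /=.
apply/andP; split; apply/eqP/permP=> i.
  have := eq_st (lshift n i); rewrite !permE /young_fun (unsplitK (inl i)).
  exact: lshift_inj.
have := eq_st (rshift n i); rewrite !permE /young_fun (unsplitK (inr i)).
exact: rshift_inj.
Qed.

(* S_n x S_n as a subgroup of S_2n, with the identity of S_n x S_n read through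
   this identification. *)
Definition young_group : {group 'S_(n + n)} :=
  (young_morphism @* [set: 'S_n * 'S_n])%G.

Definition young_id : {morphism young_group >-> 'S_n * 'S_n} :=
  [morphism of invm young_injm].

End YoungSubgroup.

(* Main.v *)
(* For a permutation w of T, the values at w of a family of class functions of
   the symmetric groups of all subsets of T form a function on the subsets of T
   supported on the w-stable ones, and induction products of class functions
   become subset convolution of these set functions.  In this commutative ring
   the complete and elementary symmetric functions h_a and e_a satisfy the usual
   relation between their generating series, and the Kazhdan--Lusztig recursions
   of the uniform matroids, solved there, give
     C_i = e_(min(i, k-i)) * s_(n-k+1, 1^(max(i, k-i)-1)).
   The differences of products of these symmetric functions are nonnegative
   combinations of products of h's, e's and Schur functions of the shapes
   (c, 2^p, 1^(q-p)) and (c, c, 2^(p-1), 1^(q-p)).  Each of the latter is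
   an integral polynomial in the h's and e's, hence a virtual character; peeling
   off variables of an alphabet computes its norm, which is 1, and a positive
   pairing with an honest character, so it is an irreducible character. *)
Require Import Defs.
From HB Require Import structures.
From mathcomp Require Import all_boot all_order all_fingroup all_algebra.
From mathcomp Require Import all_solvable all_field all_character.
From mathcomp Require Import zify ring.

Set Implicit Arguments.
Unset Strict Implicit.
Unset Printing Implicit Defensive.

Import GroupScope GRing.Theory.
Local Open Scope ring_scope.

(** * Subset convolution *)

(** Identities of class functions are checked one permutation [w] at a time. At [w], a sum over
    orbit representatives of flats with induction from their stabilisers is a plain sum over the
    [w]-stable flats; this is what opens the unknown families, indexed by all groups at once, to
    generating-series algebra. The obstacle is that the ground set of a uniform matroid is larger
    than its rank: the sequences are graded by rank, the set functions by size. Proper flats are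
    Boolean, where the two gradings agree, and only the top flat sees the difference. It enters as
    [utop], which is not homogeneous; evaluated on the whole ground set of size n, its convolutions
    with the elementary functions become hooks, and the first row n-k+1 is what is left of n after
    k-1 further boxes. For log-concavity, C_i = C_(k-i), the coefficients increase up to the middle
    index, and on either half the sequence is a product of a column sequence and a hook sequence
    that are both log-concave in the same sense. *)

Definition sfun (T : finType) (K : comNzRingType) : Type := {ffun {set T} -> K}.

Section SubsetConvolution.
Variables (T : finType) (K : comNzRingType).
Implicit Types (x y z : sfun T K) (A B : {set T}).

HB.instance Definition _ := GRing.Zmodule.copy (sfun T K) {ffun {set T} -> K}.

Definition sapp x : {set T} -> K := fun A => (x : {ffun {set T} -> K}) A.
Definition sfunof (f : {set T} -> K) : sfun T K := [ffun A => f A].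

Lemma sfunofE f A : sapp (sfunof f) A = f A.
Proof. by rewrite /sapp ffunE. Qed.

Lemma sfunP x y : sapp x =1 sapp y <-> x = y.
Proof. by split=> [eq_xy|->//]; apply/ffunP=> A; apply: eq_xy. Qed.

Lemma sapp0 A : sapp 0 A = 0.
Proof. by rewrite /sapp ffunE. Qed.

Lemma sappD x y A : sapp (x + y) A = sapp x A + sapp y A.
Proof. by rewrite /sapp ffunE. Qed.

Lemma sappN x A : sapp (- x) A = - sapp x A.
Proof. by rewrite /sapp ffunE. Qed.

Lemma sapp_sum I r (P : pred I) (f : I -> sfun T K) A :
  sapp (\sum_(i <- r | P i) f i) A = \sum_(i <- r | P i) sapp (f i) A.
Proof.
by elim/big_ind2: _ => [|x a y b <- <-|//]; rewrite ?sapp0 ?sappD.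
Qed.

Definition smul x y := sfunof (fun A =>
  \sum_(B : {set T} | B \subset A) sapp x B * sapp y (A :\: B)).
Definition sone := sfunof (fun A => (A == set0)%:R).

Lemma smulE x y A : sapp (smul x y) A =
  \sum_(B : {set T} | B \subset A) sapp x B * sapp y (A :\: B).
Proof. exact: sfunofE. Qed.

Lemma setDKs A B : B \subset A -> A :\: (A :\: B) = B.
Proof. by move=> sBA; rewrite setDDr setDv set0U (setIidPr sBA). Qed.

Lemma smulC : commutative smul.
Proof.
move=> x y; apply/sfunP=> A; rewrite !smulE.
rewrite (reindex_onto (fun B => A :\: B) (fun B => A :\: B)) => [|B /setDKs//].
apply: eq_big => [B|B /andP[_ /eqP->]]; last by rewrite mulrC.
rewrite subsetDl /=; apply/eqP/idP=> [<-|/setDKs//]; exact: subsetDl.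
Qed.

Lemma smulA : associative smul.
Proof.
move=> x y z; apply/sfunP=> A; rewrite !smulE.
under eq_bigr do rewrite smulE big_distrr /=.
under [RHS]eq_bigr do rewrite smulE big_distrl /=.
rewrite [RHS](exchange_big_dep (fun B => B \subset A)) /=; last first.
  by move=> B C sBA sCB; apply: subset_trans sBA.
apply: eq_bigr => B sBA.
(* The block [C] inside [A :\: B] is traded for the union of [B] and [C], so that both sides run
   over the same chains of subsets of [A]. *)
rewrite (reindex_onto (fun C => C :\: B) (fun C => B :|: C)) /=; last first.
  move=> C sCA; apply/setP=> t; rewrite !inE.
  by have := subsetP sCA t; rewrite !inE; case: (t \in B); case: (t \in C) => //= /(_ isT).
apply: eq_big => [C|C].
  apply/idP/idP=> [/andP[sCBA /eqP eqC]|/andP[sCA sBC]].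
    rewrite -eqC subsetUl subUset sBA /= andbT.
    by apply: subset_trans sCBA (subsetDl _ _).
  rewrite setSD //=.
  by apply/eqP/setP=> t; rewrite !inE; have := subsetP sBC t;
     case: (t \in B) => //= ->.
case/andP=> sCBA /eqP eqC; rewrite mulrA; congr (_ * _ * sapp z _).
by rewrite setDDl eqC.
Qed.

Lemma smul1 : left_id sone smul.
Proof.
move=> x; apply/sfunP=> A; rewrite smulE (bigD1 set0) ?sub0set //=.
rewrite sfunofE eqxx mul1r setD0 big1 ?addr0 // => B /andP[_ nB0].
by rewrite sfunofE (negPf nB0) mul0r.
Qed.

Lemma smulDl : left_distributive smul +%R.
Proof.
move=> x y z; apply/sfunP=> A; rewrite sappD !smulE -big_split /=.
by apply: eq_bigr => B _; rewrite sappD mulrDl.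
Qed.

Lemma sone_neq0 : sone != 0.
Proof.
apply/eqP=> /sfunP/(_ set0); rewrite sfunofE eqxx sapp0 => /eqP.
by rewrite (oner_eq0 K).
Qed.

HB.instance Definition _ := GRing.Zmodule_isComNzRing.Build (sfun T K)
  smulA smulC smul1 smulDl sone_neq0.

Lemma sappM x y A : sapp (x * y) A =
  \sum_(B : {set T} | B \subset A) sapp x B * sapp y (A :\: B).
Proof. exact: smulE. Qed.

Lemma sapp1 A : sapp 1 A = (A == set0)%:R.
Proof. exact: sfunofE. Qed.

Lemma sapp_sign n x A : sapp ((-1) ^+ n * x) A = (-1) ^+ n * sapp x A.
Proof.
rewrite -[in LHS]signr_odd -[in RHS]signr_odd.
by case: (odd n); rewrite ?expr0 ?expr1 ?mul1r ?mulN1r ?sappN.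
Qed.

End SubsetConvolution.

(* Restriction of a set function along an injection is a ring morphism for
   subset convolution; it expresses both conjugation invariance and locality. *)
Section Relabel.
Variables (T T' : finType) (K : comNzRingType) (f : T -> T').
Hypothesis inj_f : injective f.

Definition relabel (x : sfun T' K) : sfun T K :=
  sfunof (fun A => sapp x (f @: A)).

Lemma relabelE x A : sapp (relabel x) A = sapp x (f @: A).
Proof. exact: sfunofE. Qed.

Lemma relabelD x y : relabel (x + y) = relabel x + relabel y.
Proof. by apply/sfunP=> A; rewrite sappD !relabelE sappD. Qed.

Lemma relabelN x : relabel (- x) = - relabel x.
Proof. by apply/sfunP=> A; rewrite sappN !relabelE sappN. Qed.

Lemma relabelM x y : relabel (x * y) = relabel x * relabel y.
Proof.
apply/sfunP=> A; rewrite relabelE !sappM.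
rewrite (reindex_onto (fun B : {set T} => f @: B)
                      (fun B : {set T'} => f @^-1: B)) /=; last first.
  move=> B sBA; apply/setP=> t; apply/imsetP/idP=> [[s]|tB].
    by rewrite inE => ? ->.
  have /imsetP[s sA def_t] := subsetP sBA t tB.
  by exists s; rewrite ?inE -?def_t.
apply: eq_big => [B|B /andP[_ /eqP eqB]].
  have ->: f @^-1: (f @: B) == B.
    apply/eqP/setP=> t; rewrite inE; apply/imsetP/idP=> [[s sB /inj_f->//]|tB].
    by exists t.
  rewrite andbT; apply/idP/idP=> [/subsetP sBA|/imsetS//].
  by apply/subsetP=> t tB; have /sBA/imsetP[s sA /inj_f->] := imset_f f tB.
rewrite !relabelE; congr (_ * sapp y _).
apply/setP=> t; rewrite inE; apply/andP/imsetP=> [[nfB /imsetP[s sA def_t]]|].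
  by exists s; rewrite // inE sA andbT; apply: contra nfB => sB; rewrite def_t imset_f.
case=> s; rewrite inE => /andP[nsB sA] ->; split; last exact: imset_f.
by apply: contra nsB => /imsetP[r rB /inj_f->].
Qed.

End Relabel.

(** * Hook and near-hook Schur functions *)

Section HookPolynomials.
Variables (R : comNzRingType) (h e : nat -> R).

(* The Schur function of the hook (c, 1^(n-1)), by peeling off its first row;
   it is 0 for n = 0. *)
Fixpoint hook (c n : nat) : R :=
  if n is m.+1 then h c * e m - hook c.+1 m else 0.

Definition pre (g : nat -> R) (n : nat) : R := if n is m.+1 then g m else 0.

(* The Schur functions of the partitions whose conjugates are (q, p), and of
   (c, 2^p, 1^(q-p)) and (c, c, 2^(p-1), 1^(q-p)) respectively. *)
Definition two_columns p q : R := e p * e q - e q.+1 * pre e p.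

Definition row_two_columns c p q : R := e p * hook c q.+1 - e q.+1 * hook c p.

Definition two_rows_two_columns c p q : R :=
  hook c p * hook c q - hook c p.-1 * hook c q.+1
  - h c.-1 * (e q * hook c p - e p.-1 * hook c q.+1).

Lemma hookS c n : hook c n.+1 = h c * e n - hook c.+1 n.
Proof. by []. Qed.

Lemma hook_sum c n :
  hook c n = \sum_(r < n) (-1) ^+ r * (h (c + r)%N * e (n.-1 - r)%N).
Proof.
elim: n c => [|n IHn] c; first by rewrite big_ord0.
rewrite big_ord_recl /= mul1r addn0 subn0 IHn -sumrN; congr (_ + _).
apply: eq_bigr => i _; rewrite exprS mulN1r mulNr /bump /= addSnnS.
by congr (- (_ * (_ * e _))); lia.
Qed.

End HookPolynomials.

(* Adding one variable 'X to an alphabet: [gsum] extends the complete and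
   [gstep] the elementary symmetric functions, or the other way round for an
   odd variable. *)
Section Peel.
Variable R : comNzRingType.
Implicit Types g h e : nat -> R.

Fixpoint gsum g (n : nat) : {poly R} :=
  (g n)%:P + (if n is m.+1 then 'X * gsum g m else 0).

Definition gstep g (n : nat) : {poly R} := (g n)%:P + 'X * (pre g n)%:P.

Lemma gsumS g n : gsum g n.+1 = (g n.+1)%:P + 'X * gsum g n.
Proof. by []. Qed.

Lemma gsum_sum g n : gsum g n = \sum_(j < n.+1) (g (n - j)%N)%:P * 'X^j.
Proof.
elim: n => [|n IHn]; first by rewrite big_ord1 /= addr0 mulr1.
rewrite big_ord_recl gsumS IHn mulr1 subn0; congr (_ + _); rewrite big_distrr /=.
by apply: eq_bigr => j _; rewrite exprS mulrCA /bump /= add1n subSS.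
Qed.

Lemma coef_gsum g n m : (gsum g n)`_m = if (m <= n)%N then g (n - m)%N else 0.
Proof.
elim: n m => [|n IHn] m; first by rewrite /= addr0 coefC leqn0 sub0n.
rewrite gsumS coefD coefC coefXM; case: m => [|m] /=; first by rewrite addr0.
by rewrite add0r IHn ltnS subSS.
Qed.

Variables h e : nat -> R.

(** Since [gsum h c.+1] is [h c.+1] plus ['X] times [gsum h c], the recursion telescopes: the new
    variable survives only in the factor [gsum h c], from which coefficients can be read off. *)
Lemma hook_peel c n :
  hook (gsum h) (gstep e) c n.+1 = gsum h c * (e n)%:P - (hook h e c.+1 n)%:P.
Proof.
elim: n c => [|n IHn] c.
  by rewrite /= /gstep /= !subr0 mulr0 addr0.
rewrite (hookS (gsum h)) IHn (hookS h) gsumS /gstep /= polyCB polyCM.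
by ring.
Qed.

(** By [hook_peel] the expression is [gsum h c] times a constant, plus a part of degree at most 1 in
    the new variable, which [1 < m] discards. At [m = c] this is the branching rule that removes the
    whole first row. *)
Lemma row_two_columns_peel c p q m : (1 < m)%N ->
  (row_two_columns (gsum h) (gstep e) c p q)`_m =
  if (m <= c)%N then h (c - m)%N * two_columns e p q else 0.
Proof.
move=> m_gt1.
have [c0 [c1 ->]] : exists c0 c1, row_two_columns (gsum h) (gstep e) c p q =
    gsum h c * (two_columns e p q)%:P + (c0%:P + 'X * c1%:P).
  rewrite /row_two_columns hook_peel; case: p => [|p]; last rewrite hook_peel.
    exists (- (e 0 * hook h e c.+1 q)), 0.
    rewrite /two_columns /gstep /= !mulr0 !subr0 !addr0.
    by rewrite !(polyCN, polyCM, polyC0); ring.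
  exists (e q.+1 * hook h e c.+1 p - e p.+1 * hook h e c.+1 q).
  exists (e q * hook h e c.+1 p - e p * hook h e c.+1 q).
  by rewrite /two_columns /gstep /= !polyCB !polyCM; ring.
rewrite coefD coefMC coef_gsum coefD coefC coefXM coefC.
by case: m m_gt1 => [|[|m]] //= _; rewrite !addr0; case: ifP => // _; rewrite mul0r.
Qed.

(** The terms quadratic in [gsum h c] cancel, which is the purpose of the correction by [h c.-1] in
    the definition. The rest is linear in [gsum h c] and [gsum h c.-1]: nothing survives above
    degree [c], and in degree [c] one of the two rows of length [c] is stripped. *)
Lemma two_rows_two_columns_peel c p q m : (0 < c <= m)%N ->
  (two_rows_two_columns (gsum h) (gstep e) c p.+2 q.+1)`_m =
  if m == c then h 0%N * row_two_columns h e c p.+1 q else 0.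
Proof.
case: c => // c /andP[_ lt_cm].
have [z [k ->]] : exists z k : R,
    two_rows_two_columns (gsum h) (gstep e) c.+1 p.+2 q.+1 =
    gsum h c.+1 * (row_two_columns h e c.+1 p.+1 q)%:P + gsum h c * z%:P + k%:P.
  pose A := hook h e c.+2.
  exists (e q.+1 * A p.+1 - e p.+1 * A q.+1).
  exists (A p.+1 * A q - A p * A q.+1 - h c.+1 * (e q * A p.+1 - e p * A q.+1)).
  rewrite /two_rows_two_columns /row_two_columns [p.+2.-1]/= [c.+1.-1]/=.
  rewrite !hook_peel !(hookS h e c.+1) gsumS /gstep /A [pre _ _]/= [pre _ p.+1]/=.
  by rewrite !(polyCB, polyCM, polyCD); ring.
rewrite !coefD !coefMC !coef_gsum coefC.
have [-> ->] : (m <= c)%N = false /\ (m == 0%N) = false by split; lia.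
rewrite mul0r !addr0; case: eqP => [->|neq_mc]; first by rewrite leqnn subnn.
by rewrite ifF ?mul0r //; lia.
Qed.

End Peel.

(** Here [g] belongs to a single odd variable [y], so [gsum g] belongs to the two odd variables ['X]
    and [y]; what is extracted is the leading term in ['X] of the Schur function of a two-column
    shape. *)
Lemma two_columns_peel (R : comNzRingType) (g : nat -> R) (y : R) p q m :
  (forall n, g n = y ^+ n) -> (p <= q)%N -> (q <= m)%N ->
  (two_columns (gsum g) p q)`_m = if m == q then y ^+ p else 0.
Proof.
move=> gE le_pq le_qm.
have ->: two_columns (gsum g) p q =
    gsum g q * (y ^+ p)%:P - pre (gsum g) p * (y ^+ q.+1)%:P.
  rewrite /two_columns gsumS -!gE; case: p {le_pq} => [|p]; last by rewrite gsumS /=; ring.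
  by rewrite /= addr0; ring.
rewrite coefB !coefMC coef_gsum.
have ->: (pre (gsum g) p : {poly R})`_m = 0.
  case: p le_pq => [|p] le_pq; rewrite /= ?coef0 // coef_gsum.
  by case: ifP => //; lia.
rewrite mul0r subr0 eqn_leq le_qm andbT; case: ifP => le_mq; last by rewrite mul0r.
by rewrite (_ : (q - m = 0)%N) ?gE ?mul1r //; lia.
Qed.

(** * Pieri-type identities for columns and hooks *)

Section HookIdentities.
Variables (R : comNzRingType) (h e : nat -> R).
Local Notation H := (hook h e).
Hypotheses (h0 : h 0 = 1) (e0 : e 0 = 1).
Hypothesis eh : forall n, \sum_(i < n.+1) (-1) ^+ i * (e i * h (n - i)%N) = (n == 0%N)%:R.

(** The recursion for [hook] peels rows, so a hook with first row 1 is an alternating sum; the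
    relation between the generating series of [e] and [h] collapses it to a column. *)
Lemma hook_column n : H 1 n.+1 = e n.+1.
Proof.
have sum_e: e n.+1 = (-1) ^+ n * \sum_(i < n.+1) (-1) ^+ i * (e i * h (n.+1 - i)%N).
  have := eh n.+1; rewrite big_ord_recr /= subnn h0 mulr1 => /eqP.
  rewrite addr_eq0 => /eqP->; rewrite exprS mulN1r mulNr opprK mulrA -exprD.
  by rewrite addnn -signr_odd odd_double mul1r.
rewrite sum_e (hook_sum h e 1 n.+1) big_distrr [RHS](reindex_inj rev_ord_inj) /=.
apply: eq_bigr => i _; have := ltn_ord i; rewrite ltnS => le_in.
rewrite mulrA -exprD subSS /= -[in RHS]signr_odd.
have ->: odd (n + (n - i)) = odd i by lia.
rewrite signr_odd [h _ * _]mulrC; congr (_ * (_ * h _)); lia.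
Qed.

Lemma row_two_columns_hook c n : row_two_columns h e c 0 n = H c n.+1.
Proof. by rewrite /row_two_columns e0 mul1r /= mulr0 subr0. Qed.

(** A two-column shape is (c, 2^p, 1^(q-p)) with [c = 2], so products of two columns need no family
    of their own. *)
Lemma mul_columns_sub p q : e p.+1 * e q.+1 - e p * e q.+2 = row_two_columns h e 2 p q.
Proof.
have H2 n : H 2 n = h 1 * e n - e n.+1 by rewrite -hook_column /=; ring.
by rewrite /row_two_columns !H2; ring.
Qed.

(** For [i <= m] this is a difference of two Pieri expansions, in which the common shapes cancel. *)
Lemma column_hook_sub c i m : e i.+1 * H c m.+1 - e i * H c m.+2 =
  row_two_columns h e c i.+1 m + row_two_columns h e c.+1 i m.
Proof. by rewrite /row_two_columns /=; ring. Qed.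

(** [two_rows_two_columns] is arranged so that the difference of products of hooks is this function
    plus a product whose factors are both Schur functions. *)
Lemma hook_hook_sub c p q : H c.+1 p.+1 * H c.+1 q.+1 - H c.+1 p * H c.+1 q.+2 =
  h c * row_two_columns h e c.+2 p q + two_rows_two_columns h e c.+1 p.+1 q.+1.
Proof. by rewrite /row_two_columns /two_rows_two_columns /=; ring. Qed.

End HookIdentities.

(** * Symmetric functions as set functions *)

Section StableSets.
Variable T : finType.
Implicit Types (w u : {perm T}) (A B : {set T}).

Definition stb w A : bool := w \in 'N(A | 'P)%g.

Lemma stbP w A : reflect (forall x, (w x \in A) = (x \in A)) (stb w A).
Proof. by apply: (iffP astabsP) => sA x; apply: sA. Qed.

Lemma stb0 w : stb w set0.
Proof. by apply/stbP=> x; rewrite !inE. Qed.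

Lemma stbT w : stb w setT.
Proof. by apply/stbP=> x; rewrite !inE. Qed.

Lemma stbU w A B : stb w A -> stb w B -> stb w (A :|: B).
Proof. by move=> /stbP sA /stbP sB; apply/stbP=> x; rewrite !inE sA sB. Qed.

Lemma stbD w A B : stb w A -> stb w B -> stb w (A :\: B).
Proof. by move=> /stbP sA /stbP sB; apply/stbP=> x; rewrite !inE sA sB. Qed.

Lemma stbI w A B : stb w A -> stb w B -> stb w (A :&: B).
Proof. by move=> /stbP sA /stbP sB; apply/stbP=> x; rewrite !inE sA sB. Qed.

Lemma stbC w A : stb w (~: A) = stb w A.
Proof.
by apply/stbP/stbP=> sA x; [have := sA x; rewrite !inE => /negb_inj | rewrite !inE sA].
Qed.

Lemma stb_porbit w x : stb w (porbit w x).
Proof.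
apply/stbP=> y; rewrite -!eq_porbit_mem.
by rewrite -(porbit_perm w 1 y) expg1.
Qed.

Lemma porbit_sub w A x : stb w A -> (porbit w x \subset A) = (x \in A).
Proof.
move=> sA; apply/idP/idP=> [/subsetP-> //|xA]; first exact: porbit_id.
apply/subsetP=> y /porbitP[i ->]; elim: i => [|i IHi]; first by rewrite perm1.
by rewrite expgSr permM (stbP _ _ sA).
Qed.

Lemma disjoint_porbit w A x : stb w A -> x \notin A -> [disjoint porbit w x & A].
Proof.
move=> sA nxA; rewrite disjoint_subset; apply/subsetP=> y yx; rewrite inE.
apply: contra nxA; rewrite -!(porbit_sub _ sA).
by move: yx; rewrite -eq_porbit_mem => /eqP->.
Qed.

Lemma stb_perm_on u A B : perm_on A u -> B \subset ~: A -> stb u B.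
Proof.
move=> uA sBA; apply/stbP=> x; have [xA|nxA] := boolP (x \in A).
  have nB y : y \in A -> y \notin B.
    by move=> yA; apply: contraL yA => /(subsetP sBA); rewrite inE.
  by rewrite !(negPf (nB _ _)) // perm_closed.
by rewrite (out_perm uA).
Qed.

Lemma perm_on_stb u A : perm_on A u -> stb u A.
Proof. by move=> uA; apply/stbP=> x; rewrite perm_closed. Qed.

Lemma stb_restr w A B : stb w A -> B \subset A -> stb (restr_perm A w) B = stb w B.
Proof.
move=> sA sBA; apply/stbP/stbP=> sB x.
  have [xA|nxA] := boolP (x \in A); first by rewrite -(sB x) restr_permE.
  have nB y : y \notin A -> y \notin B by apply: contra; apply: (subsetP sBA).
  by rewrite !(negPf (nB _ _)) // (stbP _ _ sA).
have [xA|nxA] := boolP (x \in A); first by rewrite restr_permE.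
by rewrite (out_perm (restr_perm_on _ _)).
Qed.

Lemma restr_restr w A B : stb w A -> stb w B -> B \subset A ->
  restr_perm B (restr_perm A w) = restr_perm B w.
Proof.
move=> sA sB sBA; apply/permP=> x; have [xB|nxB] := boolP (x \in B).
  by rewrite !restr_permE ?(subsetP sBA) //; apply: etrans (stb_restr sA sBA) sB.
by rewrite !(out_perm (restr_perm_on _ _)).
Qed.

Definition cyc w A : {set {set T}} := [set c in porbits w | c \subset A].

(** The sign of [w] on a stable set, read from its cycles: the count makes sense without restricting
    [w], adds up over disjoint unions and is carried along injections. *)
Definition odd_on w A : bool := odd (#|A| + #|cyc w A|).

Lemma odd_on0 w : odd_on w set0 = false.
Proof.
rewrite /odd_on cards0 (_ : cyc w set0 = set0) ?cards0 //.
apply/setP=> c; rewrite !inE subset0; apply/andP=> -[/imsetP[x _ ->]] /eqP/setP/(_ x).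
by rewrite porbit_id inE.
Qed.

Lemma odd_onU w A B : stb w A -> stb w B -> [disjoint A & B] ->
  odd_on w (A :|: B) = odd_on w A (+) odd_on w B.
Proof.
move=> sA sB dAB; rewrite /odd_on -oddD; congr odd.
have ->: cyc w (A :|: B) = cyc w A :|: cyc w B.
  apply/setP=> c; rewrite !inE; case: imsetP => //= -[x _ ->].
  by rewrite !porbit_sub ?stbU // inE.
have dC : [disjoint cyc w A & cyc w B].
  rewrite -setI_eq0; apply/eqP/setP=> c; rewrite !inE.
  case: imsetP => //= -[x _ ->]; rewrite !porbit_sub //.
  by have := disjoint_setI0 dAB => /setP/(_ x); rewrite !inE.
rewrite !cardsU (disjoint_setI0 dAB) (disjoint_setI0 dC) !cards0 !subn0; lia.
Qed.

Lemma porbit_restr w A x : stb w A ->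
  porbit (restr_perm A w) x = if x \in A then porbit w x else [set x].
Proof.
move=> sA; have pE i : x \in A -> (restr_perm A w ^+ i)%g x = (w ^+ i)%g x /\ (w ^+ i)%g x \in A.
  move=> xA; elim: i => [|i [IH1 IH2]]; first by rewrite !perm1.
  by rewrite !expgSr !permM IH1 restr_permE // (stbP _ _ sA).
case: ifP => [xA|/negbT nxA]; apply/setP=> y.
  by apply/porbitP/porbitP=> -[i ->]; exists i; case: (pE i xA).
rewrite inE; apply/porbitP/eqP=> [[i ->]|->]; last by exists 0%N; rewrite perm1.
elim: i => [|i IHi]; first by rewrite perm1.
by rewrite expgSr permM IHi (out_perm (restr_perm_on _ _)).
Qed.

Lemma odd_on_restr w A : stb w A -> odd_on w A = odd_perm (restr_perm A w).
Proof.
move=> sA; rewrite /odd_on /odd_perm.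
have ->: porbits (restr_perm A w) = cyc w A :|: [set [set x] | x in ~: A].
  apply/setP=> c; rewrite !inE; apply/imsetP/orP=> [[x _ ->]|].
    rewrite porbit_restr //; have [xA|nxA] := boolP (x \in A); [left|right].
      by rewrite imset_f //= porbit_sub.
    by apply: imset_f; rewrite inE.
  case=> [/andP[/imsetP[x _ ->]]|/imsetP[x]].
    by rewrite porbit_sub // => xA; exists x => //; rewrite porbit_restr // xA.
  by rewrite inE => nxA ->; exists x => //; rewrite porbit_restr // (negPf nxA).
have dC : [disjoint cyc w A & [set [set x] | x in ~: A]].
  rewrite -setI_eq0; apply/eqP/setP=> c; rewrite !inE.
  apply/negbTE/negP=> /andP[/andP[_ scA] /imsetP[x]]; rewrite inE => nxA def_c.
  by case/negP: nxA; rewrite (subsetP scA) // def_c inE.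
rewrite cardsU (disjoint_setI0 dC) cards0 subn0 card_imset; last exact: set1_inj.
by rewrite -(cardsC A) -oddD !oddD; do 3!case: (odd _).
Qed.

Lemma odd_onM w u A : stb w A -> stb u A ->
  odd_on (w * u)%g A = odd_on w A (+) odd_on u A.
Proof.
move=> sw su; rewrite !odd_on_restr //; last exact: groupM.
by rewrite morphM // odd_permM.
Qed.

End StableSets.

Section Intertwine.
Variables (T T' : finType) (f : T -> T') (w : {perm T}) (w' : {perm T'}).
Hypotheses (inj_f : injective f) (fw : forall x, w' (f x) = f (w x)).
Implicit Type A : {set T}.

Lemma stb_intertwine A : stb w' (f @: A) = stb w A.
Proof.
apply/stbP/stbP=> sA x; first by have := sA (f x); rewrite fw !mem_imset.
apply/imsetP/imsetP=> [[y yA eq_y]|[y yA ->]]; last first.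
  by exists (w y); rewrite ?fw ?sA.
have eq_w : w' x = w' (f (w^-1 y)%g) by rewrite fw permKV.
by exists (w^-1 y)%g; [rewrite -sA permKV | apply: perm_inj eq_w].
Qed.

Lemma porbit_intertwine x : porbit w' (f x) = f @: porbit w x.
Proof.
have fX i : (w' ^+ i)%g (f x) = f ((w ^+ i)%g x).
  by elim: i => [|i IHi]; rewrite ?perm1 // !expgSr !permM IHi fw.
apply/setP=> y; apply/porbitP/imsetP=> [[i ->]|[z /porbitP[i ->] ->]].
  by exists ((w ^+ i)%g x); rewrite ?mem_porbit.
by exists i.
Qed.

Lemma odd_on_intertwine A : stb w A -> odd_on w' (f @: A) = odd_on w A.
Proof.
move=> sA; rewrite /odd_on card_imset //; congr (odd (_ + _)).
have ->: cyc w' (f @: A) = [set f @: (c : {set T}) | c in cyc w A].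
  apply/setP=> c; rewrite inE; apply/andP/imsetP=> [[/imsetP[x' _ ->]]|[c']].
    rewrite porbit_sub ?stb_intertwine // => /imsetP[x xA ->].
    by exists (porbit w x); rewrite ?porbit_intertwine // inE imset_f //= porbit_sub.
  rewrite inE => /andP[/imsetP[x _ ->]]; rewrite porbit_sub // => xA ->.
  by rewrite -porbit_intertwine imset_f // porbit_sub ?stb_intertwine // imset_f.
by rewrite card_imset //; apply: imset_inj.
Qed.

End Intertwine.

(** * Complete and elementary symmetric functions *)

Section Generators.
Variables (T : finType) (K : comNzRingType).
Implicit Types (w u : {perm T}) (A B : {set T}).

Definition sg (b : bool) w A : K := (-1) ^+ (b && odd_on w A).

(* The values at w of the complete (b = false) and elementary (b = true)
   symmetric functions of degree a, as functions of a w-stable set. *)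
Definition gen (b : bool) w (a : nat) : sfun T K :=
  sfunof (fun A => if stb w A && (#|A| == a) then sg b w A else 0).

Local Notation h := (gen false).
Local Notation e := (gen true).

Lemma genE b w a A :
  sapp (gen b w a) A = if stb w A && (#|A| == a) then sg b w A else 0.
Proof. exact: sfunofE. Qed.

Lemma gen_neq b w a A : #|A| != a -> sapp (gen b w a) A = 0.
Proof. by rewrite genE => /negPf->; rewrite andbF. Qed.

Lemma sg0 b w : sg b w set0 = 1.
Proof. by rewrite /sg odd_on0 andbF. Qed.

Lemma sgU b w A B : stb w A -> stb w B -> [disjoint A & B] ->
  sg b w (A :|: B) = sg b w A * sg b w B.
Proof.
by move=> sA sB dAB; rewrite /sg odd_onU //; case: b => /=; rewrite ?signr_addb ?mulr1.
Qed.

Lemma sgM b w u A : stb w A -> stb u A -> sg b (w * u)%g A = sg b w A * sg b u A.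
Proof.
by move=> sw su; rewrite /sg odd_onM //; case: b => /=; rewrite ?signr_addb ?mulr1.
Qed.

Lemma sg_addb b c w A : sg b w A * sg c w A = sg (b (+) c) w A.
Proof. by rewrite /sg -signr_addb; case: b; case: c; case: (odd_on _ _). Qed.

Lemma sg_restr b w A B : stb w A -> B \subset A -> stb w B ->
  sg b (restr_perm A w) B = sg b w B.
Proof.
move=> sA sBA sB; rewrite /sg !odd_on_restr ?stb_restr //.
by rewrite restr_restr.
Qed.

Lemma gen0 b w : gen b w 0 = 1.
Proof.
apply/sfunP=> A; rewrite genE sapp1 cards_eq0.
by have [->|_] := eqVneq A set0; rewrite ?andbF // stb0 sg0.
Qed.

(* Toggling the cycle through a fixed point of A is a sign-reversing involution. *)
Lemma sum_stb_sign w A : stb w A -> A != set0 ->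
  \sum_(B : {set T} | (B \subset A) && stb w B) (-1) ^+ #|B| * sg true w B = 0 :> K.
Proof.
move=> sA /set0Pn[x xA]; set c := porbit w x.
have scA : c \subset A by rewrite porbit_sub.
have sc : stb w c by apply: stb_porbit.
(* A cycle of length l has sign (-1)^(l-1), so adding it to [B] always flips the sign of the
   summand. *)
have sgc : (-1) ^+ #|c| * sg true w c = -1 :> K.
  rewrite /sg /odd_on (_ : cyc w c = [set c]).
    by rewrite cards1 addn1 /= -signr_odd; case: (odd _); rewrite ?expr0 ?expr1 ?mul1r ?mulr1.
  apply/setP=> d; rewrite !inE; apply/andP/eqP=> [[/imsetP[y _ ->]]|->].
    by rewrite porbit_sub // -eq_porbit_mem => /eqP.
  by rewrite imset_f.
rewrite (bigID (fun B : {set T} => x \in B)) /=.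
apply/eqP; rewrite addr_eq0; apply/eqP.
rewrite (reindex_onto (fun B : {set T} => c :|: B) (fun B : {set T} => B :\: c)) /=;
  last first.
  move=> B /andP[/andP[_ sB] xB]; rewrite -[RHS](setID B c) (setIidPr _) //.
  by rewrite porbit_sub.
have disjc B : stb w B -> x \notin B -> (c :|: B) :\: c = B.
  move=> sB nxB; rewrite setDUl setDv set0U; apply/setDidPl.
  by rewrite disjoint_sym disjoint_porbit.
rewrite -sumrN; apply: eq_big => [B|B /andP[/andP[/andP[_ scB] _] /eqP def_B]].
  have [sB|nsB] := boolP (stb w B); last first.
    rewrite !andbF /=; apply/negP=> /andP[/andP[/andP[_ scB] _] /eqP def_B].
    by case/negP: nsB; rewrite -def_B stbD.
  rewrite stbU // subUset scA !andbT inE porbit_id andbT; congr (_ && _).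
  by apply/eqP/idP=> [<-|/(disjc B sB)//]; rewrite !inE porbit_id.
have sB : stb w B by rewrite -def_B stbD.
have nxB : x \notin B by rewrite -def_B !inE porbit_id.
have dcB : [disjoint c & B] by apply: disjoint_porbit.
rewrite sgU // cardsU (disjoint_setI0 dcB) cards0 subn0 exprD mulrACA sgc.
by rewrite mulN1r.
Qed.

(** After exchanging the sums, each stable [B] inside a stable [A] of size [n] selects the single
    index [i = #|B|]. What is left is the alternating sum of [sum_stb_sign], which is zero unless
    [A] is empty. *)
Lemma sum_e_h w n :
  \sum_(i < n.+1) (-1) ^+ i * (e w i * h w (n - i)%N) = (n == 0%N)%:R.
Proof.
apply/sfunP=> A; rewrite sapp_sum.
under eq_bigr => i _ do rewrite sapp_sign sappM big_distrr /=.
rewrite exchange_big /=.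
have [sA|nsA] := boolP (stb w A); last first.
  rewrite big1 => [|B sBA].
    case: (n == 0%N); last by rewrite sapp0.
    by rewrite sapp1; case: eqP nsA => // ->; rewrite stb0.
  rewrite big1 // => i _; rewrite !genE; case: ifP => [/andP[sB _]|]; last first.
    by rewrite mul0r mulr0.
  case: ifP => [/andP[sAB _]|]; last by rewrite !mulr0.
  by case/negP: nsA; rewrite -(setID A B) (setIidPr sBA) stbU.
transitivity (\sum_(B : {set T} | (B \subset A) && stb w B)
    (-1) ^+ #|B| * sg true w B * (#|A| == n)%:R : K).
  rewrite big_mkcondr /=; apply: eq_bigr => B sBA.
  have cA : #|A| = (#|B| + #|A :\: B|)%N.
    by rewrite -(cardsID B A) (setIidPr sBA).
  have [sB|nsB] := boolP (stb w B); last first.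
    by rewrite big1 // => i _; rewrite genE (negPf nsB) mul0r mulr0.
  have [eqn|nen] := eqVneq #|A| n.
    have ltBn : (#|B| < n.+1)%N by rewrite ltnS -eqn subset_leq_card.
    rewrite (bigD1 (Ordinal ltBn)) //= big1 ?addr0 => [|i neqi]; last first.
      rewrite gen_neq ?mul0r ?mulr0 // eq_sym.
      by apply: contra neqi => /eqP eqi; apply/eqP/val_inj.
    rewrite !genE sB eqxx stbD //= ifT ?mulr1 ?mulrA // -eqn cA addKn //.
  rewrite mulr0 big1 // => i _; rewrite !genE sB /=; case: eqP => [eqi|]; last first.
    by rewrite mul0r mulr0.
  case: ifP => [/andP[_ /eqP eqni]|]; last by rewrite !mulr0.
  case/eqP: nen; rewrite cA eqi eqni; have := ltn_ord i; lia.
rewrite -big_distrl /=; have [->|nA0] := eqVneq A set0; last first.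
  rewrite sum_stb_sign // mul0r; case: (n == 0%N); rewrite ?sapp0 // sapp1.
  by rewrite (negPf nA0).
rewrite (big_pred1 set0) => [|B]; last first.
  by rewrite subset0 /=; case: eqP => [->|] //=; rewrite stb0.
rewrite cards0 sg0 mulr1 mul1r [0%N == n]eq_sym; case: (n == 0%N).
  by rewrite sapp1 eqxx.
by rewrite sapp0.
Qed.

End Generators.

(** Serves twice: with [f] a permutation it is conjugation invariance, with [f] the inclusion of one
    half of the points it restricts to a factor of the Young subgroup. *)
Lemma gen_intertwine (T T' : finType) (K : comNzRingType) (f : T -> T')
    (w : {perm T}) (w' : {perm T'}) b a :
  injective f -> (forall x, w' (f x) = f (w x)) ->
  relabel f (gen K b w' a) = gen K b w a.
Proof.
move=> inj_f fw; apply/sfunP=> A; rewrite relabelE !genE (stb_intertwine inj_f fw).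
rewrite card_imset //; case: ifP => // /andP[sA _].
by rewrite /sg (odd_on_intertwine inj_f fw).
Qed.

Section Homogeneous.
Variables (T : finType) (K : comNzRingType) (w : {perm T}).
Implicit Types x y : sfun T K.
Local Notation h := (gen K false w).
Local Notation e := (gen K true w).

Definition homogeneous (x : sfun T K) (n : nat) : Prop :=
  forall A : {set T}, #|A| != n -> sapp x A = 0.

Lemma homogeneous0 n : homogeneous 0 n.
Proof. by move=> A _; apply: sapp0. Qed.

Lemma homogeneous_gen b n : homogeneous (gen K b w n) n.
Proof. by move=> A; apply: gen_neq. Qed.

Lemma homogeneousB x y n : homogeneous x n -> homogeneous y n -> homogeneous (x - y) n.
Proof. by move=> hx hy A nA; rewrite sappD sappN hx // hy // subr0. Qed.

Lemma homogeneousM x y m n l :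
  homogeneous x m -> homogeneous y n -> l = (m + n)%N -> homogeneous (x * y) l.
Proof.
move=> hx hy -> A nA; rewrite sappM big1 // => B sBA.
have [cB|ncB] := eqVneq #|B| m; last by rewrite hx ?mul0r.
rewrite hy ?mulr0 // cardsDS // cB; apply: contra nA => /eqP<-.
by rewrite subnKC // -cB subset_leq_card.
Qed.

Lemma homogeneous_hook c n : homogeneous (hook h e c n) (c + n).-1.
Proof.
elim: n c => [|n IHn] c; first exact: homogeneous0.
rewrite hookS addnS; apply: homogeneousB; last by have := IHn c.+1; rewrite addSn.
by apply: (homogeneousM (@homogeneous_gen _ _) (@homogeneous_gen _ _)).
Qed.

Lemma homogeneous_row_two_columns c p q : (0 < c)%N ->
  homogeneous (row_two_columns h e c p q) (c + p + q)%N.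
Proof.
move=> c_gt0; apply: homogeneousB;
  apply: (homogeneousM (@homogeneous_gen _ _) (@homogeneous_hook _ _)); lia.
Qed.

Lemma homogeneous_two_rows_two_columns c p q : (0 < c)%N -> (1 < p)%N ->
  homogeneous (two_rows_two_columns h e c p q) (c + p + c + q - 2)%N.
Proof.
move=> c_gt0 p_gt1; apply: homogeneousB; first apply: homogeneousB.
- by apply: (homogeneousM (@homogeneous_hook _ _) (@homogeneous_hook _ _)); lia.
- by apply: (homogeneousM (@homogeneous_hook _ _) (@homogeneous_hook _ _)); lia.
apply: (@homogeneousM _ _ c.-1 (c + p + q).-1%N); [exact: homogeneous_gen| |lia].
by apply: homogeneousB;
  apply: (homogeneousM (@homogeneous_gen _ _) (@homogeneous_hook _ _)); lia.
Qed.

End Homogeneous.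

(** * Pairings and alphabets *)

Section Averages.
Variable T : finType.
Implicit Types (u w : {perm T}) (A B : {set T}).

Section Local.
Variable K : comNzRingType.
Implicit Types phi psi : {perm T} -> {set T} -> K.

(* The value at a set A vanishes unless A is stable, and then depends only on
   the permutation induced on A. *)
Definition local phi := forall w A,
  if stb w A then phi (restr_perm A w) A = phi w A else phi w A = 0.

(** Only permutations supported on [A] are summed, not the whole stabiliser, so the complement of
    [A] contributes no factor; divided by the factorial of [#|A|] this is an average over the
    symmetric group of [A]. *)
Definition perm_sum phi A : K := \sum_(u | perm_on A u) phi u A.

Lemma local_restr phi w A : local phi -> stb w A -> phi (restr_perm A w) A = phi w A.
Proof. by move=> /(_ w A) + sA; rewrite sA. Qed.

Lemma local_restr_sub phi w A B : local phi -> stb w A -> stb w B -> B \subset A ->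
  phi (restr_perm A w) B = phi w B.
Proof.
move=> lphi sA sB sBA; have sB' : stb (restr_perm A w) B by rewrite stb_restr.
by rewrite -(local_restr lphi sB') restr_restr // local_restr.
Qed.

Lemma local_out phi w A : local phi -> ~~ stb w A -> phi w A = 0.
Proof. by move=> /(_ w A) + /negPf nsA; rewrite nsA. Qed.

Lemma localM phi psi : local phi -> local psi ->
  local (fun u A => phi u A * psi u A).
Proof.
move=> lphi lpsi w A; case: ifP => [sA|/negbT nsA]; first by rewrite !local_restr.
by rewrite (local_out lphi) // mul0r.
Qed.

Lemma local_stb : local (fun w A => (stb w A)%:R : K).
Proof. by move=> w A; case: ifP => [sA|->] //; rewrite stb_restr ?sA. Qed.

(* A permutation of A stabilising B is a pair of permutations of B and A \ B. *)
Lemma perm_sum_split phi psi A B : local phi -> local psi -> B \subset A ->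
  \sum_(u | perm_on A u) phi u B * psi u (A :\: B) = perm_sum phi B * perm_sum psi (A :\: B).
Proof.
move=> lphi lpsi sBA; set C := A :\: B.
rewrite /perm_sum big_distrl /=; under [RHS]eq_bigr do rewrite big_distrr /=.
rewrite pair_big /= (bigID (fun u => stb u B)) /= [X in _ + X]big1 ?addr0; last first.
  by move=> u /andP[_ nsB]; rewrite (local_out lphi) // mul0r.
have sCB : C \subset ~: B by apply/subsetP=> x; rewrite !inE => /andP[].
have sBC : B \subset ~: C by apply/subsetP=> x xB; rewrite !inE xB.
have stbC v v' : perm_on B v -> perm_on C v' -> stb (v * v')%g B /\ stb (v * v')%g C.
  move=> vB v'C; split; apply: groupM; first exact: perm_on_stb.
  - exact: stb_perm_on v'C _.
  - exact: stb_perm_on vB _.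
  exact: perm_on_stb.
have restrB v v' : perm_on B v -> perm_on C v' -> restr_perm B (v * v') = v.
  move=> vB v'C; have [sB _] := stbC _ _ vB v'C.
  apply/permP=> x; have [xB|nxB] := boolP (x \in B); last first.
    by rewrite !(out_perm _ nxB) // restr_perm_on.
  rewrite restr_permE // permM (out_perm v'C) //.
  have := xB; rewrite -(perm_closed _ vB) => vxB.
  by have := subsetP sBC _ vxB; rewrite inE.
have restrC v v' : perm_on B v -> perm_on C v' -> restr_perm C (v * v') = v'.
  move=> vB v'C; have [_ sC] := stbC _ _ vB v'C.
  apply/permP=> x; have [xC|nxC] := boolP (x \in C); last first.
    by rewrite !(out_perm _ nxC) // restr_perm_on.
  rewrite restr_permE // permM (out_perm vB) //.
  by have := subsetP sCB _ xC; rewrite inE.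
rewrite (reindex_onto (fun p => p.1 * p.2)%g
          (fun u => (restr_perm B u, restr_perm C u))) /=; last first.
  move=> u /andP[uA sB]; have sC : stb u C by apply: stbD => //; apply: perm_on_stb.
  apply/permP=> x; rewrite permM; have [xB|nxB] := boolP (x \in B).
    rewrite (restr_permE sB xB) (out_perm (restr_perm_on _ _)) //.
    by have := subsetP sBC (u x); rewrite inE (stbP _ _ sB); apply.
  rewrite (out_perm (restr_perm_on _ _) nxB).
  have [xC|nxC] := boolP (x \in C); first by rewrite (restr_permE sC xC).
  rewrite (out_perm (restr_perm_on _ _) nxC) (out_perm uA) //.
  by apply: contra nxC => xA; rewrite inE nxB.
apply: eq_big => [[v v']|[v v']] /=.
  apply/idP/idP=> [/andP[_ /eqP[<- <-]]|/andP[vB v'C]]; first by rewrite !restr_perm_on.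
  rewrite restrB // restrC // eqxx andbT (stbC _ _ vB v'C).1 andbT.
  by apply: perm_onM; [apply: subset_trans vB sBA | apply: subset_trans v'C (subsetDl _ _)].
move=> /andP[_ /eqP[eqv eqv']].
have vB : perm_on B v by rewrite -eqv restr_perm_on.
have v'C : perm_on C v' by rewrite -eqv' restr_perm_on.
have [sB sC] := stbC _ _ vB v'C.
by rewrite -(local_restr lphi sB) -(local_restr lpsi sC) restrB // restrC.
Qed.

Lemma perm_sum_stb A : perm_sum (fun w B => (stb w B)%:R) A = (#|A|`!)%:R :> K.
Proof.
rewrite /perm_sum (eq_bigr (fun=> 1)) => [|u uA]; last by rewrite perm_on_stb.
by rewrite sumr_const -card_perm; congr (_ *+ _); apply: eq_card => u; rewrite inE.
Qed.

(** Orthogonality of the trivial and the sign character: they coincide on sets with at most one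
    element, and on larger sets multiplication by a transposition cancels the sum. *)
Lemma perm_sum_sg b A :
  perm_sum (fun w B => (stb w B)%:R * sg K b w B) A = (b ==> (#|A| <= 1)%N)%:R * (#|A|`!)%:R.
Proof.
case: b; last by rewrite mul1r -perm_sum_stb; apply: eq_bigr => u _; rewrite mulr1.
case: leqP => [A_le1|A_gt1].
  rewrite mul1r -perm_sum_stb; apply: eq_bigr => u uA.
  rewrite /sg odd_on_restr ?perm_on_stb //.
  suff ->: restr_perm A u = 1%g by rewrite odd_perm1 mulr1.
  apply/permP=> x; rewrite perm1; have [xA|nxA] := boolP (x \in A).
    rewrite restr_permE //; last exact: perm_on_stb.
    by apply: (card_le1_eqP A_le1); rewrite ?perm_closed.
  by rewrite (out_perm (restr_perm_on _ _)).
rewrite mul0r; have /card_gt1P[x [y [xA yA nxy]]] := A_gt1.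
have tA : perm_on A (tperm x y) by apply: subset_trans (tperm_on x y) _; rewrite subUset !sub1set xA.
have sgt u : perm_on A u -> odd_on (tperm x y * u)%g A = ~~ odd_on u A.
  move=> uA; rewrite odd_onM ?perm_on_stb // [odd_on (tperm x y) A]odd_on_restr ?perm_on_stb //.
  suff ->: restr_perm A (tperm x y) = tperm x y by rewrite odd_tperm nxy addTb.
  apply/permP=> z; have [zA|nzA] := boolP (z \in A).
    by rewrite restr_permE //; apply: perm_on_stb.
  by rewrite !(out_perm _ nzA) // restr_perm_on.
rewrite /perm_sum (bigID (fun u => odd_on u A)) /=; apply/eqP.
rewrite addr_eq0 -sumrN (reindex_inj (mulgI (tperm x y))) /=; apply/eqP.
have tinv u : perm_on A (tperm x y * u)%g = perm_on A u.
  apply/idP/idP=> uA; last exact: perm_onM.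
  by rewrite -(mulKg (tperm x y) u) tpermV perm_onM.
apply: eq_big => u; rewrite tinv; first by case uA: (perm_on A u) => //=; rewrite sgt.
case/andP=> uA; rewrite sgt // => /negPf nu.
by rewrite !perm_on_stb ?tinv // /sg sgt // nu !mul1r.
Qed.

End Local.
End Averages.

(** * Even and odd variables *)

Section Families.
Variable T : finType.
Implicit Types (u w : {perm T}) (A B : {set T}).

Definition slocal (K : comNzRingType) (x : {perm T} -> sfun T K) :=
  local (fun w A => sapp (x w) A).

Section Closure.
Variable K : comNzRingType.
Implicit Types x y : {perm T} -> sfun T K.

Lemma slocal1 : slocal (fun _ : {perm T} => 1 : sfun T K).
Proof.
by move=> w A; rewrite sapp1; case: ifP => // nsA; case: eqP nsA => // ->; rewrite stb0.
Qed.

Lemma slocal0 : slocal (fun _ : {perm T} => 0 : sfun T K).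
Proof. by move=> w A; rewrite sapp0 if_same. Qed.

Lemma slocal_gen b a : slocal (fun w => gen K b w a).
Proof.
move=> w A; rewrite !genE; case: ifP => [sA|->//].
by rewrite stb_restr ?sA // sg_restr.
Qed.

Lemma slocalN x : slocal x -> slocal (fun w => - x w).
Proof. by move=> lx w A; have := lx w A; rewrite !sappN; case: ifP => _ -> //; rewrite oppr0. Qed.

Lemma slocalD x y : slocal x -> slocal y -> slocal (fun w => x w + y w).
Proof.
move=> lx ly w A; have := lx w A; have := ly w A; rewrite !sappD.
by case: ifP => _ -> -> //; rewrite addr0.
Qed.

Lemma slocalB x y : slocal x -> slocal y -> slocal (fun w => x w - y w).
Proof. by move=> lx ly; apply: slocalD => //; apply: slocalN. Qed.

Lemma slocalM x y : slocal x -> slocal y -> slocal (fun w => x w * y w).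
Proof.
move=> lx ly w A; rewrite !sappM; case: ifP => [sA|/negbT nsA]; last first.
  rewrite big1 // => B sBA; have [sB|nsB] := boolP (stb w B); last first.
    by rewrite (local_out lx) // mul0r.
  rewrite (local_out ly) ?mulr0 //; apply: contra nsA => sAB.
  by rewrite -(setID A B) (setIidPr sBA) stbU.
apply: eq_bigr => B sBA; have [sB|nsB] := boolP (stb w B); last first.
  by rewrite !(local_out lx) ?mul0r ?stb_restr.
have sAB : stb w (A :\: B) by apply: stbD.
by rewrite (local_restr_sub lx) // (local_restr_sub ly) // subsetDl.
Qed.

End Closure.

Lemma sum_subset_card (K : comNzRingType) A (F : nat -> K) :
  \sum_(B : {set T} | B \subset A) F #|B| = \sum_(j < #|A|.+1) F j *+ 'C(#|A|, j).
Proof.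
rewrite (partition_big (fun B : {set T} => inord #|B| : 'I_#|A|.+1) predT) //=.
apply: eq_bigr => j _; rewrite (eq_bigr (fun=> F j)) => [|B /andP[sBA /eqP<-]]; last first.
  by rewrite inordK // ltnS subset_leq_card.
rewrite sumr_const -cards_draws cardsE; congr (_ *+ _); apply: eq_card => B.
rewrite !unfold_in; case sBA: (B \subset A) => //=.
apply/eqP/eqP=> [<-|cB]; first by rewrite inordK // ltnS subset_leq_card.
by apply: val_inj; rewrite /= inordK // ltnS subset_leq_card.
Qed.

(** Since the binomial coefficient times j! (n-j)! is n!, averaging turns subset convolution of
    functions of the size into the Cauchy product. This is why averages yield generating series. *)
Lemma sum_subset_fact (K : comNzRingType) A (f g : nat -> K) :
  \sum_(B : {set T} | B \subset A)
     f #|B| * (#|B|`!)%:R * (g #|A :\: B| * (#|A :\: B|`!)%:R) =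
  (\sum_(j < #|A|.+1) f j * g (#|A| - j)%N) * (#|A|`!)%:R.
Proof.
pose F j := f j * (j`!)%:R * (g (#|A| - j)%N * ((#|A| - j)`!)%:R).
rewrite (eq_bigr (fun B : {set T} => F #|B|)) => [|B sBA]; last by rewrite /F cardsDS.
rewrite sum_subset_card big_distrl /=; apply: eq_bigr => j _; rewrite /F.
have /bin_fact fE : (j <= #|A|)%N by rewrite -ltnS.
move: fE; move: (#|A|`!) (j`!) ((#|A| - j)`!) ('C(#|A|, j)) => a c d k <-.
rewrite -[LHS]mulr_natr !natrM; move: (a%:R : K) (c%:R : K) (d%:R : K) (k%:R : K) (f j) (g _) => ? ? ? ? ? ?; ring.
Qed.

Definition multiplicative (K : comNzRingType) (Y : {perm T} -> sfun T K) :=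
  forall w A B, stb w A -> stb w B -> [disjoint A & B] ->
  sapp (Y w) (A :|: B) = sapp (Y w) A * sapp (Y w) B.

Lemma multiplicativeM (K : comNzRingType) (x y : {perm T} -> sfun T K) :
  slocal x -> slocal y -> multiplicative x -> multiplicative y ->
  multiplicative (fun w => x w * y w).
Proof.
move=> lx ly mx my w A B sA sB dAB; rewrite !sappM big_distrl /=.
have AB0 : A :&: B = set0 by apply: disjoint_setI0.
under [RHS]eq_bigr do rewrite big_distrr /=.
rewrite pair_big /= (reindex_onto (fun p => p.1 :|: p.2)
  (fun C : {set T} => (C :&: A, C :&: B))) /=; last first.
  by move=> C sC; rewrite -setIUr (setIidPl sC).
have disj (C D : {set T}) : C \subset A -> D \subset B -> C :&: B = set0 /\ D :&: A = set0.
  move=> sCA sDB; split; apply/eqP; rewrite -subset0 -AB0; first exact: setSI.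
  by rewrite setIC setIS.
apply: eq_big => [[C D]|[C D]] /=.
  apply/idP/idP=> [/andP[_ /eqP[<- <-]]|/andP[sCA sDB]]; first by rewrite !subsetIr.
  have [CB0 DA0] := disj _ _ sCA sDB.
  by rewrite setUSS // !setIUl (setIidPl sCA) (setIidPl sDB) CB0 DA0 setU0 set0U eqxx.
case/andP=> _ /eqP[eqC eqD].
have sCA : C \subset A by rewrite -eqC subsetIr.
have sDB : D \subset B by rewrite -eqD subsetIr.
have [CB0 DA0] := disj _ _ sCA sDB.
have dCD : [disjoint C & D] by rewrite (disjointWl sCA) // (disjointWr sDB).
have [sC|nsC] := boolP (stb w C); last first.
  rewrite [sapp (x w) C](local_out lx) // (local_out lx) ?mul0r //.
  by apply: contra nsC => sCD; rewrite -eqC stbI.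
have [sD|nsD] := boolP (stb w D); last first.
  rewrite [sapp (x w) D](local_out lx) // (local_out lx) ?mul0r ?mulr0 //.
  by apply: contra nsD => sCD; rewrite -eqD stbI.
have ->: (A :|: B) :\: (C :|: D) = (A :\: C) :|: (B :\: D).
  have dAD : A :\: D = A by apply/setDidPl; rewrite -setI_eq0 setIC DA0.
  have dBC : B :\: C = B by apply/setDidPl; rewrite -setI_eq0 setIC CB0.
  rewrite setDUl !setDUr dAD dBC; congr (_ :|: _).
    by apply/setIidPl; apply: subsetDl.
  by apply/setIidPr; apply: subsetDl.
rewrite mx // my ?stbD //; first by rewrite mulrACA.
by rewrite (disjointWl (subsetDl _ _)) // (disjointWr (subsetDl _ _)).
Qed.

(* [Y] is the generating function, over a set of variables in K, of all products of
   complete and elementary symmetric functions; averaging it over the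
   permutations of A gives g false (resp. g true, after a sign twist), the
   complete (resp. elementary) symmetric functions in these variables. *)
Record alphabet (K : comNzRingType) (Y : {perm T} -> sfun T K) (g : bool -> nat -> K) :=
  Alphabet {
    alphabet_local : slocal Y;
    alphabet_mult : multiplicative Y;
    alphabet_total : forall b A,
      perm_sum (fun w B => sg K b w B * sapp (Y w) B) A = g b #|A| * (#|A|`!)%:R }.

Lemma alphabet0 (K : comNzRingType) :
  alphabet (fun=> 1 : sfun T K) (fun _ n => (n == 0%N)%:R).
Proof.
split; first exact: slocal1.
  move=> w A B sA sB dAB; rewrite !sapp1 setU_eq0.
  by case: (A == _); case: (B == _); rewrite ?mulr0 ?mulr1.
move=> b A; rewrite /perm_sum cards_eq0; have [->|nA0] := eqVneq A set0; last first.
  by rewrite mul0r big1 // => u _; rewrite sapp1 (negPf nA0) mulr0.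
rewrite cards0 (big_pred1 1%g) => [|u]; first by rewrite sg0 sapp1 eqxx mulr1.
apply/idP/eqP=> [u0|->]; last exact: perm_on1.
by apply/permP=> x; rewrite perm1 (out_perm u0) ?inE.
Qed.

Definition smap (K K' : comNzRingType) (f : K -> K') (x : sfun T K) : sfun T K' :=
  sfunof (fun A => f (sapp x A)).

Section Map.
Variables (K K' : comNzRingType) (f : {rmorphism K -> K'}).

Lemma smapE x A : sapp (smap f x) A = f (sapp x A).
Proof. exact: sfunofE. Qed.

Lemma smapM x y : smap f (x * y) = smap f x * smap f y.
Proof.
apply/sfunP=> A; rewrite smapE !sappM rmorph_sum /=.
by apply: eq_bigr => B _; rewrite rmorphM !smapE.
Qed.

Lemma smap1 : smap f 1 = 1.
Proof. by apply/sfunP=> A; rewrite smapE !sapp1 rmorph_nat. Qed.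

Lemma sg_rmorph b w A : f (sg K b w A) = sg K' b w A.
Proof. exact: rmorph_sign. Qed.

Lemma smap_gen b w a : smap f (gen K b w a) = gen K' b w a.
Proof.
by apply/sfunP=> A; rewrite smapE !genE; case: ifP => _; rewrite ?rmorph0 ?sg_rmorph.
Qed.

Lemma slocal_map x : slocal x -> slocal (fun w => smap f (x w)).
Proof.
move=> lx w A; have := lx w A; rewrite !smapE.
by case: ifP => _ ->; rewrite ?rmorph0.
Qed.

End Map.

Section Step.
Variables (K : comNzRingType) (Y : {perm T} -> sfun T K) (g : bool -> nat -> K).
Hypothesis alphY : alphabet Y g.
Variable b : bool.

(** The generating series of all the [gen b w m], the new variable recording the degree [m]. *)
Definition newvar w : sfun T {poly K} :=
  sfunof (fun A => (stb w A)%:R * sg {poly K} b w A * 'X^#|A|).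

Definition stepY w : sfun T {poly K} := newvar w * smap polyC (Y w).

Definition stepg (c : bool) : nat -> {poly K} :=
  if b == c then gsum (g c) else gstep (g c).

Lemma newvarE w A : sapp (newvar w) A = (stb w A)%:R * sg {poly K} b w A * 'X^#|A|.
Proof. exact: sfunofE. Qed.

(** Extracting a power of the new variable multiplies by one generator. The factor [Z] is carried
    along because extractions are iterated over several variables. *)
Lemma coef_stepY (Z : {perm T} -> sfun T K) w A m :
  (sapp (smap polyC (Z w) * stepY w) A)`_m = sapp (Z w * (gen K b w m * Y w)) A.
Proof.
have ->: smap polyC (Z w) * stepY w = newvar w * smap polyC (Z w * Y w).
  by rewrite smapM mulrCA.
rewrite mulrCA !sappM coef_sum; apply: eq_bigr => B _.
rewrite newvarE genE smapE coefMC -(sg_rmorph polyC) -(rmorph_nat polyC) -rmorphM /=.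
rewrite coefCM coefXn eq_sym; case: ifP => [/andP[-> ->]|]; first by rewrite mul1r mulr1.
by case: (stb w B) => [/= ->|_]; rewrite ?mulr0 ?mul0r.
Qed.

Lemma slocal_newvar : slocal newvar.
Proof.
move=> w A; rewrite !newvarE; case: ifP => [sA|->]; last by rewrite !mul0r.
by rewrite stb_restr ?sA // sg_restr.
Qed.

(** A permutation stabilising [B] splits, so the average of a product is the Cauchy product of the
    averages. The average of [newvar] is the geometric series when its sign matches the twist [c],
    and 1 + X otherwise: these are the factors behind [gsum] and [gstep]. *)
Lemma alphabet_step : alphabet stepY stepg.
Proof.
case: alphY => lY mY tY.
have lYC := slocal_map polyC lY.
split; first by apply: slocalM => //; apply: slocal_newvar.
  apply: multiplicativeM => //; first exact: slocal_newvar.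
    move=> w A B sA sB dAB; rewrite !newvarE stbU // sA sB !mul1r sgU //.
    by rewrite cardsU (disjoint_setI0 dAB) cards0 subn0 exprD mulrACA.
  by move=> w A B sA sB dAB; rewrite !smapE mY // rmorphM.
move=> c A; rewrite /perm_sum.
pose phi w B := sg {poly K} c w B * sapp (newvar w) B.
pose psi w B := sg {poly K} c w B * sapp (smap polyC (Y w)) B.
have lsg x : slocal x -> local (fun w B => sg {poly K} c w B * sapp (x w) B).
  move=> lx w B; have := lx w B; case: ifP => [sB ->|_ ->]; last by rewrite mulr0.
  by rewrite sg_restr.
have lphi : local phi by apply: (lsg _ slocal_newvar).
have lpsi : local psi by apply: (lsg _ lYC).
transitivity (\sum_(B : {set T} | B \subset A) perm_sum phi B * perm_sum psi (A :\: B)).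
  under [RHS]eq_bigr => B sBA do rewrite -perm_sum_split //.
  rewrite [RHS]exchange_big /=; apply: eq_bigr => u uA; rewrite /stepY sappM big_distrr /=.
  apply: eq_bigr => B sBA; rewrite /phi /psi.
  have [sB|nsB] := boolP (stb u B); last by rewrite newvarE (negPf nsB) !(mulr0, mul0r).
  have sAB : stb u (A :\: B) by apply: stbD => //; apply: perm_on_stb.
  have ->: sg {poly K} c u A = sg {poly K} c u B * sg {poly K} c u (A :\: B).
    rewrite -sgU //; last by rewrite -setI_eq0 setIDA setIC -setIDA setDv setI0.
    by rewrite -{1}(setID A B) (setIidPr sBA).
  by rewrite mulrACA.
have tphi B : perm_sum phi B = ((b != c) ==> (#|B| <= 1)%N)%:R * 'X^#|B| * (#|B|`!)%:R.
  have ->: (b != c) = b (+) c by case: (b); case: (c).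
  rewrite mulrAC -perm_sum_sg /perm_sum big_distrl /=; apply: eq_bigr => u _.
  by rewrite /phi newvarE -sg_addb; ring.
have tpsi B : perm_sum psi B = (g c #|B|)%:P * (#|B|`!)%:R.
  rewrite -(rmorph_nat polyC) -rmorphM -tY /perm_sum rmorph_sum; apply: eq_bigr => u _.
  by rewrite /psi smapE rmorphM /= sg_rmorph.
under eq_bigr do rewrite tphi tpsi.
rewrite (sum_subset_fact A (fun j => ((b != c) ==> (j <= 1)%N)%:R * 'X^j) (fun j => (g c j)%:P)).
congr (_ * _); rewrite /stepg; case: eqP => _ /=.
  by rewrite gsum_sum; apply: eq_bigr => j _; rewrite mul1r mulrC.
rewrite /gstep; case: #|A| => [|n]; first by rewrite big_ord1 /= mulr0 addr0 !mul1r.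
rewrite big_ord_recl big_ord_recl big1 ?addr0 => [|j _]; last by rewrite !mul0r.
by rewrite /bump /= !mul1r expr1 subn1.
Qed.

End Step.
End Families.

(** * Specialisation of symmetric functions to an alphabet *)

Section Pairing.
Variable T : finType.
Implicit Types (u w : {perm T}) (A B : {set T}).

Section Eval.
Variables (k K : comNzRingType) (iota : {rmorphism k -> K}).

Definition pairing (x : {perm T} -> sfun T k) (Y : {perm T} -> sfun T K) A : K :=
  perm_sum (fun w B => iota (sapp (x w) B) * sapp (Y w) B) A.

Variables (Y : {perm T} -> sfun T K) (g : bool -> nat -> K).
Hypothesis alphY : alphabet Y g.

(* x is homogeneous of degree N and its characteristic specialises to v. *)
Definition evaluates (x : {perm T} -> sfun T k) (N : nat) (v : K) :=
  slocal x /\ forall A, pairing x Y A = (#|A| == N)%:R * v * (#|A|`!)%:R.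

Lemma evaluates0 N : evaluates (fun=> 0) N 0.
Proof.
split=> [|A]; first exact: slocal0.
by rewrite mulr0 mul0r /pairing /perm_sum big1 // => u _; rewrite sapp0 rmorph0 mul0r.
Qed.

Lemma evaluates_gen b n : evaluates (fun w => gen k b w n) n (g b n).
Proof.
split=> [|A]; first exact: slocal_gen.
rewrite /pairing /perm_sum; have [cA|ncA] := eqVneq #|A| n; last first.
  by rewrite !mul0r big1 // => u _; rewrite gen_neq // rmorph0 mul0r.
rewrite mul1r -cA -(alphabet_total alphY); apply: eq_bigr => u uA.
by rewrite genE perm_on_stb // eqxx sg_rmorph.
Qed.

Lemma evaluatesB x y N v v' :
  evaluates x N v -> evaluates y N v' -> evaluates (fun w => x w - y w) N (v - v').
Proof.
move=> [lx ex] [ly ey]; split=> [|A]; first exact: slocalB.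
rewrite mulrBr mulrBl -ex -ey /pairing /perm_sum -sumrB; apply: eq_bigr => u _.
by rewrite sappD sappN rmorphB mulrBl.
Qed.

(** [Y] is multiplicative over stable pieces, so pairing with it sends subset convolution to a
    Cauchy product; homogeneity leaves the single term with pieces of sizes [M] and [N]. *)
Lemma evaluatesM x y (M N : nat) v v' :
  evaluates x M v -> evaluates y N v' -> evaluates (fun w => x w * y w) (M + N)%N (v * v').
Proof.
move=> [lx ex] [ly ey]; split=> [|A]; first exact: slocalM.
have lY := alphabet_local alphY.
have lp z : slocal z -> local (fun w B => iota (sapp (z w) B) * sapp (Y w) B).
  move=> lz; apply: localM => //; move=> w B; have := lz w B.
  by case: ifP => _ ->; rewrite ?rmorph0.
transitivity (\sum_(B : {set T} | B \subset A) pairing x Y B * pairing y Y (A :\: B)).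
  under [RHS]eq_bigr => B sBA do
    rewrite /pairing -(perm_sum_split (lp _ lx) (lp _ ly) sBA).
  rewrite [RHS]exchange_big /=; apply: eq_bigr => u uA.
  rewrite sappM rmorph_sum big_distrl /=.
  apply: eq_bigr => B sBA.
  have [sB|nsB] := boolP (stb u B); last first.
    by rewrite [sapp (x u) B](local_out lx) // mul0r rmorph0 !mul0r.
  have sAB : stb u (A :\: B) by apply: stbD => //; apply: perm_on_stb.
  have ->: sapp (Y u) A = sapp (Y u) B * sapp (Y u) (A :\: B).
    rewrite -(alphabet_mult alphY) //; last first.
      by rewrite -setI_eq0 setIDA setIC -setIDA setDv setI0.
    by rewrite -{1}(setID A B) (setIidPr sBA).
  by rewrite rmorphM mulrACA.
under eq_bigr do rewrite ex ey.
rewrite (sum_subset_fact A (fun j => (j == M)%:R * v) (fun j => (j == N)%:R * v')).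
congr (_ * _); have [cA|ncA] := eqVneq #|A| (M + N)%N.
  have ltM : (M < #|A|.+1)%N by lia.
  rewrite (bigD1 (Ordinal ltM)) //= big1 => [|i neqi]; last first.
    have /negPf-> : (i : nat) != M by apply: contra neqi => /eqP eqi; apply/eqP/val_inj.
    by rewrite !mul0r.
  by rewrite eqxx cA addKn eqxx !mul1r addr0.
rewrite mul0r big1 // => j _; have := ltn_ord j.
case: eqP => [->|]; last by rewrite !mul0r.
case: eqP => [eqN|]; last by rewrite mul0r mulr0.
by rewrite ltnS => leM; case/eqP: ncA; lia.
Qed.

Local Notation hook_fam c n := (fun w => hook (gen k false w) (gen k true w) c n).

Lemma evaluates_hook c n :
  evaluates (hook_fam c n) (c + n).-1 (hook (g false) (g true) c n).
Proof.
elim: n c => [|n IHn] c; first exact: evaluates0.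
rewrite addnS; apply: evaluatesB; last by have := IHn c.+1; rewrite addSn.
by apply: evaluatesM; apply: evaluates_gen.
Qed.

Lemma evaluates_row_two_columns c p q : (0 < c)%N ->
  evaluates (fun w => row_two_columns (gen k false w) (gen k true w) c p q)
    (c + p + q)%N (row_two_columns (g false) (g true) c p q).
Proof.
move=> c_gt0; apply: evaluatesB.
  have ->: (c + p + q = p + (c + q.+1).-1)%N by lia.
  by apply: evaluatesM; [apply: evaluates_gen | apply: evaluates_hook].
have ->: (c + p + q = q.+1 + (c + p).-1)%N by lia.
by apply: evaluatesM; [apply: evaluates_gen | apply: evaluates_hook].
Qed.

Lemma evaluates_two_rows_two_columns c p q : (0 < c)%N -> (1 < p)%N ->
  evaluates (fun w => two_rows_two_columns (gen k false w) (gen k true w) c p q)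
    (c + p + c + q - 2)%N (two_rows_two_columns (g false) (g true) c p q).
Proof.
move=> c_gt0 p_gt1; apply: evaluatesB; first apply: evaluatesB.
- have ->: (c + p + c + q - 2 = (c + p).-1 + (c + q).-1)%N by lia.
  by apply: evaluatesM; apply: evaluates_hook.
- have ->: (c + p + c + q - 2 = (c + p.-1).-1 + (c + q.+1).-1)%N by lia.
  by apply: evaluatesM; apply: evaluates_hook.
have ->: (c + p + c + q - 2 = c.-1 + (c + p + q).-1)%N by lia.
apply: evaluatesM; first exact: evaluates_gen.
apply: evaluatesB.
  have ->: ((c + p + q).-1 = q + (c + p).-1)%N by lia.
  by apply: evaluatesM; [apply: evaluates_gen | apply: evaluates_hook].
have ->: ((c + p + q).-1 = p.-1 + (c + q.+1).-1)%N by lia.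
by apply: evaluatesM; [apply: evaluates_gen | apply: evaluates_hook].
Qed.

Lemma coef_pairing b x (Z : {perm T} -> sfun T K) A m :
  (perm_sum (fun w B => (iota (sapp (x w) B))%:P *
     sapp (smap polyC (Z w) * stepY Y b w) B) A)`_m =
  pairing x (fun w => Z w * (gen K b w m * Y w)) A.
Proof.
rewrite /pairing /perm_sum coef_sum; apply: eq_bigr => u _.
by rewrite coefCM coef_stepY.
Qed.

End Eval.

(** * Norms of the near-hook Schur functions *)

Section Norms.
Variable k : comNzRingType.
Local Notation h := (gen k false).
Local Notation e := (gen k true).
Implicit Types x z : {perm T} -> sfun T k.

Local Notation K1 := {poly k}.
Local Notation K2 := {poly K1}.
Local Notation K3 := {poly K2}.
Local Notation K4 := {poly K3}.

Definition avg_pair x z A : k := perm_sum (fun w B => sapp (x w) B * sapp (z w) B) A.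

(** Two odd variables, then two even ones. The last one added is outermost, so coefficients are
    extracted rows first and columns afterwards; each extraction pairs with one more [h] or [e]. *)
Definition g1 := stepg (fun _ n => (n == 0%N)%:R : k) true.
Definition g2 := stepg g1 true.
Definition g3 := stepg g2 false.
Definition g4 := stepg g3 false.

Lemma g1_true n : g1 true n = 'X ^+ n.
Proof.
by rewrite /g1 /stepg /=; elim: n => [|n IHn] /=; rewrite ?addr0 // IHn add0r -exprS.
Qed.

Let Y1 := stepY (fun _ : {perm T} => 1 : sfun T k) true.
Let Y2 := stepY Y1 true.
Let Y3 := stepY Y2 false.
Let Y4 := stepY Y3 false.

Let alph1 : alphabet Y1 g1. Proof. exact: alphabet_step (alphabet0 _ _) _. Qed.
Let alph2 : alphabet Y2 g2. Proof. exact: alphabet_step alph1 _. Qed.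
Let alph3 : alphabet Y3 g3. Proof. exact: alphabet_step alph2 _. Qed.
Let alph4 : alphabet Y4 g4. Proof. exact: alphabet_step alph3 _. Qed.

Let i1 : {rmorphism k -> K1} := polyC \o idfun.
Let i2 : {rmorphism k -> K2} := polyC \o i1.
Let i3 : {rmorphism k -> K3} := polyC \o i2.
Let i4 : {rmorphism k -> K4} := polyC \o i3.

Lemma eq_pairing (K : comNzRingType) (iota : k -> K) x (Y Z : {perm T} -> sfun T K) A :
  Y =1 Z -> perm_sum (fun w B => iota (sapp (x w) B) * sapp (Y w) B) A =
            perm_sum (fun w B => iota (sapp (x w) B) * sapp (Z w) B) A.
Proof. by move=> eqYZ; apply: eq_bigr => u _; rewrite eqYZ. Qed.

(** [Z] is the factor already extracted from a fourth variable, or 1 when there is none. *)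
Lemma avg_pair3_aux x (Z : {perm T} -> sfun T k) m a b A :
  (perm_sum (fun w B => i3 (sapp (x w) B) *
     sapp (smap i3 (Z w) * Y3 w) B) A)`_m`_a`_b =
  avg_pair x (fun w => Z w * (h w m * (e w a * e w b))) A.
Proof.
pose Z1 w := smap i1 (Z w); pose Z2 w := smap i2 (Z w).
have Z3 w : smap i3 (Z w) * Y3 w = smap polyC (Z2 w) * stepY Y2 false w.
  congr (_ * _).
  by apply/sfunP=> B; rewrite !sfunofE.
rewrite (eq_pairing _ _ _ Z3) (coef_pairing i2).
have Z4 w : Z2 w * (gen K2 false w m * Y2 w) =
    smap polyC (Z1 w * gen K1 false w m) * stepY Y1 true w.
  rewrite mulrA (smapM polyC) (smap_gen polyC); congr (_ * _ * _).
  by apply/sfunP=> B; rewrite !sfunofE.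
rewrite /pairing (eq_pairing _ _ _ Z4) (coef_pairing i1).
have Z5 w : Z1 w * gen K1 false w m * (gen K1 true w a * Y1 w) =
    smap polyC (Z w * h w m * e w a) * stepY (fun _ => 1) true w.
  by rewrite mulrA !(smapM polyC) !(smap_gen polyC).
rewrite /pairing (eq_pairing _ _ _ Z5) (coef_pairing idfun).
by apply: eq_pairing => w; rewrite mulr1 !mulrA.
Qed.

Lemma avg_pair3 x N v A m a b : evaluates i3 Y3 x N v ->
  avg_pair x (fun w => h w m * (e w a * e w b)) A =
  v`_m`_a`_b *+ (#|A| == N) *+ #|A|`!.
Proof.
case=> _ /(_ A) ex; rewrite -!coefMn.
have {}ex : pairing i3 x Y3 A = v *+ (#|A| == N) *+ #|A|`! by rewrite ex mulr_natl mulr_natr.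
have Z3 w : Y3 w = smap i3 (1 : sfun T k) * Y3 w by rewrite smap1 mul1r.
rewrite -ex /pairing (eq_pairing _ _ _ Z3) avg_pair3_aux.
by apply: eq_bigr => w _; rewrite mul1r.
Qed.

Lemma avg_pair4 x N v A m n a b : evaluates i4 Y4 x N v ->
  avg_pair x (fun w => h w m * (h w n * (e w a * e w b))) A =
  v`_m`_n`_a`_b *+ (#|A| == N) *+ #|A|`!.
Proof.
case=> _ /(_ A) ex; rewrite -!coefMn.
have {}ex : pairing i4 x Y4 A = v *+ (#|A| == N) *+ #|A|`! by rewrite ex mulr_natl mulr_natr.
rewrite -ex /pairing.
have Z4 w : Y4 w = smap polyC (1 : sfun T K3) * stepY Y3 false w.
  by rewrite (smap1 _ polyC) mul1r.
rewrite (eq_pairing _ _ _ Z4) (coef_pairing i3).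
have Z3 w : 1 * (gen K3 false w m * Y3 w) = smap i3 (h w m) * Y3 w.
  by rewrite mul1r smap_gen.
by rewrite /pairing (eq_pairing _ _ _ Z3) avg_pair3_aux.
Qed.

Lemma g1_false0 : g1 false 0 = 1.
Proof. by rewrite /g1 /stepg /= /gstep /= mulr0 addr0. Qed.

Lemma g2_false0 : g2 false 0 = 1.
Proof. by rewrite /g2 /stepg /= /gstep /= g1_false0 mulr0 addr0. Qed.

Lemma g3_false0 : g3 false 0 = 1.
Proof. by rewrite /g3 /stepg /= g2_false0 addr0. Qed.

Local Notation vF c p q := (row_two_columns (g3 false) (g3 true) c p q).
Local Notation vG c p q := (two_rows_two_columns (g4 false) (g4 true) c p q).

Lemma coef_vF_gt c p q m : (1 < c < m)%N -> (vF c p q)`_m = 0.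
Proof. by move=> lt_cm; rewrite row_two_columns_peel ?ifF //; lia. Qed.

Lemma coef_vF c p q a : (1 < c)%N -> (p <= q)%N -> (q <= a)%N ->
  (vF c p q)`_c`_a = if a == q then 'X^p else 0.
Proof.
move=> c_gt1 le_pq le_qa; rewrite row_two_columns_peel // leqnn subnn g2_false0 mul1r.
exact: two_columns_peel g1_true _ _.
Qed.

Lemma coef_vG c p q m : (0 < c <= m)%N ->
  (vG c p.+2 q.+1)`_m = if m == c then vF c p.+1 q else 0.
Proof. by move=> lt_cm; rewrite two_rows_two_columns_peel // g3_false0 mul1r. Qed.

Lemma avg_pairB x y z A : avg_pair x (fun w => y w - z w) A = avg_pair x y A - avg_pair x z A.
Proof.
rewrite /avg_pair /perm_sum -sumrB; apply: eq_bigr => u _.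
by rewrite sappD sappN mulrBr.
Qed.

Lemma avg_pair_sum x n (z : nat -> {perm T} -> sfun T k) A :
  avg_pair x (fun w => \sum_(r < n) (-1) ^+ r * z r w) A =
  \sum_(r < n) (-1) ^+ r * avg_pair x (z r) A.
Proof.
rewrite /avg_pair /perm_sum; under eq_bigr do rewrite sapp_sum big_distrr /=.
rewrite exchange_big /=; apply: eq_bigr => r _; rewrite big_distrr /=.
by apply: eq_bigr => u _; rewrite sapp_sign mulrCA.
Qed.

Lemma eq_pair x y z A : y =1 z -> avg_pair x y A = avg_pair x z A.
Proof. by move=> eq_yz; apply: eq_bigr => u _; rewrite eq_yz. Qed.

Local Notation F c p q := (fun w => row_two_columns (h w) (e w) c p q).
Local Notation G c p q := (fun w => two_rows_two_columns (h w) (e w) c p q).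

Lemma avg_pair_F c p q m a b A : (1 < c)%N -> (p <= q)%N -> #|A| = (c + p + q)%N ->
  avg_pair (F c p q) (fun w => h w m * (e w a * e w b)) A = (vF c p q)`_m`_a`_b *+ #|A|`!.
Proof.
move=> c_gt1 le_pq cA; rewrite (@avg_pair3 _ (c + p + q) (vF c p q)) ?cA ?eqxx //.
by apply: (evaluates_row_two_columns i3 alph3); lia.
Qed.

Lemma avg_pair_G c p q m n a b A : (1 < c)%N -> #|A| = (c + p.+2 + c + q.+1 - 2)%N ->
  avg_pair (G c p.+2 q.+1) (fun w => h w m * (h w n * (e w a * e w b))) A =
  (vG c p.+2 q.+1)`_m`_n`_a`_b *+ #|A|`!.
Proof.
move=> c_gt1 cA.
rewrite (@avg_pair4 _ (c + p.+2 + c + q.+1 - 2) (vG c p.+2 q.+1)) ?cA ?eqxx //.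
by apply: (evaluates_two_rows_two_columns i4 alph4); lia.
Qed.

Lemma avg_pair_F_top c p q A : (1 < c)%N -> (p <= q)%N -> #|A| = (c + p + q)%N ->
  avg_pair (F c p q) (fun w => h w c * (e w q * e w p)) A = (#|A|`!)%:R.
Proof. by move=> *; rewrite avg_pair_F // coef_vF // eqxx coefXn eqxx. Qed.

Lemma avg_pair_G_top c p q A : (1 < c)%N -> (p < q)%N ->
  #|A| = (c + p.+2 + c + q.+1 - 2)%N ->
  avg_pair (G c p.+2 q.+1) (fun w => h w c * (h w c * (e w q * e w p.+1))) A = (#|A|`!)%:R.
Proof.
move=> c_gt1 lt_pq cA; rewrite avg_pair_G // coef_vG ?eqxx; last by lia.
by rewrite coef_vF // eqxx coefXn eqxx.
Qed.

(** Expanding one of the two arguments by [hook_sum] gives signed products of one [h] and two [e].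
    Only the leading product h_c e_q e_p pairs nontrivially with the other argument: all others
    contain a row longer than [c] or a column longer than [q]. *)
Lemma norm_F c p q A : (1 < c)%N -> (p <= q)%N -> #|A| = (c + p + q)%N ->
  avg_pair (F c p q) (F c p q) A = (#|A|`!)%:R.
Proof.
move=> c_gt1 le_pq cA.
pose z1 r w := h w (c + r)%N * (e w (q - r)%N * e w p).
pose z2 r w := h w (c + r)%N * (e w q.+1 * e w (p.-1 - r)%N).
have FE : F c p q =1 fun w => \sum_(r < q.+1) (-1) ^+ r * z1 r w - \sum_(r < p) (-1) ^+ r * z2 r w.
  move=> w; rewrite /row_two_columns !hook_sum !big_distrr /=; congr (_ - _);
    by apply: eq_bigr => r _; rewrite /z1 /z2; ring.
rewrite (eq_pair _ _ FE) avg_pairB !avg_pair_sum big_ord_recl [X in _ + X - _]big1 => [|r _].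
  rewrite big1 => [|r _].
    by rewrite mul1r subr0 addr0 /z1 addn0 subn0 avg_pair_F_top.
  rewrite avg_pair_F //; case: (r : nat) => [|s].
    by rewrite addn0 coef_vF // ifF ?coef0 ?mul0rn ?mulr0 //; lia.
  by rewrite coef_vF_gt ?coef0 ?mul0rn ?mulr0 //; lia.
by rewrite /z1 lift0 avg_pair_F // coef_vF_gt ?coef0 ?mul0rn ?mulr0 //; lia.
Qed.

Lemma norm_G c p q A : (1 < c)%N -> (p < q)%N ->
  #|A| = (c + p.+2 + c + q.+1 - 2)%N ->
  avg_pair (G c p.+2 q.+1) (G c p.+2 q.+1) A = (#|A|`!)%:R.
Proof.
move=> c_gt1 lt_pq cA.
have sum0 n (f : nat -> k) : (forall r, f r.+1 = 0) ->
    \sum_(r < n.+1) (-1) ^+ r * f r = f 0.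
  by move=> f0; rewrite big_ord_recl big1 ?addr0 ?mul1r // => r _; rewrite f0 mulr0.
pose z1 r s w := h w (c + r)%N * (h w (c + s)%N * (e w (q - s)%N * e w (p.+1 - r)%N)).
pose z2 r s w := h w (c + r)%N * (h w (c + s)%N * (e w (q.+1 - s)%N * e w (p - r)%N)).
(* [z3] and [z4] contain the short row [c.-1], for which no coefficient is computed: at [r = 0] they
   are the same product and cancel, and for larger [r] the row [c + r] is too long. *)
pose z3 r w := h w (c + r)%N * (h w c.-1 * (e w q.+1 * e w (p.+1 - r)%N)).
pose z4 r w := h w (c + r)%N * (h w c.-1 * (e w (q.+1 - r)%N * e w p.+1)).
pose Z1 r w := \sum_(s < q.+1) (-1) ^+ s * z1 r s w.
pose Z2 r w := \sum_(s < q.+2) (-1) ^+ s * z2 r s w.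
have GE : G c p.+2 q.+1 =1 fun w =>
    (\sum_(r < p.+2) (-1) ^+ r * Z1 r w - \sum_(r < p.+1) (-1) ^+ r * Z2 r w)
    - (\sum_(r < p.+2) (-1) ^+ r * z3 r w - \sum_(r < q.+2) (-1) ^+ r * z4 r w).
  move=> w; rewrite /two_rows_two_columns [p.+2.-1]/= !hook_sum mulrBr.
  congr (_ - _ - (_ - _)).
  - rewrite big_distrl /=; apply: eq_bigr => r _; rewrite -mulrA /Z1; congr (_ * _).
    by rewrite mulr_sumr; apply: eq_bigr => s _; rewrite /z1 /=; ring.
  - rewrite big_distrl /=; apply: eq_bigr => r _; rewrite -mulrA /Z2; congr (_ * _).
    by rewrite mulr_sumr; apply: eq_bigr => s _; rewrite /z2 /=; ring.
  - by rewrite !mulr_sumr; apply: eq_bigr => r _; rewrite /z3 /=; ring.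
  by rewrite !mulr_sumr; apply: eq_bigr => r _; rewrite /z4 /=; ring.
have vG0 r : (vG c p.+2 q.+1)`_(c + r.+1) = 0.
  by rewrite coef_vG ?ifF //; lia.
have vGc : (vG c p.+2 q.+1)`_c = vF c p.+1 q by rewrite coef_vG ?eqxx //; lia.
have pZ1 r : avg_pair (G c p.+2 q.+1) (Z1 r) A =
    \sum_(s < q.+1) (-1) ^+ s * avg_pair (G c p.+2 q.+1) (z1 r s) A by apply: avg_pair_sum.
have pZ2 r : avg_pair (G c p.+2 q.+1) (Z2 r) A =
    \sum_(s < q.+2) (-1) ^+ s * avg_pair (G c p.+2 q.+1) (z2 r s) A by apply: avg_pair_sum.
have {}pZ1 : \sum_(r < p.+2) (-1) ^+ r * avg_pair (G c p.+2 q.+1) (Z1 r) A = (#|A|`!)%:R.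
  rewrite (sum0 _ (fun r => avg_pair _ (Z1 r) A)) => [|r]; last first.
    by rewrite pZ1 big1 // => s _; rewrite /z1 avg_pair_G // vG0 !coef0 mul0rn mulr0.
  rewrite pZ1 (sum0 _ (fun s => avg_pair _ (z1 0 s) A)) => [|s]; last first.
    by rewrite /z1 avg_pair_G // addn0 vGc coef_vF_gt ?coef0 ?mul0rn //; lia.
  by rewrite /z1 !addn0 !subn0 avg_pair_G_top.
have {}pZ2 : \sum_(r < p.+1) (-1) ^+ r * avg_pair (G c p.+2 q.+1) (Z2 r) A = 0.
  rewrite (sum0 _ (fun r => avg_pair _ (Z2 r) A)) => [|r]; last first.
    by rewrite pZ2 big1 // => s _; rewrite /z2 avg_pair_G // vG0 !coef0 mul0rn mulr0.
  rewrite pZ2 (sum0 _ (fun s => avg_pair _ (z2 0 s) A)) => [|s]; last first.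
    by rewrite /z2 avg_pair_G // addn0 vGc coef_vF_gt ?coef0 ?mul0rn //; lia.
  rewrite /z2 !addn0 !subn0 avg_pair_G // vGc coef_vF // ?ifF ?coef0 ?mul0rn //; lia.
rewrite (eq_pair _ _ GE) !avg_pairB !avg_pair_sum pZ1 pZ2.
rewrite (sum0 _ (fun r => avg_pair _ (z3 r) A)) => [|r]; last first.
  by rewrite /z3 avg_pair_G // vG0 !coef0 mul0rn.
rewrite (sum0 _ (fun r => avg_pair _ (z4 r) A)) => [|r]; last first.
  by rewrite /z4 avg_pair_G // vG0 !coef0 mul0rn.
by rewrite /z3 /z4 !subn0 subrr !subr0.
Qed.

End Norms.
End Pairing.

(** * Honest and virtual characters *)

Section InducedSums.
Variables (gT : finGroupType) (T : finType) (to : {action gT &-> T}).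
Variable G : {group gT}.
Implicit Types (y z : T) (X : {set T}).

Lemma cfInd_orbit (y : T) (H : {group gT}) (phi : 'CF(H)) (psi : T -> gT -> algC) w :
    H = 'C_G[y | to] :> {set gT} ->
    (forall g u, g \in G -> u \in G -> psi (to y g) (u ^ g)%g = psi y u) ->
    {in H, forall u, phi u = psi y u} -> w \in G ->
  'Ind[G] phi w = \sum_(z in orbit to G y | to z w == z) psi z w.
Proof.
move=> defH psiJ phiE Gw.
have sHG : H \subset G by rewrite defH subsetIl.
have memH u : u \in G -> (u \in H) = (to y u == y).
  by move=> Gu; rewrite defH inE Gu /=; apply/astab1P/eqP.
rewrite cfIndE // (reindex_inj invg_inj) /=.
under eq_bigl do rewrite groupV.
have phiV g : g \in G ->
    phi (w ^ g^-1)%g = if to (to y g) w == to y g then psi (to y g) w else 0.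
  move=> Gg; have -> : (to (to y g) w == to y g) = ((w ^ g^-1)%g \in H).
    rewrite memH ?groupJ ?groupV // conjgE invgK !actM.
    by rewrite (canF_eq (actKV to g)).
  case: ifP => [Hw|/negbT nHw]; last by rewrite cfun0.
  by rewrite phiE // -(psiJ g) ?groupJ ?groupV // conjgKV.
rewrite (eq_bigr _ phiV) (partition_big (to y) (mem (orbit to G y))) /=; last first.
  by move=> g Gg; apply: mem_orbit.
rewrite big_distrr /= [RHS]big_mkcondr /=; apply: eq_bigr => z /orbitP[a Ga <-].
rewrite (eq_bigr (fun=> if to (to y a) w == to y a then psi (to y a) w else 0));
  last by move=> g /andP[_ /eqP->].
rewrite sumr_const (_ : #|_| = #|H|).
  case: ifP => _; last by rewrite mul0rn mulr0.
  by rewrite -[X in _ * X]mulr_natl mulKf // neq0CG.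
rewrite -(card_rcoset H a) defH; apply: eq_card => g.
by rewrite -amove_act ?subsetT // [RHS]inE.
Qed.

(** Each point of [X] lies in the orbit of exactly one representative, so the choice of
    representatives disappears and every fixed point of [w] in [X] is counted once. *)
Lemma sum_cfInd_orbits X (H : T -> {group gT}) (phi : forall y, 'CF(H y))
    (psi : T -> gT -> algC) w :
    [acts G, on X | to] -> {in X, forall y, H y = 'C_G[y | to] :> {set gT}} ->
    (forall y g u, y \in X -> g \in G -> u \in G -> psi (to y g) (u ^ g)%g = psi y u) ->
    (forall y u, y \in X -> u \in H y -> phi y u = psi y u) -> w \in G ->
  \sum_(y in orbit_transversal to G X) 'Ind[G] (phi y) w =
  \sum_(y in X | to y w == y) psi y w.
Proof.
move=> actsG defH psiJ phiE Gw.
have [_ sub injX memX] := orbit_transversalP actsG.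
(* Points are sorted by the representative of their orbit; as one always exists, the default of
   [odflt] is only a placeholder. *)
rewrite [RHS](partition_big (fun y => odflt y [pick z in orbit_transversal to G X | y \in orbit to G z])
  (mem (orbit_transversal to G X))) /=; last first.
  move=> y /andP[Xy _]; case: pickP => [z /andP[]//|no].
  have [a Ga Xa] := memX y Xy; have := no (to y a).
  by rewrite Xa /= orbit_sym mem_orbit.
apply: eq_bigr => y Ry; have Xy := subsetP sub y Ry.
rewrite (@cfInd_orbit y _ _ psi) //; [|exact: defH|by move=> *; apply: psiJ|by move=> *; apply: phiE].
apply: eq_bigl => z; rewrite andbAC; case: (to z w == z); rewrite ?andbF ?andbT //=.
apply/idP/andP=> [zy|[Xz /eqP]].
  have Xz : z \in X by case/orbitP: zy => a Ga <-; rewrite (acts_act actsG).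
  split=> //; case: pickP => [t /andP[Rt zt]|/(_ y)]; last by rewrite Ry zy.
  by rewrite /= -injX //; apply: orbit_trans zt; rewrite orbit_sym.
case: pickP => [t /andP[Rt zt] <- //|no].
have [a Ga Xa] := memX z Xz; have := no (to z a).
by rewrite Xa /= orbit_sym mem_orbit.
Qed.

End InducedSums.

Section Honest.
Variable T : finType.
Local Notation fam := ({perm T} -> sfun T algC).
Implicit Types (u w g : {perm T}) (A B : {set T}) (x y : fam).

(** Conjugation invariance makes [x _ A] a class function on the stabiliser of [A], locality makes
    it blind to the complement of [A], and reality removes the conjugate from inner products. *)
Record natural x : Prop := Natural {
  natural_local : slocal x;
  natural_conj : forall w g A, sapp (x (w ^ g)%g) (g @: A) = sapp (x w) A;
  natural_real : forall w A, (sapp (x w) A)^* = sapp (x w) A }.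

Lemma natural_relabel x : slocal x -> (forall w A, (sapp (x w) A)^* = sapp (x w) A) ->
  (forall w g, relabel g (x (w ^ g)%g) = x w) -> natural x.
Proof. by move=> lx rx jx; split=> // w g A; rewrite -relabelE jx. Qed.

Lemma natural_gen b n : natural (fun w => gen algC b w n).
Proof.
apply: natural_relabel => [|w A|w g]; first exact: slocal_gen.
  by rewrite genE; case: ifP => _; rewrite ?rmorph0 // rmorph_sign.
apply: gen_intertwine => [|t]; first exact: perm_inj.
by rewrite conjgE !permM permK.
Qed.

Lemma natural0 : natural (fun=> 0).
Proof. by split=> [|w g A|w A]; rewrite ?sapp0 ?rmorph0 //; apply: slocal0. Qed.

Lemma naturalD x y : natural x -> natural y -> natural (fun w => x w + y w).
Proof.
move=> [lx jx rx] [ly jy ry]; split=> [|w g A|w A]; first exact: slocalD.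
  by rewrite !sappD jx jy.
by rewrite !sappD rmorphD /= rx ry.
Qed.

Lemma naturalM x y : natural x -> natural y -> natural (fun w => x w * y w).
Proof.
move=> [lx jx rx] [ly jy ry]; apply: natural_relabel => [|w A|w g].
- exact: slocalM.
- by rewrite !sappM rmorph_sum; apply: eq_bigr => B _; rewrite rmorphM /= rx ry.
rewrite relabelM; last exact: perm_inj.
by congr (_ * _); apply/sfunP=> A; rewrite relabelE.
Qed.

(* The class function [x _ A] of the stabiliser of A is an honest character. *)
Definition honest x : Prop := natural x /\ forall A,
  exists2 chi : 'CF('N(A | 'P)), chi \is a character &
    {in 'N(A | 'P), forall w, chi w = sapp (x w) A}.

Lemma eq_honest x y : x =1 y -> honest x -> honest y.
Proof.
move=> eqxy [[lx jx rx] hx]; split=> [|A].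
  by split=> [w A|w g A|w A]; rewrite -!eqxy; [apply: lx | apply: jx | apply: rx].
by have [chi ? chiE] := hx A; exists chi => // w Nw; rewrite chiE // eqxy.
Qed.

Lemma honest0 : honest (fun=> 0).
Proof.
split=> [|A]; first exact: natural0.
by exists 0 => [|w _]; rewrite ?rpred0 // cfunE sapp0.
Qed.

Lemma honestD x y : honest x -> honest y -> honest (fun w => x w + y w).
Proof.
move=> [nx hx] [ny hy]; split=> [|A]; first exact: naturalD.
have [chi chiC chiE] := hx A; have [xi xiC xiE] := hy A.
by exists (chi + xi) => [|w Nw]; rewrite ?rpredD // cfunE sappD chiE // xiE.
Qed.

Lemma honest_gen b n : honest (fun w => gen algC b w n).
Proof.
split=> [|A]; first exact: natural_gen.
have [cA|ncA] := eqVneq #|A| n; last first.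
  by exists 0 => [|w _]; rewrite ?rpred0 // cfunE gen_neq.
have repP : mx_repr 'N(A | 'P) (fun w => (sg algC b w A)%:M : 'M_1).
  split=> [|w u Nw Nu]; last by rewrite sgM // scalar_mxM.
  have := odd_onM (group1 'N(A | 'P)) (group1 'N(A | 'P)).
  by rewrite mulg1 addbb /sg => ->; rewrite andbF.
exists (cfRepr (MxRepresentation repP)) => [|w Nw]; first exact: cfRepr_char.
by rewrite cfunE Nw /= mulr1n mxtrace_scalar mulr1n genE cA eqxx andbT ifT.
Qed.

(** The witness is an induction product: over representatives [B] of the subsets of [A], the
    restricted characters for [B] and [A :\: B] are multiplied on the common stabiliser and induced
    up. [sum_cfInd_orbits] identifies its values with the subset convolution. *)
Lemma honestM x y : honest x -> honest y -> honest (fun w => x w * y w).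
Proof.
move=> [nx hx] [ny hy]; split=> [|A]; first exact: naturalM.
have [chi chiC chiE] := fin_all_exists2 hx.
have [xi xiC xiE] := fin_all_exists2 hy.
pose G := 'N(A | 'P)%G; pose H B := 'C_G[B | 'P^*]%G.
pose psi B w := sapp (x w) B * sapp (y w) (A :\: B).
pose phi B : 'CF(H B) := 'Res[H B] (chi B) * 'Res[H B] (xi (A :\: B)).
exists (\sum_(B in orbit_transversal 'P^* G (powerset A)) 'Ind[G] (phi B)).
  apply: rpred_sum => B _; apply: cfInd_char; apply: rpredM; apply: cfRes_char;
    [exact: chiC | exact: xiC].
move=> w Gw; rewrite sum_cfunE.
have stabJ u B : ('P^*%act B u == B) = stb u B.
  by rewrite /stb -astab1_set; apply/eqP/idP=> /astab1P.
have actsA : [acts G, on powerset A | 'P^*].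
  apply/actsP=> u Gu B; rewrite !powersetE; apply/subsetP/subsetP=> sBA t tB.
    by rewrite -(stbP _ _ Gu); apply/sBA/imset_f.
  by have /imsetP[s /sBA sA ->] := tB; rewrite [_ \in _](stbP _ _ Gu).
have HE B u : B \subset A -> u \in H B -> [/\ u \in G, stb u B & stb u (A :\: B)].
  move=> sBA /setIP[Gu /astab1P/eqP]; rewrite stabJ => sB; split=> //.
  exact: stbD.
rewrite (@sum_cfInd_orbits _ _ _ _ _ H phi psi) //.
- rewrite sappM; apply/esym; rewrite (bigID (fun B => stb w B)) /= [X in _ + X]big1 ?addr0.
    by apply: eq_big => [B|B _]; rewrite // powersetE stabJ.
  by move=> B /andP[_ nsB]; rewrite (local_out (natural_local nx)) // mul0r.
- move=> B g u; rewrite powersetE => sBA Gg Gu; rewrite /psi.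
  rewrite -[in RHS](natural_conj nx _ g) -[in RHS](natural_conj ny _ g).
  have gA : g @: A = A by apply/eqP; have := Gg; rewrite -[g \in _]/(stb g A) -stabJ.
  congr (_ * sapp _ _); rewrite -{1}gA; apply/setP=> t; rewrite inE.
  apply/andP/imsetP=> [[nB /imsetP[s sA def_t]]|[s /setDP[sA nsB] ->]].
    exists s; rewrite // inE sA andbT; apply: contra nB => sB.
    by rewrite def_t (imset_f (aperm^~ g)).
  split; last exact: imset_f.
  by apply: contra nsB => /imsetP[r rB /perm_inj->].
move=> B u; rewrite powersetE => sBA uH; have [Gu sB sAB] := HE _ _ sBA uH.
have sHB : H B \subset 'N(B | 'P) by apply/subsetP=> v /(HE _ _ sBA)[].
have sHAB : H B \subset 'N(A :\: B | 'P) by apply/subsetP=> v /(HE _ _ sBA)[].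
by rewrite cfunE !cfResE // chiE ?xiE.
Qed.

End Honest.

(** * Virtual characters of norm one *)

Section Virtual.
Variable T : finType.
Local Notation fam := ({perm T} -> sfun T algC).
Implicit Types (u w g : {perm T}) (A B : {set T}) (x y z : fam).

Definition virtual x : Prop :=
  exists y z, [/\ honest y, honest z & x =1 fun w => y w - z w].

Lemma virtual_honest x : honest x -> virtual x.
Proof.
by move=> hx; exists x, (fun=> 0); split=> // [|w]; [exact: honest0 | rewrite subr0].
Qed.

Lemma virtualB x y : virtual x -> virtual y -> virtual (fun w => x w - y w).
Proof.
move=> [a [b [ha hb xE]]] [c [d [hc hd yE]]].
exists (fun w => a w + d w), (fun w => b w + c w).
split=> [||w]; [exact: honestD | exact: honestD | rewrite xE yE; ring].
Qed.

Lemma virtualM x y : virtual x -> virtual y -> virtual (fun w => x w * y w).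
Proof.
move=> [a [b [ha hb xE]]] [c [d [hc hd yE]]].
exists (fun w => a w * c w + b w * d w), (fun w => a w * d w + b w * c w).
split=> [||w]; try by apply: honestD; apply: honestM.
by rewrite xE yE; ring.
Qed.

Lemma virtual_natural x : virtual x -> natural x.
Proof.
move=> [a [b [[[la ja ra] _] [[lb jb rb] _] xE]]].
split=> [w A|w g A|w A]; rewrite ?xE.
- exact: slocalB la lb w A.
- by rewrite !sappD !sappN ja jb.
by rewrite !sappD !sappN rmorphB /= ra rb.
Qed.

Lemma virtual_vchar x A : virtual x -> exists2 chi : 'CF('N(A | 'P)),
  chi \in 'Z[irr 'N(A | 'P)] & {in 'N(A | 'P), forall w, chi w = sapp (x w) A}.
Proof.
move=> [a [b [[_ ha] [_ hb] xE]]].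
have [chi chiC chiE] := ha A; have [xi xiC xiE] := hb A.
exists (chi - xi) => [|w Nw]; first by rewrite rpredB ?char_vchar.
by rewrite !cfunE chiE // xiE // xE sappD sappN.
Qed.

Local Notation h w := (gen algC false w).
Local Notation e w := (gen algC true w).

Lemma virtual_gen b n : virtual (fun w => gen algC b w n).
Proof. exact/virtual_honest/honest_gen. Qed.

Lemma virtual_hook c n : virtual (fun w => hook (h w) (e w) c n).
Proof.
elim: n c => [|n IHn] c; first exact/virtual_honest/honest0.
by apply: virtualB => //; apply: virtualM; apply: virtual_gen.
Qed.

(** The stabiliser of [A] is the product of the symmetric groups of [A] and of its complement; by
    locality the second only multiplies the sum and the group order by the same factorial. *)
Lemma cfdot_pair x y A (chi xi : 'CF('N(A | 'P))) : natural x -> natural y ->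
  {in 'N(A | 'P), forall w, chi w = sapp (x w) A} ->
  {in 'N(A | 'P), forall w, xi w = sapp (y w) A} ->
  '[chi, xi] = avg_pair x y A / (#|A|`!)%:R.
Proof.
move=> nx ny chiE xiE.
have lxy : local (fun w B => sapp (x w) B * sapp (y w) B).
  exact: localM (natural_local nx) (natural_local ny).
have lone : local (fun w B => (stb w B)%:R : algC) by apply: local_stb.
have sumN phi : local phi -> \sum_(w in 'N(A | 'P)) phi w A =
    perm_sum phi A * (#|~: A|`!)%:R :> algC.
  move=> lphi; rewrite -perm_sum_stb -setTD -perm_sum_split ?subsetT // setTD.
  rewrite [LHS]big_mkcond [RHS]big_mkcond; apply: eq_bigr => w _.
  have -> : perm_on setT w by apply/subsetP=> t _; rewrite inE.
  rewrite -[w \in _]/(stb w A); case: ifP => [sA|/negbT nsA].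
    by rewrite stbC sA mulr1.
  by rewrite (local_out lphi) // mul0r.
rewrite cfdotE (eq_bigr (fun w => sapp (x w) A * sapp (y w) A)) => [|w Nw]; last first.
  by rewrite chiE // xiE // (natural_real ny).
rewrite (sumN _ lxy) -/(avg_pair x y A).
have -> : #|'N(A | 'P)|%:R = (#|A|`!)%:R * (#|~: A|`!)%:R :> algC.
  rewrite -{1}perm_sum_stb -sumN // -sumr_const; apply: eq_bigr => w.
  by rewrite -[w \in _]/(stb w A) => ->.
have nz m : (m`!)%:R != 0 :> algC by rewrite Num.Theory.pnatr_eq0 -lt0n fact_gt0.
by field; rewrite !nz.
Qed.

(* A virtual character of norm 1 is an irreducible character up to sign, and a
   positive pairing with an honest character fixes the sign. *)
Lemma honest_norm1 x y N : virtual x -> honest y ->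
    (forall w A, #|A| != N -> sapp (x w) A = 0) ->
    (forall A, #|A| = N -> avg_pair x x A = (#|A|`!)%:R) ->
    (forall A, #|A| = N -> avg_pair x y A = (#|A|`!)%:R) ->
  honest x.
Proof.
move=> vx hy x0 xx xy; have nx := virtual_natural vx; split=> // A.
have [cA|ncA] := eqVneq #|A| N; last first.
  by exists 0 => [|w _]; rewrite ?rpred0 // cfunE x0.
have [chi Zchi chiE] := virtual_vchar A vx.
have [ny /(_ A)[xi xiC xiE]] := hy.
have nz m : (m`!)%:R != 0 :> algC by rewrite Num.Theory.pnatr_eq0 -lt0n fact_gt0.
have n1 : '[chi] = 1 by rewrite (cfdot_pair nx nx chiE chiE) xx // divff.
have p1 : '[chi, xi] = 1 by rewrite (cfdot_pair nx ny chiE xiE) xy // divff.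
exists chi => //; have [b [i def_chi]] := vchar_norm1P Zchi n1.
case: b def_chi => def_chi; last by rewrite def_chi scale1r irr_char.
have := Cnat_cfdot_char (irr_char i) xiC; case/Num.Theory.natrP=> m def_m.
have /eqP := p1; rewrite def_chi cfdotZl def_m mulN1r -subr_eq0 -opprD oppr_eq0 natr1.
by rewrite Num.Theory.pnatr_eq0.
Qed.

Lemma honest_row_two_columns c p q : (1 < c)%N -> (p <= q)%N ->
  honest (fun w => row_two_columns (h w) (e w) c p q).
Proof.
move=> c_gt1 le_pq.
apply: (@honest_norm1 _ (fun w => h w c * (e w q * e w p)) (c + p + q)%N).
- by apply: virtualB; apply: virtualM; (exact: virtual_gen || exact: virtual_hook).
- by do 2?apply: honestM; apply: honest_gen.
- by move=> w A; apply: homogeneous_row_two_columns; lia.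
- by move=> A cA; apply: norm_F.
by move=> A cA; apply: avg_pair_F_top.
Qed.

Lemma honest_two_rows_two_columns c p q : (1 < c)%N -> (p < q)%N ->
  honest (fun w => two_rows_two_columns (h w) (e w) c p.+2 q.+1).
Proof.
move=> c_gt1 lt_pq.
apply: (@honest_norm1 _ (fun w => h w c * (h w c * (e w q * e w p.+1)))
  (c + p.+2 + c + q.+1 - 2)%N).
- do !(apply: virtualB || apply: virtualM || apply: virtual_gen || apply: virtual_hook).
- by do 3?apply: honestM; apply: honest_gen.
- by move=> w A; apply: homogeneous_two_rows_two_columns; lia.
- by move=> A cA; apply: norm_G.
by move=> A cA; apply: avg_pair_G_top.
Qed.

(** For [c > 1] a hook is (c, 2^p, 1^(q-p)) with [p = 0]; for [c = 1] it is a column, outside the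
    range of the norm computation. *)
Lemma honest_hook c n : (0 < c)%N -> honest (fun w => hook (h w) (e w) c n).
Proof.
case: n => [|n] c_gt0; first exact: honest0.
case: c c_gt0 => // -[|c] _.
  apply: (eq_honest _ (honest_gen T true n.+1)) => w; rewrite hook_column ?gen0 //; apply: sum_e_h.
have := @honest_row_two_columns c.+2 0 n isT (leq0n _); apply: eq_honest => w.
by rewrite row_two_columns_hook ?gen0.
Qed.

End Virtual.

(** * Log-concavity *)

Section LogConcavity.
Variables (T : finType) (c : nat).
Hypothesis c_gt0 : (0 < c)%N.
Implicit Types w : {perm T}.
Local Notation h w := (gen algC false w).
Local Notation e w := (gen algC true w).
Local Notation H w := (hook (h w) (e w)).

Lemma honest_columns p q : (p <= q)%N ->
  honest (fun w : {perm T} => e w p.+1 * e w q.+1 - e w p * e w q.+2).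
Proof.
move=> le_pq; apply: eq_honest (@honest_row_two_columns T 2 p q isT le_pq) => w.
by rewrite (@mul_columns_sub _ (h w)) ?gen0 //; apply: sum_e_h.
Qed.

Lemma honest_hooks p q : (p < q)%N ->
  honest (fun w : {perm T} => H w c p.+2 * H w c q.+1 - H w c p.+1 * H w c q.+2).
Proof.
move=> lt_pq; case: c c_gt0 => // -[|d] _.
  apply: eq_honest (@honest_columns p.+1 q lt_pq) => w.
  by rewrite !hook_column ?gen0 //; apply: sum_e_h.
apply: eq_honest (honestD (honestM (honest_gen T false d.+1)
    (@honest_row_two_columns T d.+3 p.+1 q isT lt_pq))
  (@honest_two_rows_two_columns T d.+2 p q isT lt_pq)) => w.
by rewrite hook_hook_sub.
Qed.

Lemma honest_column_hook i m : (i <= m)%N ->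
  honest (fun w : {perm T} => e w i.+1 * H w c m.+1 - e w i * H w c m.+2).
Proof.
move=> le_im; have h2 := @honest_row_two_columns T c.+1 i m c_gt0 le_im.
suff h1 : honest (fun w : {perm T} => row_two_columns (h w) (e w) c i.+1 m).
  by apply: eq_honest (honestD h1 h2) => w; rewrite column_hook_sub.
have [eq_im|ne_im] := eqVneq i m.
  by apply: eq_honest (honest0 T) => w; rewrite eq_im /row_two_columns subrr.
have [c1|c_gt1] := leqP c 1.
  have {c1}-> : c = 1%N by lia.
  apply: eq_honest (honest0 T) => w; rewrite /row_two_columns.
  rewrite !hook_column ?gen0 //; try exact: sum_e_h.
  by rewrite mulrC subrr.
by apply: honest_row_two_columns => //; lia.
Qed.

Variable k : nat.

(* The coefficients of the equivariant inverse Z-polynomial. *)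
Definition zcoef i w := e w (minn i (k - i)) * H w c (maxn i (k - i)).

(** The left half of the sequence; the right half is its mirror image under the exchange of i and
    k-i. *)
Let a i w := e w i * H w c (k - i).

Lemma zcoef_low i w : (i.*2 <= k)%N -> zcoef i w = a i w.
Proof. by move=> le_ik; rewrite /zcoef /a; congr (e w _ * H w c _); lia. Qed.

Lemma zcoef_high i w : (k <= i.*2)%N -> (i <= k)%N -> zcoef i w = a (k - i) w.
Proof. by move=> ? ?; rewrite /zcoef /a; congr (e w _ * H w c _); lia. Qed.

Lemma honest_zcoef i : honest (zcoef i).
Proof. by apply: honestM; [apply: honest_gen | apply: honest_hook]. Qed.

Lemma honest_low_mono i : (i.+1.*2 <= k)%N -> honest (fun w => a i.+1 w - a i w).
Proof.
move=> le_ik; have [m def_m] : exists m, (k - i.+1 = m.+1)%N by exists (k - i.+2)%N; lia.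
have le_im : (i <= m)%N by lia.
apply: eq_honest (honest_column_hook le_im) => w; rewrite /a def_m.
by have -> : (k - i = m.+2)%N by lia.
Qed.

(** The product rule for log-concavity: the difference is e_(i+1) e_j times a difference of products
    of hooks, plus a product of two hooks times a difference of products of columns. *)
Lemma honest_low_mul i j : (i < j)%N -> (j.+1.*2 <= k)%N ->
  honest (fun w => a i.+1 w * a j w - a i w * a j.+1 w).
Proof.
case: j => // j lt_ij le_jk.
have [p def_p] : exists p, (k - j.+1 = p.+2)%N by exists (k - j.+3)%N; lia.
have [q def_q] : exists q, (k - i.+1 = q.+1)%N by exists (k - i.+2)%N; lia.
have lt_pq : (p < q)%N by lia.
have h1 := honestM (honestM (honest_gen T true i.+1) (honest_gen T true j.+1)) (honest_hooks lt_pq).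
have h2 := honestM (honestM (honest_hook T p.+1 c_gt0) (honest_hook T q.+2 c_gt0))
             (@honest_columns i j lt_ij).
apply: eq_honest (honestD h1 h2) => w; rewrite /a def_p def_q.
have [-> ->] : (k - i = q.+2 /\ k - j.+2 = p.+1)%N by lia.
move: (H w c p.+1) (H w c p.+2) (H w c q.+1) (H w c q.+2) => x1 x2 x3 x4.
by move: (e w _) (e w i.+1) (e w j.+1) (e w j.+2) => y1 y2 y3 y4; ring.
Qed.

(** Either both indices lie in the left half, or both in the right half, which is the mirror image,
    or they straddle the middle. In the last case monotonicity on each side is enough, by (C_i -
    C_(i-1)) C_j + C_(i-1) (C_j - C_(j+1)). *)
Lemma honest_zcoef_sub i j : (0 < i)%N -> (i <= j)%N -> (j < k)%N ->
  honest (fun w => zcoef i w * zcoef j w - zcoef i.-1 w * zcoef j.+1 w).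
Proof.
case: i => // i _ lt_ij lt_jk; rewrite [i.+1.-1]/=.
have [le_jk|gt_jk] := leqP j.+1.*2 k.
  apply: eq_honest (@honest_low_mul i j lt_ij le_jk) => w.
  by rewrite !zcoef_low //; lia.
have [le_ki|gt_ki] := leqP k i.*2.
  have lt' : (k - j.+1 < k - i.+1)%N by lia.
  have le' : ((k - i.+1).+1.*2 <= k)%N by lia.
  apply: eq_honest (honest_low_mul lt' le') => w.
  rewrite !zcoef_high; try lia.
  have [-> ->] : ((k - j.+1).+1 = k - j /\ (k - i.+1).+1 = k - i)%N by lia.
  ring.
have h1 : honest (fun w => zcoef i.+1 w - zcoef i w).
  have [le_ik|gt_ik] := leqP i.+1.*2 k.
    by apply: eq_honest (honest_low_mono le_ik) => w; rewrite !zcoef_low //; lia.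
  (* Here [k] is odd and the two indices are the two middle ones, so the coefficients are equal. *)
  apply: eq_honest (honest0 T) => w; rewrite zcoef_high; try lia.
  rewrite zcoef_low; last by lia.
  have -> : (k - i.+1 = i)%N by lia.
  by rewrite subrr.
have h2 : honest (fun w => zcoef j w - zcoef j.+1 w).
  have [le_kj|gt_kj] := leqP k j.*2.
    have le' : ((k - j.+1).+1.*2 <= k)%N by lia.
    apply: eq_honest (honest_low_mono le') => w; rewrite !zcoef_high; try lia.
    by have -> : ((k - j.+1).+1 = k - j)%N by lia.
  apply: eq_honest (honest0 T) => w; rewrite zcoef_low; last by lia.
  rewrite zcoef_high; try lia.
  have -> : (k - j.+1 = j)%N by lia.
  by rewrite subrr.
apply: eq_honest (honestD (honestM h1 (honest_zcoef j)) (honestM (honest_zcoef i) h2)) => w.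
ring.
Qed.

End LogConcavity.

(** * Kazhdan--Lusztig identities in a commutative ring *)

Section CauchyProduct.
Variable R : comNzRingType.
Implicit Types f g k : nat -> R.

Definition sconv f g (n : nat) : R := \sum_(j < n.+1) f j * g (n - j)%N.

Definition sdelta (n : nat) : R := (n == 0%N)%:R.

Lemma sconv_coef f g n m : (n <= m)%N ->
  sconv f g n = ((\poly_(i < m.+1) f i) * (\poly_(i < m.+1) g i))`_n.
Proof.
move=> le_nm; rewrite coefM; apply: eq_bigr => j _; rewrite !coef_poly.
by have [-> ->] : (j < m.+1)%N /\ (n - j < m.+1)%N by have := ltn_ord j; lia.
Qed.

Lemma sconvC f g n : sconv f g n = sconv g f n.
Proof. by rewrite !(@sconv_coef _ _ n n) // mulrC. Qed.

Lemma sconvA f g k n : sconv f (sconv g k) n = sconv (sconv f g) k n.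
Proof.
pose P u : {poly R} := \poly_(i < n.+1) u i.
have coefP u i : (i < n.+1)%N -> (P u)`_i = u i by move=> lt_in; rewrite coef_poly lt_in.
have sub u v i (w : {poly R}) : (i < n.+1)%N -> (P (sconv u v) * w)`_i = (P u * P v * w)`_i.
  move=> lt_in; rewrite !coefM; apply: eq_bigr => j _; congr (_ * _).
  have lt_jn : (j < n.+1)%N by have := ltn_ord j; lia.
  by rewrite coefP // (@sconv_coef _ _ _ n).
rewrite !(@sconv_coef _ _ n n) // [LHS](congr1 (fun p : {poly R} => p`_n) (mulrC _ _)).
by rewrite !sub // mulrC mulrA.
Qed.

Lemma eq_sconv f f' g g' n : (forall i, (i <= n)%N -> f i = f' i) ->
  (forall i, (i <= n)%N -> g i = g' i) -> sconv f g n = sconv f' g' n.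
Proof.
move=> eqf eqg; apply: eq_bigr => j _; rewrite eqf ?eqg ?leq_subr //.
by rewrite -ltnS.
Qed.

Lemma sconv1 f n : sconv sdelta f n = f n.
Proof.
rewrite /sconv big_ord_recl /sdelta mul1r subn0 big1 ?addr0 // => j _.
by rewrite mul0r.
Qed.

Lemma sconvN f g n : sconv f (fun i => - g i) n = - sconv f g n.
Proof. by rewrite -sumrN; apply: eq_bigr => j _; rewrite mulrN. Qed.

Lemma sconvD f g g' n : sconv f (fun i => g i + g' i) n = sconv f g n + sconv f g' n.
Proof. by rewrite -big_split; apply: eq_bigr => j _; rewrite mulrDr. Qed.

Lemma sconv_trunc f g n : g 0%N = 0 -> sconv f g n = \sum_(j < n) f j * g (n - j)%N.
Proof. by move=> g0; rewrite /sconv big_ord_recr /= subnn g0 mulr0 addr0. Qed.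

Variable t : R.

Definition twist f (n : nat) : R := t ^+ n * f n.

Lemma twist_sconv f g n : twist (sconv f g) n = sconv (twist f) (twist g) n.
Proof.
rewrite /twist /sconv mulr_sumr; apply: eq_bigr => j _.
by rewrite mulrACA -exprD subnKC // -ltnS.
Qed.

Lemma twist_delta n : twist sdelta n = sdelta n.
Proof. by rewrite /twist /sdelta; case: n => [|n]; rewrite ?mulr0 ?mulr1. Qed.

(* In the Kazhdan--Lusztig identity of the uniform matroid the sequences below
   are graded by rank: eh is the signed elementary family (the Moebius invariant
   of Boolean matroids), ge records the single flat of maximal rank, mu is the
   Moebius invariant, qh the signed inverse Kazhdan--Lusztig polynomial and qr
   its reversal. *)
Variables (eh h ge qh qr : nat -> R).
Hypothesis ehh : forall n, sconv eh h n = sdelta n.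

Definition useq_mu n := - sconv eh ge n.
Definition useq_char n := useq_mu n + sconv eh (twist ge) n.
Definition useq_bool n := sconv (twist h) eh n.
Definition useq_KL n := - sconv h qh n.

Lemma useq_geE n : ge n = - sconv h useq_mu n.
Proof.
by rewrite sconvN opprK sconvA -[LHS]sconv1; apply: eq_sconv => // i _;
  rewrite -ehh sconvC.
Qed.

Hypothesis qhr : forall n,
  qh n - qr n = sconv (twist eh) useq_mu n - sconv eh (twist useq_mu) n.

(** In terms of generating series, [eh] inverts [h] and [ge] is -h mu. Both sides become minus
    [twist h] times [qh], plus the same two terms in [mu]; [qhr] is exactly what trades the reversal
    [qr] for [qh]. *)
Lemma useq_KLE n :
  - sconv (twist h) qr n = useq_char n + sconv useq_bool useq_KL n.
Proof.
have hehE m : sconv h eh m = sdelta m by rewrite sconvC ehh.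
have twE m : sconv (twist h) (twist eh) m = sdelta m.
  by rewrite -twist_sconv -twist_delta /twist hehE.
have qrE m : qr m = qh m + (sconv eh (twist useq_mu) m - sconv (twist eh) useq_mu m).
  by rewrite -opprB -qhr; ring.
have -> : sconv (twist h) qr n = sconv (twist h) qh n +
    (sconv (twist h) (sconv eh (twist useq_mu)) n - useq_mu n).
  rewrite (eq_sconv (f' := twist h) (g' := fun m => qh m +
    (sconv eh (twist useq_mu) m - sconv (twist eh) useq_mu m))) //.
  rewrite sconvD sconvD sconvN [sconv _ (sconv (twist eh) _) _]sconvA.
  congr (_ + (_ - _)); rewrite -[RHS]sconv1; exact: eq_sconv.
have -> : sconv useq_bool useq_KL n = - sconv (twist h) qh n.
  rewrite sconvN sconvA; congr (- _); apply: eq_sconv => // i _.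
  rewrite /useq_bool -sconvA (eq_sconv (f' := twist h) (g' := sdelta)) //.
  by rewrite sconvC sconv1.
have -> : useq_char n = useq_mu n - sconv (twist h) (sconv eh (twist useq_mu)) n.
  have -> : sconv (twist h) (sconv eh (twist useq_mu)) n =
      sconv eh (sconv (twist h) (twist useq_mu)) n.
    by rewrite !sconvA; apply: eq_sconv => // i _; apply: sconvC.
  rewrite /useq_char; congr (_ + _).
  rewrite -sconvN; apply: eq_sconv => // i _.
  by rewrite -twist_sconv /twist useq_geE mulrN.
ring.
Qed.

End CauchyProduct.

(** * Equivariant polynomials of uniform matroids *)

Section UniformMatroid.
Variable T : finType.
Implicit Types (A B F S : {set T}) (k : nat).

Fact unif_subproof S k :
  matroid_axiom (S, [set A : {set T} | (A \subset S) && (#|A| <= k)%N]).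
Proof.
apply/matroid_axiomP; split=> [|A|A B|A B]; rewrite ?inE ?sub0set ?cards0 //.
- by case/andP.
- case/andP=> sAS cA sBA; rewrite (subset_trans sBA sAS).
  exact: leq_trans (subset_leq_card sBA) cA.
case/andP=> sAS cA /andP[sBS cB] ltAB; case: (boolP (B \subset A)) => [/subset_leq_card|].
  by rewrite leqNgt ltAB.
case/subsetPn=> x xB nxA; exists x; split=> //.
rewrite inE cardsU1 nxA (leq_trans ltAB) // subUset sub1set sAS.
by rewrite (subsetP sBS).
Qed.

(** Ground sets are subsets of one fixed type, so that restriction to a flat and contraction of a
    flat stay within this family. *)
Definition unif S k : matroid T := Matroid (unif_subproof S k).

Lemma ground_unif S k : ground (unif S k) = S.
Proof. by []. Qed.

Lemma indep_unif S k A : (A \in indep (unif S k)) = (A \subset S) && (#|A| <= k)%N.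
Proof. by rewrite inE. Qed.

Lemma eq_matroid (M N : matroid T) :
  ground M = ground N -> indep M =i indep N -> M = N.
Proof.
move=> eqG eqI; apply: val_inj; rewrite /= [matroid_val M]surjective_pairing.
by rewrite [matroid_val N]surjective_pairing; congr (_, _) => //; apply/setP.
Qed.

Lemma rk_le (M : matroid T) A B : A \in indep M -> A \subset B -> (#|A| <= rk M B)%N.
Proof.
move=> AI sAB; rewrite /rk.
by apply: (@leq_bigmax_cond _ (fun A => (A \in indep M) && (A \subset B)) (fun A : {set T} => #|A|) A);
  rewrite AI sAB.
Qed.

Lemma exists_subset_card A m : (m <= #|A|)%N -> exists2 B : {set T}, B \subset A & #|B| = m.
Proof.
move=> le_mA; have : (0 < #|[set B : {set T} | (B \subset A) & #|B| == m]|)%N.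
  by rewrite cards_draws bin_gt0.
by case/card_gt0P=> B; rewrite inE => /andP[sBA /eqP cB]; exists B.
Qed.

Lemma rk_unif S k F : F \subset S -> rk (unif S k) F = minn k #|F|.
Proof.
move=> sFS; apply/eqP; rewrite eqn_leq; apply/andP; split.
  apply/bigmax_leqP=> A /andP[]; rewrite indep_unif => /andP[_ cA] sAF.
  by rewrite leq_min cA subset_leq_card.
have [B sBF cB] := exists_subset_card (geq_minr k #|F|).
rewrite -[X in (X <= _)%N]cB; apply: rk_le => //.
by rewrite indep_unif (subset_trans sBF sFS) cB geq_minl.
Qed.

Lemma mrank_unif S k : (k <= #|S|)%N -> mrank (unif S k) = k.
Proof. by move=> le_kS; rewrite /mrank rk_unif //; apply/minn_idPl. Qed.

Lemma loopless_unif S k : (0 < k)%N || (S == set0) -> loopless (unif S k).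
Proof.
move=> k_or; apply/forall_inP=> x; rewrite ground_unif indep_unif sub1set cards1 => xS.
rewrite xS; case/orP: k_or => // /eqP S0.
by rewrite S0 inE in xS.
Qed.

Lemma flats_unif S k F : (0 < k)%N -> (k <= #|S|)%N ->
  (F \in flats (unif S k)) = (F \subset S) && ((#|F| < k)%N || (F == S)).
Proof.
move=> k_gt0 le_kS; rewrite inE ground_unif; have [sFS|//] := boolP (F \subset S).
apply/forall_inP/orP=> [flatF|ltF x].
  have [->|neFS] := eqVneq F S; [by right | left].
  have /subsetPn[x xS nxF] : ~~ (S \subset F).
    by apply: contra neFS => sSF; rewrite eqEsubset sFS.
  have := flatF x; rewrite inE nxF xS => /(_ isT).
  rewrite !rk_unif // ?subUset ?sub1set ?xS // cardsU1 nxF; lia.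
rewrite inE => /andP[nxF xS]; case: ltF => [ltFk|/eqP eqFS]; last first.
  by rewrite eqFS xS in nxF.
rewrite !rk_unif // ?subUset ?sub1set ?xS // cardsU1 nxF; lia.
Qed.

Lemma flats_unif0 F : (F \in flats (unif set0 0)) = (F == set0).
Proof.
rewrite inE ground_unif subset0; have [->|//] := eqVneq F set0.
by apply/forall_inP=> x; rewrite !inE.
Qed.

Lemma restrict_unif S k F : F \subset S -> (#|F| <= k)%N ->
  restrict (unif S k) F = unif F #|F|.
Proof.
move=> sFS leFk; apply: eq_matroid => [|A]; first exact/setIidPr.
rewrite !inE; have [sAF|] := boolP (A \subset F); rewrite ?andbF //= andbT.
by rewrite (subset_trans sAF sFS) subset_leq_card // (leq_trans (subset_leq_card sAF)).
Qed.

Lemma restrict_unif_ground S k : restrict (unif S k) S = unif S k.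
Proof.
apply: eq_matroid => [|A]; first exact: setIid.
by rewrite !inE andbAC andbb.
Qed.

Lemma contract_unif S k F : F \subset S -> (#|F| <= k)%N ->
  contract (unif S k) F = unif (S :\: F) (k - #|F|).
Proof.
move=> sFS leFk; apply: eq_matroid => // A; rewrite !inE ground_unif.
case sA: (A \subset S :\: F) => //=.
have cAJ (J : {set T}) : J \subset F -> #|A :|: J| = (#|A| + #|J|)%N.
  move=> sJF; apply/eqP; rewrite (leq_card_setU A J).2 disjoints_subset.
  by rewrite (subset_trans sA) // (subset_trans (subsetDr S F)) // setCS.
have sAS := subset_trans sA (subsetDl S F).
apply/existsP/idP=> [[J /and3P[sJF]]|cA].
  rewrite rk_unif // (minn_idPr leFk) => /eqP cJ; rewrite indep_unif cAJ // cJ.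
  by case/andP=> _; lia.
exists F; rewrite subxx rk_unif // (minn_idPr leFk) eqxx /= indep_unif.
by rewrite subUset sAS sFS cAJ //=; lia.
Qed.

Lemma contract_unif_ground S k : (k <= #|S|)%N -> contract (unif S k) S = unif set0 0.
Proof.
move=> le_kS; apply: eq_matroid => [|A]; first exact: setDv.
rewrite !inE ground_unif setDv subset0; case: eqP => //= ->; rewrite cards0.
have [J sJS cJ] := exists_subset_card le_kS.
apply/existsP; exists J; rewrite sJS rk_unif // (minn_idPl le_kS) cJ eqxx /=.
by rewrite set0U indep_unif sJS cJ leqnn.
Qed.

Lemma equivariant_unif (gT : finGroupType) (to : {action gT &-> T}) (W : {group gT}) S k :
  W \subset 'N(S | to)%g -> equivariant to W (unif S k).
Proof.
move=> sWN; rewrite /equivariant ground_unif; apply/andP; split=> //.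
have im u A : u \in W -> (to^*%act A u \in indep (unif S k)) = (A \in indep (unif S k)).
  move=> Wu; rewrite !indep_unif card_setact; congr (_ && _).
  apply/subsetP/subsetP=> sAS t tA.
    by rewrite -(astabs_act t (subsetP sWN u Wu)); apply/sAS/imset_f.
  by have /imsetP[s /sAS sS ->] := tA; rewrite (astabs_act s (subsetP sWN u Wu)).
have maxJ u A : u \in W -> A \in bases (unif S k) -> to^*%act A u \in bases (unif S k).
  move=> Wu; rewrite !inE => /maxsetP[AI maxA]; apply/maxsetP; split=> [|B BI sAB].
    by have := im u A Wu; rewrite /= => ->.
  have BI' : to^*%act B (u^-1)%g \in indep (unif S k) by rewrite im ?groupV.
  rewrite -[B](actKV to^*%act u) (maxA _ BI') //.
  by rewrite -[A](actK to^*%act u); apply: imsetS.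
apply/actsP=> u Wu A; apply/idP/idP=> [|/maxJ]; last exact.
by move/(maxJ u^-1%g); rewrite groupV actK; apply.
Qed.

End UniformMatroid.

Section NaturalClosure.
Variable T : finType.
Implicit Types x y : {perm T} -> sfun T algC.

Lemma eq_natural x y : x =1 y -> natural x -> natural y.
Proof.
move=> eqxy [lx jx rx]; split=> [w A|w g A|w A]; rewrite -!eqxy //.
exact: lx.
Qed.

Lemma naturalN x : natural x -> natural (fun w => - x w).
Proof.
move=> [lx jx rx]; split=> [|w g A|w A]; first exact: slocalN.
  by rewrite !sappN jx.
by rewrite sappN rmorphN /= rx.
Qed.

Lemma natural_sign n x : natural x -> natural (fun w => (-1) ^+ n * x w).
Proof.
move=> nx; have [odd_n|even_n] := boolP (odd n).
  by apply: eq_natural (naturalN nx) => w; rewrite -signr_odd odd_n mulN1r.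
by apply: eq_natural nx => w; rewrite -signr_odd (negPf even_n) mul1r.
Qed.

Lemma natural_if (b : bool) x y : natural x -> natural y ->
  natural (fun w => if b then x w else y w).
Proof. by case: b. Qed.

Lemma natural_sum n (x : nat -> {perm T} -> sfun T algC) :
  (forall j, natural (x j)) -> natural (fun w => \sum_(j < n) x j w).
Proof.
move=> nx; elim: n => [|n IHn].
  by apply: eq_natural (natural0 T) => w; rewrite big_ord0.
by apply: eq_natural (naturalD IHn (nx n)) => w; rewrite big_ord_recr.
Qed.

Lemma natural_sconv n (x y : nat -> {perm T} -> sfun T algC) :
  (forall j, natural (x j)) -> (forall j, natural (y j)) ->
  natural (fun w => sconv (x^~ w) (y^~ w) n).
Proof.
by move=> nx ny; apply: (@natural_sum n.+1 (fun j w => x j w * y (n - j)%N w)) => j;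
  apply: naturalM.
Qed.

End NaturalClosure.

(** * Explicit solution of the recursions *)

Section Explicit.
Variable T : finType.
Implicit Types (w u g : {perm T}) (S F B : {set T}).
Local Notation sA := (sfun T algC).
Local Notation R := {poly sA}.

Definition usym w a : sA := gen algC false w a.
Definition ualt w a : sA := (-1) ^+ a * gen algC true w a.
(** The trivial character on every stable set large enough to carry rank [m]; it represents the top
    flat. Its vanishing at [m = 0] drops from the convolutions the term in which a proper flat would
    have full rank. *)
Definition utop w m : sA := sfunof (fun B => [&& (0 < m)%N, stb w B & (m <= #|B|)%N]%:R).
Definition umob w : nat -> sA := useq_mu (ualt w) (utop w).

Definition cst (f : nat -> sA) (n : nat) : R := (f n)%:P.

(** The hypothesis of [useq_KLE] prescribes the difference of this polynomial and its reversal,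
    whose coefficients change sign when i and n-i are exchanged. Keeping only those with [i.*2 < n]
    solves it within the degree bound. *)
Definition uinvKL w n : R := \poly_(i < n.+1)
  if (i.*2 < n)%N then ualt w i * umob w (n - i)%N - ualt w (n - i)%N * umob w i else 0.
Definition uKL w : nat -> R := useq_KL (cst (usym w)) (uinvKL w).
Definition uchar w : nat -> R := useq_char 'X (cst (ualt w)) (cst (utop w)).

Lemma ualt_usym w n : sconv (ualt w) (usym w) n = sdelta sA n.
Proof.
rewrite -[RHS](sum_e_h _ w n); apply: eq_bigr => i _; by rewrite mulrA.
Qed.

Lemma cst_ualt_usym w n : sconv (cst (ualt w)) (cst (usym w)) n = sdelta R n.
Proof.
have -> : sdelta R n = (sdelta sA n)%:P by rewrite /sdelta polyC_natr.
rewrite -(ualt_usym w) rmorph_sum /sconv /=.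
by apply: eq_bigr => i _; rewrite [RHS]polyCM.
Qed.

Lemma cst_umob w n : useq_mu (cst (ualt w)) (cst (utop w)) n = cst (umob w) n.
Proof.
rewrite /useq_mu /cst /umob /useq_mu /sconv rmorphN rmorph_sum /=; congr (- _).
by apply: eq_bigr => i _; rewrite [RHS]polyCM.
Qed.

Lemma utopE w m B : sapp (utop w m) B = [&& (0 < m)%N, stb w B & (m <= #|B|)%N]%:R.
Proof. exact: sfunofE. Qed.

Lemma utop0 w : utop w 0 = 0.
Proof. by apply/sfunP=> B; rewrite sapp0. Qed.

Lemma umob0 w : umob w 0 = 0.
Proof. by rewrite /umob /useq_mu /sconv big_ord1 utop0 mulr0 oppr0. Qed.

Lemma uinvKL0 w : uinvKL w 0 = 0.
Proof. by apply/polyP=> i; rewrite coef_poly coef0 /=; case: (i < 1)%N. Qed.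

Lemma uKL0 w : uKL w 0 = 0.
Proof. by rewrite /uKL /useq_KL /sconv big_ord1 uinvKL0 mulr0 oppr0. Qed.

Lemma coef_sconv_twistl (f g : nat -> sA) n i :
  (sconv (twist 'X (cst f)) (cst g) n)`_i = if (i <= n)%N then f i * g (n - i)%N else 0.
Proof.
rewrite coef_sum; case: leqP => [le_in|lt_ni].
  rewrite (bigD1 (Ordinal (le_in : (i < n.+1)%N))) //= big1 => [|j ne_ji].
    by rewrite addr0 /twist /cst -mulrA -rmorphM coefXnM ltnn subnn coefC.
  rewrite /twist /cst -mulrA -rmorphM coefXnM coefC; case: ltnP => // le_ji.
  by case: eqP => // /eqP; rewrite subn_eq0 => le_ij; case/eqP: ne_ji; apply: val_inj => /=; lia.
rewrite big1 // => j _; rewrite /twist /cst -mulrA -rmorphM coefXnM coefC.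
by have lt_jn := ltn_ord j; case: ltnP => // le_ji; rewrite ifF //; lia.
Qed.

Lemma coef_sconv_twistr (f g : nat -> sA) n i :
  (sconv (cst f) (twist 'X (cst g)) n)`_i = if (i <= n)%N then f (n - i)%N * g i else 0.
Proof. by rewrite sconvC coef_sconv_twistl; case: ifP => //; rewrite mulrC. Qed.

Lemma coef_uinvKL w n i : (uinvKL w n)`_i =
  if (i.*2 < n)%N then ualt w i * umob w (n - i)%N - ualt w (n - i)%N * umob w i else 0.
Proof.
by rewrite coef_poly; case: ifP => // /negbT; rewrite -leqNgt => ?; rewrite ifF //; lia.
Qed.

Lemma coef_reverse (K : nzRingType) d (p : {poly K}) i :
  (poly_reverse d p)`_i = if (i <= d)%N then p`_(d - i) else 0.
Proof. by rewrite coef_poly. Qed.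

Lemma uinvKL_reverse w n : uinvKL w n - poly_reverse n (uinvKL w n) =
  sconv (twist 'X (cst (ualt w))) (useq_mu (cst (ualt w)) (cst (utop w))) n -
  sconv (cst (ualt w)) (twist 'X (useq_mu (cst (ualt w)) (cst (utop w)))) n.
Proof.
have muE m : useq_mu (cst (ualt w)) (cst (utop w)) m = cst (umob w) m by apply: cst_umob.
have -> : sconv (twist 'X (cst (ualt w))) (useq_mu (cst (ualt w)) (cst (utop w))) n =
    sconv (twist 'X (cst (ualt w))) (cst (umob w)) n by apply: eq_sconv.
have -> : sconv (cst (ualt w)) (twist 'X (useq_mu (cst (ualt w)) (cst (utop w)))) n =
    sconv (cst (ualt w)) (twist 'X (cst (umob w))) n.
  by apply: eq_sconv => // i _; rewrite /twist muE.
apply/polyP=> i; rewrite !coefB coef_sconv_twistl coef_sconv_twistr coef_reverse.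
rewrite !coef_uinvKL; case: (leqP i n) => [le_in|lt_ni]; last by rewrite ifF ?subrr //; lia.
rewrite subKn //; case: (ltngtP i.*2 n) => [lt_in|gt_in|eq_in].
- by rewrite ifF ?subr0 //; lia.
- by rewrite ifT ?sub0r ?opprB //; lia.
rewrite ifF ?subr0; last by lia.
have -> : (n - i = i)%N by lia.
by rewrite subrr.
Qed.

Lemma uKL_reverse w n : poly_reverse n (uKL w n) =
  uchar w n + sconv (useq_bool 'X (cst (ualt w)) (cst (usym w))) (uKL w) n.
Proof.
rewrite -(useq_KLE (cst_ualt_usym w) (uinvKL_reverse w)).
apply/polyP=> i; rewrite coef_reverse /uKL /useq_KL !coefN.
rewrite [in RHS]/sconv !coef_sum.
case: (leqP i n) => [le_in|lt_ni].
  congr (- _); apply: eq_bigr => j _.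
  rewrite /twist /cst coefCM -mulrA coefXnM coefCM coef_reverse.
  have le_jn : (j <= n)%N by have := ltn_ord j.
  case: ltnP => [lt_ij|le_ji]; first by rewrite coef_uinvKL ifF ?mulr0 //; lia.
  by rewrite ifT; [congr (_ * (uinvKL w _)`_ _); lia | lia].
rewrite big1 ?oppr0 // => j _; rewrite /twist /cst -mulrA coefXnM coefCM coef_reverse.
have le_jn : (j <= n)%N by have := ltn_ord j.
by case: ltnP => // le_ji; rewrite ifF ?mulr0 //; lia.
Qed.

Lemma coef_uKL_high w n i : (n <= i.*2)%N -> (uKL w n)`_i = 0.
Proof.
move=> le_ni; rewrite /uKL /useq_KL coefN coef_sum big1 ?oppr0 // => j _.
by rewrite /cst coefCM coef_uinvKL ifF ?mulr0 //; lia.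
Qed.

Lemma natural_usym a : natural (usym^~ a).
Proof. exact: natural_gen. Qed.

Lemma natural_ualt a : natural (ualt^~ a).
Proof. exact/natural_sign/natural_gen. Qed.

Lemma natural_utop m : natural (utop^~ m).
Proof.
apply: natural_relabel => [w B|w B|w g].
- by rewrite !sfunofE; case: ifP => [sB|->]; rewrite ?andbF // stb_restr ?sB.
- by rewrite sfunofE rmorph_nat.
apply/sfunP=> B; rewrite relabelE !sfunofE card_imset ?(stb_intertwine (w := w)) //;
  try exact: perm_inj.
by move=> x; rewrite conjgE !permM permK.
Qed.

Lemma natural_umob k : natural (umob^~ k).
Proof.
exact/naturalN/(@natural_sconv T k (fun j => ualt^~ j) (fun j => utop^~ j)
  natural_ualt natural_utop).
Qed.

Lemma natural_uinvKL n i : natural (fun w => (uinvKL w n)`_i).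
Proof.
have nd : natural (fun w => ualt w i * umob w (n - i)%N - ualt w (n - i)%N * umob w i).
  apply: naturalD; last apply: naturalN; apply: naturalM;
    (exact: natural_ualt || exact: natural_umob).
apply: eq_natural (natural_if (i.*2 < n)%N nd (natural0 T)) => w.
by rewrite coef_uinvKL.
Qed.

Lemma coef_uKL w n i :
  (uKL w n)`_i = - sconv (usym w) (fun m => (uinvKL w m)`_i) n.
Proof.
by rewrite /uKL /useq_KL coefN coef_sum; congr (- _); apply: eq_bigr => j _; rewrite coefCM.
Qed.

Lemma natural_uKL n i : natural (fun w => (uKL w n)`_i).
Proof.
apply: eq_natural (fun w => esym (coef_uKL w n i)) _.
exact/naturalN/(@natural_sconv T n (fun j => usym^~ j) (fun m w => (uinvKL w m)`_i)
  natural_usym (natural_uinvKL^~ i)).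
Qed.

Lemma coef_uchar w n i : (uchar w n)`_i =
  (if i == 0%N then umob w n else 0) +
  (if (i <= n)%N then ualt w (n - i)%N * utop w i else 0).
Proof. by rewrite /uchar /useq_char coefD coef_sconv_twistr cst_umob coefC. Qed.

Lemma natural_uchar n i : natural (fun w => (uchar w n)`_i).
Proof.
apply: eq_natural (fun w => esym (coef_uchar w n i)) _.
apply: naturalD; apply: natural_if; try exact: natural0; first exact: natural_umob.
by apply: naturalM; [apply: natural_ualt | apply: natural_utop].
Qed.

End Explicit.

(** * Boolean values: sets whose size is the rank *)

Section BooleanValues.
Variables (T : finType) (w : {perm T}).
Implicit Types (F S : {set T}).
Local Notation sA := (sfun T algC).
Implicit Types x y : sA.

(** A proper flat of size [a] restricts to the Boolean matroid of rank [a], where the explicit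
    sequences simplify; equality is therefore asked only on sets of that size. *)
Definition agree a x y := forall F : {set T}, #|F| = a -> sapp x F = sapp y F.

Lemma agree_mul_homogeneous j m z x y : homogeneous z j -> agree m x y ->
  agree (j + m) (z * x) (z * y).
Proof.
move=> hz eqxy F cF; rewrite !sappM; apply: eq_bigr => B sBF.
have [cB|ncB] := eqVneq #|B| j; last by rewrite !hz ?mul0r.
by rewrite eqxy // cardsDS // cF cB addKn.
Qed.

Lemma homogeneous_ualt a : homogeneous (ualt w a) a.
Proof. by move=> F nF; rewrite sapp_sign gen_neq // mulr0. Qed.

Lemma agree_sconv (z x y : nat -> sA) a :
    (forall j, homogeneous (z j) j) -> (forall m, (0 < m <= a)%N -> agree m (x m) (y m)) ->
  agree a (\sum_(j < a) z j * x (a - j)%N) (\sum_(j < a) z j * y (a - j)%N).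
Proof.
move=> hz eqxy F cF; rewrite !sapp_sum; apply: eq_bigr => j _; have lt_ja := ltn_ord j.
apply: (@agree_mul_homogeneous j (a - j)) => //; last by lia.
by apply: eqxy; lia.
Qed.

Lemma utop_agree m : (0 < m)%N -> agree m (utop w m) (usym w m).
Proof.
move=> m_gt0 F cF; rewrite sfunofE genE cF m_gt0 leqnn eqxx !andbT.
by case: (stb w F).
Qed.

Lemma sum_ualt_usym a : (0 < a)%N ->
  \sum_(j < a) ualt w j * usym w (a - j)%N = - ualt w a.
Proof.
move=> a_gt0; have := ualt_usym w a; rewrite /sconv big_ord_recr /= subnn.
rewrite /sdelta (gtn_eqF a_gt0) => /eqP; rewrite addr_eq0 => /eqP->.
by rewrite /usym gen0 mulr1.
Qed.

Lemma umob_agree a : (0 < a)%N -> agree a (umob w a) (ualt w a).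
Proof.
move=> a_gt0 F cF; rewrite /umob /useq_mu sconv_trunc ?utop0 // sappN.
rewrite (@agree_sconv _ _ (usym w) a homogeneous_ualt) => [|m /andP[m_gt0 _]|//].
  by rewrite sum_ualt_usym // sappN opprK.
exact: utop_agree.
Qed.

Lemma ualt0 : ualt w 0 = 1.
Proof. by rewrite /ualt gen0 mulr1. Qed.

Lemma uinvKL_agree a i : (0 < a)%N ->
  agree a (uinvKL w a)`_i (if i == 0%N then ualt w a else 0).
Proof.
move=> a_gt0 F cF; rewrite coef_uinvKL; case: i => [|i].
  by rewrite double0 a_gt0 subn0 ualt0 umob0 mul1r mulr0 subr0 umob_agree.
case: ltnP => // lt_ia; rewrite sappD sappN.
rewrite (@agree_mul_homogeneous i.+1 (a - i.+1) _ _ (ualt w (a - i.+1)%N)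
  (@homogeneous_ualt _)) ?cF; try lia; last by apply: umob_agree; lia.
rewrite (@agree_mul_homogeneous (a - i.+1) i.+1 _ _ (ualt w i.+1)
  (@homogeneous_ualt _)) ?cF; try lia; last exact: umob_agree.
by rewrite mulrC subrr sapp0.
Qed.

Lemma uKL_agree a i : (0 < a)%N ->
  agree a (uKL w a)`_i (if i == 0%N then usym w a else 0).
Proof.
move=> a_gt0 F cF; rewrite coef_uKL sconv_trunc ?uinvKL0 ?coef0 // sappN.
rewrite (@agree_sconv (usym w) (fun m => (uinvKL w m)`_i)
  (fun m => if i == 0%N then ualt w m else 0) a) //; first last.
- by move=> m /andP[m_gt0 _]; apply: uinvKL_agree.
- by move=> j; apply: homogeneous_gen.
case: eqP => _; last by rewrite big1 ?sapp0 ?oppr0 // => j _; rewrite mulr0.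
have := ualt_usym w a; rewrite sconvC /sconv big_ord_recr /= subnn ualt0 mulr1.
by rewrite /sdelta (gtn_eqF a_gt0) => /eqP; rewrite addr_eq0 => /eqP->; rewrite sappN opprK.
Qed.

Lemma uchar_agree a i : (0 < a)%N ->
  agree a (uchar w a)`_i (useq_bool 'X (cst (ualt w)) (cst (usym w)) a)`_i.
Proof.
move=> a_gt0 F cF; rewrite coef_uchar /useq_bool coef_sconv_twistl.
case: i => [|i]; first by rewrite /= subn0 utop0 mulr0 addr0 /usym gen0 mul1r umob_agree.
rewrite add0r /=; case: ltnP => // lt_ia; rewrite [usym _ _ * _]mulrC.
rewrite (@agree_mul_homogeneous (a - i.+1) i.+1 _ _ (usym w i.+1) (@homogeneous_ualt _)) ?cF //.
  exact: utop_agree.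
by lia.
Qed.

Lemma homogeneous_bool a i :
  homogeneous (useq_bool 'X (cst (ualt w)) (cst (usym w)) a)`_i a.
Proof.
rewrite /useq_bool coef_sconv_twistl; case: leqP => [le_ia|_]; last exact: homogeneous0.
by apply: (homogeneousM (@homogeneous_gen _ _ _ _ _) (@homogeneous_ualt _)); lia.
Qed.

(** Homogeneity of [X a] selects the subsets of size [a] in the convolution, so that the index of
    the sequence becomes the rank of the flat. *)
Lemma sum_flats (X Z : nat -> sA) k S : (forall a, homogeneous (X a) a) ->
  \sum_(F : {set T} | (F \subset S) && (#|F| < k)%N)
     sapp (X #|F|) F * sapp (Z (k - #|F|)%N) (S :\: F) =
  sapp (\sum_(a < k) X a * Z (k - a)%N) S.
Proof.
move=> hX; rewrite sapp_sum; under [RHS]eq_bigr do rewrite sappM.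
rewrite exchange_big big_mkcondr /=; apply: eq_bigr => F sFS.
case: ltnP => [ltFk|leFk]; last first.
  rewrite big1 // => a _; rewrite hX ?mul0r // neq_ltn.
  by have := ltn_ord a; rewrite orbC => /leq_trans->.
rewrite (bigD1 (Ordinal ltFk)) //= big1 ?addr0 // => a ne_aF.
by rewrite hX ?mul0r // eq_sym; apply: contra ne_aF => /eqP eqF; apply/eqP/val_inj.
Qed.

Lemma sum_flats_coef (X Z : nat -> {poly sA}) k S i :
    (forall a j, homogeneous (X a)`_j a) ->
  \sum_(F : {set T} | (F \subset S) && (#|F| < k)%N)
     \sum_(j < i.+1) sapp (X #|F|)`_j F * sapp (Z (k - #|F|)%N)`_(i - j) (S :\: F) =
  sapp (\sum_(a < k) X a * Z (k - a)%N)`_i S.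
Proof.
move=> hX; rewrite exchange_big /= coef_sum sapp_sum.
under [RHS]eq_bigr do rewrite coefM sapp_sum.
rewrite [RHS]exchange_big /=; apply: eq_bigr => j _.
rewrite -sapp_sum -(@sum_flats (fun a => (X a)`_j) (fun m => (Z m)`_(i - j))) //.
Qed.

End BooleanValues.

(** * Sums over orbits of flats *)

Section FlatSums.
Variables (T : finType) (W : {group {perm T}}) (S : {set T}) (k : nat).
Hypotheses (k_gt0 : (0 < k)%N) (le_kS : (k <= #|S|)%N) (sWS : W \subset 'N(S | 'P)).
Implicit Types (F : {set T}) (u w g : {perm T}).

Lemma acts_flats_unif : [acts W, on flats (unif S k) | 'P^*].
Proof.
apply/actsP=> g Wg F; rewrite !flats_unif //.
have gS : stb g S by apply: (subsetP sWS).
have gFS : ('P^*%act F g \subset S) = (F \subset S).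
  apply/subsetP/subsetP=> sFS t tF.
    by rewrite -(stbP _ _ gS); apply/sFS/(imset_f (aperm^~ g)).
  by have /imsetP[s /sFS sS ->] := tF; rewrite [_ \in _](stbP _ _ gS).
rewrite gFS card_setact; congr (_ && (_ || _)).
have gSS : 'P^*%act S g = S by apply/astab1P; rewrite astab1_set.
by rewrite -{1}gSS (inj_eq (act_inj _ _)).
Qed.

(** The flats are the subsets of size below [k] and the ground set; the latter stands apart because
    its term is either the unknown of a recursion or an exceptional one. The last hypothesis extends
    the sum from the [w]-stable flats to all of them. *)
Lemma flat_sum (phi : forall F, 'CF('N_W(F | 'P)%G)) (psi : {set T} -> {perm T} -> algC) w :
    w \in W ->
    (forall F g u, F \subset S -> g \in W -> u \in W -> psi (g @: F) (u ^ g)%g = psi F u) ->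
    (forall F u, (F \subset S) && ((#|F| < k)%N || (F == S)) -> u \in 'N_W(F | 'P)%G ->
       phi F u = psi F u) ->
    (forall F, F \subset S -> ~~ stb w F -> psi F w = 0) ->
  \sum_(F in flat_reps 'P W (unif S k)) 'Ind[W] (phi F) w =
  \sum_(F : {set T} | (F \subset S) && (#|F| < k)%N) psi F w + psi S w.
Proof.
move=> Ww psiJ phiE psi0.
rewrite (@sum_cfInd_orbits _ _ _ _ _ (fun F => 'N_W(F | 'P)%G) phi psi) //.
- rewrite big_mkcondr /= (bigD1 S) /=; last by rewrite flats_unif // subxx eqxx orbT.
  have sS : stb w S by apply: (subsetP sWS).
  have fixE F : ('P^*%act F w == F) = stb w F.
    by rewrite /stb -astab1_set; apply/eqP/idP=> /astab1P.
  rewrite fixE sS addrC; congr (_ + _); apply: eq_big => F.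
    rewrite flats_unif //; have [->|neFS] := eqVneq F S; last by rewrite orbF andbT.
    by rewrite ltnNge le_kS !andbF.
  rewrite flats_unif // fixE => /andP[/andP[sFS _] _].
  by case: ifP => // /negbT/(psi0 _ sFS)->.
- exact: acts_flats_unif.
- by move=> F _; rewrite /= astab1_set.
- by move=> F g u; rewrite flats_unif // => /andP[sFS _]; apply: psiJ.
by move=> F u; rewrite flats_unif //; apply: phiE.
Qed.

End FlatSums.

(** * The given families coincide with the explicit solution *)

Section EquivariantPolynomials.
Variable T : finType.
Variables (mu : forall W : {group {perm T}}, matroid T -> 'CF(W)).
Variables (P Q : forall W : {group {perm T}}, matroid T -> {poly 'CF(W)}).
Hypothesis hmu : is_equivariant_mobius 'P%act mu.
Hypothesis hP : is_equivariant_KL 'P%act mu P.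
Hypothesis hQ : is_equivariant_inverse_KL 'P%act P Q.
Implicit Types (F S : {set T}) (u w g : {perm T}) (W : {group {perm T}}).
Local Notation sA := (sfun T algC).
Local Notation stabg W F := ('N_W(F | 'P)%G).

(** The parameters for which [unif S k] is loopless of rank [k]: in rank 0 this forces an empty
    ground set. *)
Definition valid S k := if k == 0%N then S == set0 else (k <= #|S|)%N.

(* In rank 0 the polynomials are constant, so the zeroth coefficient is 1. *)
Definition pfin (x : {perm T} -> nat -> {poly sA}) w k : {poly sA} :=
  if k == 0%N then 1 else x w k.

Definition mob_val w k : sA := if k == 0%N then 1 else umob w k.
Definition KL_val := pfin (@uKL T).
Definition char_val := pfin (@uchar T).
Definition invKL_val := pfin (fun w k => (-1) ^+ k * uinvKL w k).

Lemma natural1 : natural (fun _ : {perm T} => 1 : sA).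
Proof. by apply: eq_natural (natural_gen T false 0) => w; rewrite gen0. Qed.

Lemma natural_mob_val k : natural (mob_val^~ k).
Proof. by rewrite /mob_val; case: eqP => _; [apply: natural1 | apply: natural_umob]. Qed.

Lemma natural_pfin (x : {perm T} -> nat -> {poly sA}) k i : (forall n, natural (fun w => (x w n)`_i)) ->
  natural (fun w => (pfin x w k)`_i).
Proof.
move=> nx; rewrite /pfin; case: (k == 0%N) => //.
have := natural_if (i == 0%N) natural1 (natural0 T); apply: eq_natural => w.
by rewrite coef1; case: (i == 0%N).
Qed.

Lemma natural_KL_val k i : natural (fun w => (KL_val w k)`_i).
Proof. by apply: natural_pfin => n; apply: natural_uKL. Qed.

Lemma natural_char_val k i : natural (fun w => (char_val w k)`_i).
Proof. by apply: natural_pfin => n; apply: natural_uchar. Qed.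

Lemma coef_sign (n : nat) (p : {poly sA}) i : ((-1) ^+ n * p)`_i = (-1) ^+ n * p`_i.
Proof. by rewrite -(rmorph_sign polyC) /= coefCM. Qed.

Lemma natural_invKL_val k i : natural (fun w => (invKL_val w k)`_i).
Proof.
apply: natural_pfin => n; apply: eq_natural (natural_sign n (natural_uinvKL T n i)) => w.
by rewrite coef_sign.
Qed.

Lemma mob_val_bool w F : sapp (mob_val w #|F|) F = sapp (ualt w #|F|) F.
Proof.
by rewrite /mob_val; case: eqP => [->|/eqP]; rewrite ?ualt0 // -lt0n => F0; apply: umob_agree.
Qed.

Lemma KL_val_bool w F i : sapp (KL_val w #|F|)`_i F = sapp (cst (usym w) #|F|)`_i F.
Proof.
rewrite /KL_val /pfin /cst coefC; case: eqP => [->|/eqP]; first by rewrite /usym gen0 coef1; case: eqP.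
by rewrite -lt0n => F0; apply: uKL_agree.
Qed.

Lemma char_val_bool w F i :
  sapp (char_val w #|F|)`_i F = sapp (useq_bool 'X (cst (ualt w)) (cst (usym w)) #|F|)`_i F.
Proof.
rewrite /char_val /pfin; case: eqP => [->|/eqP]; last by rewrite -lt0n => F0; apply: uchar_agree.
rewrite /useq_bool coef_sconv_twistl coef1 leqn0; case: i => [|i] //=.
by rewrite subnn ualt0 /usym gen0 mulr1.
Qed.

Lemma invKL_val_bool w F i :
  sapp (invKL_val w #|F|)`_i F = if i == 0%N then sapp (gen algC true w #|F|) F else 0.
Proof.
rewrite /invKL_val /pfin; case: eqP => [->|/eqP].
  by rewrite coef1 gen0; case: (i == 0%N); rewrite ?sapp0.
rewrite -lt0n => F0; rewrite coef_sign sapp_sign (uinvKL_agree w i F0) //.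
case: eqP => _; last by rewrite sapp0 mulr0.
by rewrite sapp_sign mulrA -exprD addnn -signr_odd odd_double mul1r.
Qed.

Lemma valid_proper S k F : (0 < k)%N -> (k <= #|S|)%N -> F \subset S -> (#|F| < k)%N ->
  [/\ valid F #|F|, valid (S :\: F) (k - #|F|)%N & (0 < k - #|F|)%N].
Proof.
move=> k_gt0 le_kS sFS ltFk; rewrite /valid cards_eq0 cardsDS //.
split; [by case: (F == set0) | | lia].
by rewrite ifF; lia.
Qed.

Lemma stab_sub W S F : W \subset 'N(S | 'P) -> stabg W F \subset 'N(F | 'P) /\
  stabg W F \subset 'N(S :\: F | 'P).
Proof.
move=> sWS; split; first exact: subsetIr.
apply/subsetP=> u /setIP[/(subsetP sWS) uS uF].
by apply: stbD.
Qed.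

Lemma stab_ground W S : W \subset 'N(S | 'P) -> stabg W S = W.
Proof. by move=> sWS; apply/group_inj/setIidPl. Qed.

Lemma imset_eq_ground g S F : stb g S -> (g @: F == S) = (F == S).
Proof.
move=> gS; have gSS : g @: S = S.
  by have : 'P^*%act S g = S by apply/astab1P; rewrite astab1_set.
by rewrite -{1}gSS; apply/eqP/eqP=> [/(imset_inj perm_inj)|->].
Qed.

Lemma valid_matroid W S k : valid S k -> W \subset 'N(S | 'P) ->
  [/\ equivariant 'P%act W (unif S k), loopless (unif S k) & mrank (unif S k) = k].
Proof.
rewrite /valid => vS sWS; split.
- exact: equivariant_unif.
- by apply: loopless_unif; case: k vS => [/= ->|].
by rewrite mrank_unif //; move: vS; case: k.
Qed.

Lemma mobius_unif k S W w : valid S k -> W \subset 'N(S | 'P) -> w \in W ->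
  mu W (unif S k) w = sapp (mob_val w k) S.
Proof.
elim/ltn_ind: k S W w => k IHk S W w vS sWS Ww.
have [eqM llM rkM] := valid_matroid vS sWS.
have [_ mu0 muS] := hmu eqM llM; rewrite /mob_val; case: eqP vS => [k0|/eqP].
  by rewrite /valid mu0 ?rkM // cfun1E Ww k0 => /= /eqP->; rewrite sapp1 eqxx.
rewrite -lt0n => k_gt0; rewrite /valid (gtn_eqF k_gt0) => le_kS.
(* The flat [S] contributes the unknown value itself, so the recursion is solved for this term;
   proper flats are known by induction. *)
pose psi F u := if F == S then mu W (unif S k) u else sapp (mob_val u #|F|) F.
have := congr1 (fun f : 'CF(W) => f w) (muS _); rewrite rkM => /(_ k_gt0).
rewrite sum_cfunE cfunE.
rewrite (@flat_sum _ _ _ _ k_gt0 le_kS sWS _ psi) //; first last.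
- move=> F sFS nsF; rewrite /psi ifF; last first.
    by apply: contraNF nsF => /eqP->; apply: (subsetP sWS).
  exact: (local_out (natural_local (natural_mob_val _))).
- move=> F u /andP[sFS ltF] uF; rewrite /psi; case: eqP ltF => [-> _|_].
    by rewrite restrict_unif_ground stab_ground.
  rewrite orbF => ltF; rewrite restrict_unif //; last exact: ltnW.
  have [vF _ _] := valid_proper k_gt0 le_kS sFS ltF.
  by apply: IHk => //; apply: (stab_sub F sWS).1.
- move=> F g u sFS Wg Wu; rewrite /psi imset_eq_ground; last exact: (subsetP sWS).
  case: eqP => _; first by rewrite cfunJ.
  by rewrite card_imset ?(natural_conj (natural_mob_val _)) //; apply: perm_inj.
rewrite {2}/psi eqxx addrC => /eqP; rewrite addr_eq0 => /eqP->.
rewrite /umob /useq_mu sconv_trunc ?utop0 // sappN; congr (- _).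
rewrite -sum_flats; last exact: homogeneous_ualt.
apply: eq_bigr => F /andP[sFS ltF]; rewrite /psi ifF; last first.
  by apply: contraTF ltF => /eqP->; rewrite -leqNgt.
rewrite mob_val_bool; have [sF|nsF] := boolP (stb w F); last first.
  by rewrite (local_out (natural_local (natural_ualt T _))) // mul0r.
have sSF : stb w (S :\: F) by apply: stbD => //; apply: (subsetP sWS).
rewrite utopE sSF cardsDS //=.
have [-> ->] : (0 < k - #|F|)%N /\ (k - #|F| <= #|S| - #|F|)%N by lia.
by rewrite mulr1.
Qed.

Lemma grIndE W (H : {group {perm T}}) (p : {poly 'CF(H)}) i :
  (grInd W p)`_i = 'Ind[W] p`_i.
Proof. by rewrite coef_map_id0 ?linear0. Qed.

Lemma cfun_mul_coef W (p q : {poly 'CF(W)}) i u :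
  (p * q)`_i u = \sum_(j < i.+1) p`_j u * q`_(i - j) u.
Proof. by rewrite coefM sum_cfunE; apply: eq_bigr => j _; rewrite cfunE. Qed.

Lemma flat_reps_unif0 W : flat_reps 'P W (unif (set0 : {set T}) 0) = [set set0].
Proof.
have im0 g : 'P^*%act (set0 : {set T}) g = set0 by apply: imset0.
have acts0 : [acts W, on flats (unif (set0 : {set T}) 0) | 'P^*].
  apply/actsP=> g Wg F; rewrite !flats_unif0.
  by rewrite -{1}(im0 g) (inj_eq (act_inj _ _)).
have [_ /subsetP sub _ memX] := orbit_transversalP acts0.
apply/setP=> F; rewrite inE; apply/idP/eqP=> [/sub|->].
  by rewrite flats_unif0 => /eqP.
by have [|g _] := memX set0; rewrite ?flats_unif0 // im0.
Qed.

(** The only index is [a = k - i]; for [i = 0] it falls outside the range, which [z 0 = 0]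
    compensates. *)
Lemma sum_single (R : nzRingType) (x z : nat -> R) k i : z 0%N = 0 ->
  \sum_(a < k) x a * (if (k - a == i)%N then z (k - a)%N else 0) =
  if (i <= k)%N then x (k - i)%N * z i else 0.
Proof.
move=> z0; case: i => [|i].
  rewrite subn0 z0 mulr0 big1 // => a _; rewrite ifF ?mulr0 //.
  by have := ltn_ord a; lia.
case: (leqP i.+1 k) => [le_ik|lt_ki]; last first.
  by rewrite big1 // => a _; rewrite ifF ?mulr0 //; lia.
have lt_k : (k - i.+1 < k)%N by lia.
rewrite (bigD1 (Ordinal lt_k)) //= big1 ?addr0 => [|a ne_a]; last first.
  rewrite ifF ?mulr0 //; apply: contraNF ne_a => /eqP eq_a.
  by apply/eqP/val_inj => /=; have := ltn_ord a; lia.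
by rewrite subKn // eqxx.
Qed.

Lemma char_poly_unif k S W w i : valid S k -> W \subset 'N(S | 'P) -> w \in W ->
  (equivariant_char_poly 'P%act mu W (unif S k))`_i w = sapp (char_val w k)`_i S.
Proof.
move=> vS sWS Ww; have [_ _ rkM] := valid_matroid vS sWS.
rewrite /equivariant_char_poly coef_sum sum_cfunE rkM.
pose phi F : 'CF(stabg W F) :=
  (i == k - rk (unif S k) F)%N%:R *: mu (stabg W F) (restrict (unif S k) F).
transitivity (\sum_(F in flat_reps 'P W (unif S k)) 'Ind[W] (phi F) w).
  apply: eq_bigr => F _; rewrite coefCM coefXn linearZ /= !cfunE mulrC.
  by case: eqP => _; rewrite ?cfun1E ?Ww ?cfunE.
rewrite /char_val /pfin; case: eqP vS => [k0|/eqP].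
  rewrite {}/phi {}k0 in rkM * => vS; move: (vS); rewrite /valid eqxx => /eqP S0.
  rewrite {}S0 in sWS rkM vS *; rewrite flat_reps_unif0 big_set1 sub0n.
  rewrite restrict_unif_ground stab_ground // cfInd_id cfunE mobius_unif // /mob_val eqxx.
  by rewrite coef1 sapp1 eqxx mulr1; case: (i == 0%N); rewrite ?sapp0 // sapp1 eqxx.
rewrite -lt0n => k_gt0; rewrite /valid (gtn_eqF k_gt0) => le_kS.
pose psi F u := if F == S then (i == 0%N)%:R * sapp (umob u k) S else
  (i == k - #|F|)%N%:R * sapp (ualt u #|F|) F.
rewrite (@flat_sum _ _ _ _ k_gt0 le_kS sWS _ psi) //; first last.
- move=> F sFS nsF; rewrite /psi ifF; last first.
    by apply: contraNF nsF => /eqP->; apply: (subsetP sWS).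
  by rewrite (local_out (natural_local (natural_ualt T _))) // mulr0.
- move=> F u /andP[sFS ltF] uF; rewrite /psi /phi cfunE rk_unif //.
  have [sub1 _] := stab_sub F sWS.
  case: eqP ltF => [eqFS _|_].
    rewrite eqFS restrict_unif_ground (minn_idPl le_kS) subnn in uF sub1 *.
    rewrite mobius_unif // /mob_val ?(gtn_eqF k_gt0) //.
    by rewrite /valid (gtn_eqF k_gt0).
  rewrite orbF => ltF; rewrite restrict_unif //; last exact: ltnW.
  have [vF _ _] := valid_proper k_gt0 le_kS sFS ltF.
  by rewrite mobius_unif // mob_val_bool (minn_idPr (ltnW ltF)).
- move=> F g u sFS Wg Wu; rewrite /psi imset_eq_ground; last exact: (subsetP sWS).
  rewrite card_imset ?(natural_conj (natural_ualt T _)); last exact: perm_inj.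
  case: eqP => // _; rewrite -[in RHS](natural_conj (natural_umob T _) u g).
  have gSS : 'P^*%act S g = S by apply/astab1P; rewrite astab1_set; apply: (subsetP sWS).
  by rewrite -{1}gSS.
rewrite {2}/psi eqxx coef_uchar addrC sappD; congr (_ + _).
  by case: (i == 0%N); rewrite ?mul1r ?mul0r ?sapp0.
have sS : stb w S by apply: (subsetP sWS).
pose Z m := if m == i then utop w m else 0.
transitivity (sapp (\sum_(a < k) ualt w a * Z (k - a)%N) S); last first.
  by rewrite /Z sum_single ?utop0.
rewrite -sum_flats; last exact: homogeneous_ualt.
apply: eq_bigr => F /andP[sFS ltF]; rewrite /psi ifF; last first.
  by apply: contraTF ltF => /eqP->; rewrite -leqNgt.
have [sF|nsF] := boolP (stb w F); last first.
  by rewrite (local_out (natural_local (natural_ualt T _))) // mulr0 mul0r.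
have sSF : stb w (S :\: F) by apply: stbD.
rewrite /Z eq_sym; case: eqP => _; last by rewrite sapp0 mulr0 mul0r.
rewrite utopE sSF cardsDS //=.
have [-> ->] : (0 < k - #|F|)%N /\ (k - #|F| <= #|S| - #|F|)%N by lia.
by rewrite mulr1 mul1r.
Qed.

Implicit Types (x y : {perm T} -> nat -> {poly sA}).

Definition conv_coef (x y : {perm T} -> nat -> {poly sA}) k S i F u : algC :=
  \sum_(j < i.+1) sapp (x u #|F|)`_j F * sapp (y u (k - #|F|)%N)`_(i - j) (S :\: F).

Lemma imset_setD g F S : stb g S -> g @: (S :\: F) = S :\: (g @: F).
Proof.
move=> gS; apply/setP=> t; rewrite inE; apply/imsetP/andP=> [[s /setDP[sS nsF] ->]|[nF tS]].
  split; last by rewrite (stbP _ _ gS).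
  by apply: contra nsF => /imsetP[r rF /perm_inj->].
exists (g^-1 t)%g; last by rewrite permKV.
rewrite inE -(stbP _ _ gS) permKV tS andbT; apply: contra nF => sF.
by apply/imsetP; exists (g^-1 t)%g; rewrite ?permKV.
Qed.

Lemma conv_coef_conj x y k S i F u g :
    (forall n j, natural (fun w => (x w n)`_j)) -> (forall n j, natural (fun w => (y w n)`_j)) ->
  stb g S -> conv_coef x y k S i (g @: F) (u ^ g)%g = conv_coef x y k S i F u.
Proof.
move=> nx ny gS; apply: eq_bigr => j _; rewrite card_imset; last exact: perm_inj.
by rewrite (natural_conj (nx _ _)) -imset_setD // (natural_conj (ny _ _)).
Qed.

Lemma conv_coef_stb x y k S i F u : (forall n j, natural (fun w => (x w n)`_j)) ->
  ~~ stb u F -> conv_coef x y k S i F u = 0.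
Proof.
move=> nx nsF; rewrite /conv_coef big1 // => j _.
by rewrite (local_out (natural_local (nx _ _))) // mul0r.
Qed.

(* The flat set0 contributes the unknown value X itself; all other values are
   explicit. *)
Lemma flat_sum_conv x y (X : {perm T} -> algC) (top : nat -> {perm T} -> sA) W S k w i
    (phi : forall F, 'CF(stabg W F)) :
    (forall n j, natural (fun w => (x w n)`_j)) -> (forall n j, natural (fun w => (y w n)`_j)) ->
    natural (top i) -> (0 < k)%N -> (k <= #|S|)%N -> W \subset 'N(S | 'P) -> w \in W ->
    (forall g u, g \in W -> u \in W -> X (u ^ g)%g = X u) ->
    (forall u, u \in W -> phi set0 u = X u) ->
    (forall u, u \in W -> phi S u = sapp (top i u) S) ->
    (forall F u, F \subset S -> (0 < #|F| < k)%N -> u \in stabg W F ->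
       phi F u = conv_coef x y k S i F u) ->
  \sum_(F in flat_reps 'P W (unif S k)) 'Ind[W] (phi F) w =
  X w - conv_coef x y k S i set0 w
  + \sum_(F : {set T} | (F \subset S) && (#|F| < k)%N) conv_coef x y k S i F w
  + sapp (top i w) S.
Proof.
move=> nx ny ntop k_gt0 le_kS sWS Ww XJ phi0 phiS phiE.
have neS0 : S != set0 by rewrite -card_gt0 (leq_trans k_gt0).
pose psi F u := if F == set0 then X u else if F == S then sapp (top i u) S
  else conv_coef x y k S i F u.
rewrite (@flat_sum _ _ _ _ k_gt0 le_kS sWS _ psi) //; first last.
- move=> F sFS nsF; rewrite /psi !ifF.
  + exact: conv_coef_stb.
  + by apply: contraNF nsF => /eqP->; apply: (subsetP sWS).
  by apply: contraNF nsF => /eqP->; apply: stb0.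
- move=> F u /andP[sFS ltF] uF; rewrite /psi.
  have Wu : u \in W by case/setIP: uF.
  case: eqP => [->|/eqP neF0]; first exact: phi0.
  case: eqP ltF => [-> _|_]; first exact: phiS.
  by rewrite orbF => ltF; apply: phiE; rewrite // card_gt0 neF0.
- move=> F g u sFS Wg Wu; have gS : stb g S by apply: (subsetP sWS).
  rewrite /psi imset_eq0 imset_eq_ground // XJ // conv_coef_conj //.
  have gSS : 'P^*%act S g = S by apply/astab1P; rewrite astab1_set.
  by rewrite -[in RHS](natural_conj ntop u g) -[g @: S]/('P^*%act S g) gSS.
rewrite {2}/psi (negPf neS0) eqxx; congr (_ + _).
have in0 : (set0 \subset S) && (#|@set0 T| < k)%N by rewrite sub0set cards0.
rewrite (bigD1 set0 in0) [in RHS](bigD1 set0 in0) /= {1}/psi eqxx addrA subrK.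
congr (_ + _); apply: eq_bigr => F /andP[/andP[sFS ltF] neF0].
rewrite /psi (negPf neF0) ifF //; apply: contraTF ltF => /eqP->.
by rewrite -leqNgt.
Qed.

Lemma sum_delta_l (R : nzRingType) (b : nat -> R) i :
  \sum_(j < i.+1) (j == 0%N :> nat)%:R * b (i - j)%N = b i.
Proof.
by rewrite big_ord_recl mul1r subn0 big1 ?addr0 // => j _; rewrite mul0r.
Qed.

Lemma sum_delta_r (R : nzRingType) (b : nat -> R) i :
  \sum_(j < i.+1) b j * (i - j == 0)%N%:R = b i.
Proof.
rewrite big_ord_recr /= subnn mulr1 big1 ?add0r // => j _.
by rewrite subn_eq0 leqNgt ltn_ord mulr0.
Qed.

Lemma coef1_set0 j : sapp (1 : {poly sA})`_j set0 = (j == 0%N)%:R.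
Proof. by rewrite coef1; case: (j == 0%N); rewrite ?sapp0 // sapp1 eqxx. Qed.

Lemma cfun_coef1 W u j : u \in W -> (1 : {poly 'CF(W)})`_j u = (j == 0%N)%:R.
Proof.
by move=> Wu; rewrite coef1; case: (j == 0%N); rewrite ?mulr1n ?mulr0n ?cfun1E ?Wu ?cfunE.
Qed.

Lemma conv_coef_set0 x y k S i w :
  conv_coef (pfin x) y k S i set0 w = sapp (y w k)`_i S.
Proof.
rewrite /conv_coef cards0 subn0 setD0 /pfin eqxx.
by under eq_bigr do rewrite coef1_set0; rewrite (sum_delta_l (fun m => sapp (y w k)`_m S)).
Qed.

Lemma subset_stab_set0 W : W \subset 'N(set0 : {set T} | 'P).
Proof. by apply/subsetP=> u _; apply: stb0. Qed.

Lemma valid_set0 : valid set0 0.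
Proof. by rewrite /valid /=. Qed.

Lemma restrict_unif_set0 S k : restrict (unif S k) set0 = unif set0 0.
Proof. by rewrite restrict_unif ?sub0set ?cards0. Qed.

Lemma contract_unif_set0 S k : contract (unif S k) set0 = unif S k.
Proof. by rewrite contract_unif ?sub0set ?cards0 // setD0 subn0. Qed.

Lemma KL_unif0 W u j : u \in W -> (P W (unif set0 0))`_j u = (j == 0%N)%:R.
Proof.
move=> Wu; have [eqM llM rkM] := valid_matroid valid_set0 (subset_stab_set0 W).
by have [_ -> // _ _] := hP eqM llM; apply: cfun_coef1.
Qed.

(** The recursion says that the difference between [P] and the explicit solution equals its own
    reversal in degree [k]. Both have degree below k/2, so a low coefficient of the difference is
    also a high one and vanishes. *)
Lemma KL_unif k S W w i : valid S k -> W \subset 'N(S | 'P) -> w \in W ->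
  (P W (unif S k))`_i w = sapp (KL_val w k)`_i S.
Proof.
elim/ltn_ind: k S W w i => k IHk S W w i vS sWS Ww.
have [eqM llM rkM] := valid_matroid vS sWS.
have [_ P0 degP eqKL] := hP eqM llM; rewrite rkM in P0 degP eqKL.
have [k0|] := eqVneq k 0%N.
  move: vS; rewrite /valid /KL_val /pfin k0 eqxx => /eqP->.
  by rewrite KL_unif0 // coef1_set0.
rewrite -lt0n => k_gt0; move: (vS); rewrite {1}/valid (gtn_eqF k_gt0) => le_kS.
have VKLE u m : (0 < m)%N -> KL_val u m = uKL u m by rewrite /KL_val /pfin => /gtn_eqF->.
have key j : (poly_reverse k (P W (unif S k)))`_j w =
    (P W (unif S k))`_j w - sapp (uKL w k)`_j S + sapp (poly_reverse k (uKL w k))`_j S.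
  rewrite eqKL coef_sum sum_cfunE; under eq_bigr do rewrite grIndE.
  rewrite (@flat_sum_conv char_val KL_val (fun u => (P W (unif S k))`_j u)
    (fun j u => (uchar u k)`_j) _ S k w j) //.
  - have -> : sapp (poly_reverse k (uKL w k))`_j S = sapp (uchar w k)`_j S +
        sapp (sconv (useq_bool 'X (cst (ualt w)) (cst (usym w))) (uKL w) k)`_j S.
      by rewrite uKL_reverse [in LHS]coefD [in LHS]sappD.
    rewrite conv_coef_set0 VKLE // -addrA; congr (_ + _).
    rewrite addrC; congr (_ + _); rewrite sconv_trunc ?uKL0 //.
    rewrite -sum_flats_coef; last by move=> a l; apply: homogeneous_bool.
    apply: eq_bigr => F /andP[sFS ltF]; apply: eq_bigr => l _.
    by rewrite char_val_bool VKLE ?subn_gt0.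
  - exact: natural_char_val.
  - exact: natural_KL_val.
  - exact: natural_uchar.
  - by move=> g u Wg _; rewrite cfunJ.
  - move=> u Wu; rewrite restrict_unif_set0 contract_unif_set0.
    rewrite stab_ground ?subset_stab_set0 // cfun_mul_coef.
    under eq_bigr do rewrite char_poly_unif ?valid_set0 ?subset_stab_set0 // coef1_set0.
    by rewrite (sum_delta_l (fun m => (P W (unif S k))`_m u)).
  - move=> u Wu; rewrite restrict_unif_ground contract_unif_ground // stab_ground //.
    rewrite cfun_mul_coef.
    under eq_bigr do rewrite KL_unif0 //.
    rewrite (sum_delta_r (fun m => (equivariant_char_poly _ _ _ _)`_m u)).
    by rewrite char_poly_unif // /char_val /pfin (gtn_eqF k_gt0).
  move=> F u sFS /andP[F_gt0 ltF] uF; rewrite cfun_mul_coef.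
  apply: eq_bigr => l _.
  have [vF vSF _] := valid_proper k_gt0 le_kS sFS ltF.
  have [sub1 sub2] := stab_sub F sWS.
  rewrite restrict_unif ?contract_unif ?(ltnW ltF) // char_poly_unif // IHk //.
  by lia.
have Phigh j : (k <= j.*2)%N -> (P W (unif S k))`_j = 0.
  move=> le_kj; have := degP k_gt0; move sE: (size _) => s lt_sk.
  by rewrite nth_default // sE; lia.
rewrite VKLE //.
have [le_ki|lt_ik] := leqP k i.*2; first by rewrite Phigh // coef_uKL_high // cfunE sapp0.
have := key (k - i)%N; rewrite !coef_reverse leq_subr subKn; last by lia.
have hi : (k <= (k - i).*2)%N by lia.
by rewrite (Phigh _ hi) (coef_uKL_high w hi) cfunE sapp0 subrr add0r.
Qed.

Lemma cfun_poly_sign W (p : {poly 'CF(W)}) n i w :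
  ((-1) ^+ n * p)`_i w = (-1) ^+ n * p`_i w.
Proof.
rewrite -[in LHS]signr_odd -[in RHS]signr_odd.
by case: (odd n); rewrite ?expr0 ?expr1 ?mul1r ?mulN1r ?coefN ?cfunE.
Qed.

(** The recursion is solved for the empty flat, whose contraction is the whole matroid. The other
    terms sum to minus the explicit value, because [uKL] is defined as minus the convolution of
    [usym] with [uinvKL]. *)
Lemma inverse_KL_unif k S W w i : valid S k -> W \subset 'N(S | 'P) -> w \in W ->
  (Q W (unif S k))`_i w = sapp (invKL_val w k)`_i S.
Proof.
elim/ltn_ind: k S W w i => k IHk S W w i vS sWS Ww.
have [eqM llM rkM] := valid_matroid vS sWS.
have [_ Q0 eqQ] := hQ eqM llM; rewrite rkM in Q0 eqQ.
have [k0|] := eqVneq k 0%N.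
  move: vS; rewrite Q0 // /valid /invKL_val /pfin k0 eqxx => /eqP->.
  by rewrite cfun_coef1 // coef1_set0.
rewrite -lt0n => k_gt0; move: (vS); rewrite {1}/valid (gtn_eqF k_gt0) => le_kS.
have VE u m : (0 < m)%N -> invKL_val u m = (-1) ^+ m * uinvKL u m.
  by rewrite /invKL_val /pfin => /gtn_eqF->.
have Q00 (G : {group {perm T}}) u j : u \in G -> (Q G (unif set0 0))`_j u = (j == 0%N)%:R.
  move=> Gu; have [eqM0 llM0 rkM0] := valid_matroid valid_set0 (subset_stab_set0 G).
  by have [_ -> // _] := hQ eqM0 llM0; apply: cfun_coef1.
pose sVKL := pfin (fun u m => (-1) ^+ m * uKL u m).
pose phi F : 'CF(stabg W F) := (-1) ^+ rk (unif S k) F *: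
  (P (stabg W F) (restrict (unif S k) F) * Q (stabg W F) (contract (unif S k) F))`_i.
have : \sum_(F in flat_reps 'P W (unif S k)) 'Ind[W] (phi F) w = 0.
  have := congr1 (fun p : {poly 'CF(W)} => p`_i w) (eqQ k_gt0).
  rewrite coef_sum sum_cfunE coef0 cfunE => eq0; rewrite -[RHS]eq0; apply: eq_bigr => F _.
  by rewrite /phi linearZ /= cfunE cfun_poly_sign grIndE.
have sVE u m : sVKL u m = (-1) ^+ m * KL_val u m.
  by rewrite /sVKL /KL_val /pfin; case: eqP => [->|_]; rewrite ?mulr1.
rewrite (@flat_sum_conv sVKL invKL_val (fun u => (Q W (unif S k))`_i u)
  (fun i u => ((-1) ^+ k * uKL u k)`_i) _ S k w i) //.
- rewrite conv_coef_set0 -addrA; set tl := (X in _ + X); suff ->: tl = 0.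
    by rewrite addr0 => /eqP; rewrite subr_eq0 => /eqP.
  rewrite {}/tl; set Z := (fun m => (-1) ^+ m * uinvKL w m : {poly sA}).
  transitivity (sapp (\sum_(a < k) cst (fun a => (-1) ^+ a * usym w a) a * Z (k - a)%N)`_i S
      + sapp ((-1) ^+ k * uKL w k)`_i S).
    congr (_ + _); rewrite -(@sum_flats_coef _ (cst (fun a => (-1) ^+ a * usym w a)) Z).
      apply: eq_bigr => F /andP[sFS ltF]; apply: eq_bigr => l _.
      rewrite VE ?subn_gt0 // sVE coef_sign sapp_sign KL_val_bool.
      by rewrite /cst !coefC; case: eqP => _; rewrite ?sapp_sign // sapp0 mulr0.
    move=> a l; rewrite /cst coefC; case: eqP => _; last exact: homogeneous0.
    by move=> F nF; rewrite sapp_sign gen_neq // mulr0.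
  rewrite -sappD -coefD (_ : _ + _ = 0) ?coef0 ?sapp0 //.
  rewrite /uKL /useq_KL sconv_trunc ?uinvKL0 // mulrN; apply/eqP; rewrite subr_eq0; apply/eqP.
  rewrite mulr_sumr; apply: eq_bigr => a _; rewrite /Z /cst polyCM (rmorph_sign polyC) /=.
  by rewrite mulrACA -exprD subnKC // ltnW.
- move=> n j; rewrite /sVKL; apply: natural_pfin => m.
  by apply: eq_natural (natural_sign m (natural_uKL T m j)) => u; rewrite coef_sign.
- exact: natural_invKL_val.
- by apply: eq_natural (natural_sign k (natural_uKL T k i)) => u; rewrite coef_sign.
- by move=> g u Wg _; rewrite cfunJ.
- move=> u Wu; rewrite /phi rk_unif ?sub0set // cards0 minn0 scale1r.
  rewrite restrict_unif_set0 contract_unif_set0 stab_ground ?subset_stab_set0 //.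
  rewrite cfun_mul_coef; under eq_bigr do rewrite KL_unif0 //.
  by rewrite (sum_delta_l (fun m => (Q W (unif S k))`_m u)).
- move=> u Wu; rewrite /phi rk_unif // (minn_idPl le_kS) cfunE.
  rewrite restrict_unif_ground contract_unif_ground // stab_ground // cfun_mul_coef.
  under eq_bigr do rewrite Q00 //.
  rewrite (sum_delta_r (fun m => (P _ _)`_m u)) KL_unif // coef_sign sapp_sign.
  by rewrite /KL_val /pfin (gtn_eqF k_gt0).
move=> F u sFS /andP[F_gt0 ltF] uF; rewrite /phi cfunE rk_unif // (minn_idPr (ltnW ltF)).
have [vF vSF _] := valid_proper k_gt0 le_kS sFS ltF.
have [sub1 sub2] := stab_sub F sWS.
rewrite restrict_unif ?contract_unif ?(ltnW ltF) // cfun_mul_coef mulr_sumr.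
apply: eq_bigr => l _; rewrite KL_unif // IHk //; last by lia.
by rewrite sVE coef_sign sapp_sign mulrA.
Qed.

(** A proper flat has constant inverse Kazhdan--Lusztig polynomial, so t^i sees only the flats of
    corank [i], which give [ualt w (k - i) * umob w i]. The ground set adds the coefficient of
    [uinvKL]: below the middle it replaces this product by its mirror image, elsewhere it is 0. *)
Lemma inverse_Z_unif k S W w i : (0 < k)%N -> (k <= #|S|)%N -> W \subset 'N(S | 'P) ->
    w \in W -> (i <= k)%N ->
  (inverse_Z_poly 'P%act mu Q W (unif S k))`_i w = (-1) ^+ k *
    sapp (if (i.*2 < k)%N then ualt w i * umob w (k - i)%N else ualt w (k - i)%N * umob w i) S.
Proof.
move=> k_gt0 le_kS sWS Ww le_ik.
have vS : valid S k by rewrite /valid (gtn_eqF k_gt0).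
have [_ _ rkM] := valid_matroid vS sWS.
rewrite /inverse_Z_poly rkM cfun_poly_sign; congr (_ * _); rewrite coef_sum sum_cfunE.
have sS : stb w S by apply: (subsetP sWS).
pose m F := mrank (contract (unif S k) F).
pose phi F : 'CF(stabg W F) := (-1) ^+ rk (unif S k) F *:
  (if (i < m F)%N then 0 else (Q (stabg W F) (restrict (unif S k) F))`_(i - m F) *
     mu (stabg W F) (contract (unif S k) F)).
transitivity (\sum_(F in flat_reps 'P W (unif S k)) 'Ind[W] (phi F) w).
  apply: eq_bigr => F _; rewrite -mulrA cfun_poly_sign /phi linearZ /= cfunE; congr (_ * _).
  rewrite coefXnM -/(m F); case: ifP => _; first by rewrite linear0.
  by rewrite grIndE coefMC.
pose Z u a := if a == i then umob u a else 0.
pose psi F u := if F == S then (-1) ^+ k * sapp (invKL_val u k)`_i S else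
  sapp (ualt u #|F|) F * sapp (Z u (k - #|F|)%N) (S :\: F).
rewrite (@flat_sum _ _ _ _ k_gt0 le_kS sWS _ psi) //; first last.
- move=> F sFS nsF; rewrite /psi ifF.
    by rewrite (local_out (natural_local (natural_ualt T _))) // mul0r.
  by apply: contraNF nsF => /eqP->.
- move=> F u /andP[sFS ltF] uF; have Wu : u \in W by case/setIP: uF.
  rewrite /psi /phi cfunE rk_unif //.
  case: eqP ltF => [eqFS _|_].
    rewrite /m {}eqFS (minn_idPl le_kS) contract_unif_ground //.
    rewrite mrank_unif ?cards0 // ltn0 subn0 restrict_unif_ground stab_ground // cfunE.
    rewrite inverse_KL_unif // mobius_unif ?valid_set0 ?subset_stab_set0 //.
    by rewrite /mob_val eqxx sapp1 eqxx mulr1.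
  rewrite orbF => ltF; rewrite (minn_idPr (ltnW ltF)).
  have [vF vSF m_gt0] := valid_proper k_gt0 le_kS sFS ltF.
  have [sub1 sub2] := stab_sub F sWS; have [_ _ rkF] := valid_matroid vSF sub2.
  rewrite /m contract_unif ?(ltnW ltF) // rkF restrict_unif ?(ltnW ltF) // sapp_sign -mulrA.
  congr (_ * _); rewrite /Z; case: (ltngtP i (k - #|F|)) => [lt_i|gt_i|eq_i].
  - by rewrite cfunE sapp0 mulr0.
  - by rewrite cfunE inverse_KL_unif // invKL_val_bool ifF ?mul0r ?sapp0 ?mulr0 //; lia.
  rewrite cfunE inverse_KL_unif // invKL_val_bool eq_i subnn eqxx mobius_unif //.
  by rewrite /mob_val (gtn_eqF m_gt0).
- move=> F g u sFS Wg Wu; have gS : stb g S by apply: (subsetP sWS).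
  rewrite /psi imset_eq_ground //; have gSS : 'P^*%act S g = S.
    by apply/astab1P; rewrite astab1_set.
  case: eqP => _.
    rewrite -[in RHS](natural_conj (natural_invKL_val _ _) u g).
    by rewrite -[g @: S]/('P^*%act S g) gSS.
  rewrite card_imset; last exact: perm_inj.
  rewrite (natural_conj (natural_ualt T _)) -imset_setD // /Z; congr (_ * _).
  by case: eqP => _; rewrite ?sapp0 // (natural_conj (natural_umob T _)).
rewrite {2}/psi eqxx {1}/invKL_val /pfin (gtn_eqF k_gt0) coef_sign sapp_sign mulrA -exprD.
rewrite addnn -signr_odd odd_double mul1r.
transitivity (sapp (\sum_(a < k) ualt w a * Z w (k - a)%N) S + sapp (uinvKL w k)`_i S).
  congr (_ + _); rewrite -sum_flats; last exact: homogeneous_ualt.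
  apply: eq_bigr => F /andP[sFS ltF]; rewrite /psi ifF //.
  by apply: contraTF ltF => /eqP->; rewrite -leqNgt.
rewrite /Z sum_single ?umob0 // le_ik coef_uinvKL -sappD; congr sapp.
by case: ifP => _; rewrite ?addr0 // addrC subrK.
Qed.

End EquivariantPolynomials.

(** * Restriction to Young subgroups *)

Section HookValues.
Variables (T : finType) (w : {perm T}).
Local Notation h := (gen algC false w).
Local Notation e := (gen algC true w).

Lemma utop_agree_le m n : (0 < m <= n)%N -> agree n (utop w m) (h n).
Proof.
move=> /andP[m_gt0 le_mn] F cF; rewrite utopE genE cF m_gt0 le_mn eqxx !andbT.
by case: (stb w F).
Qed.

(** On a set of size c+m-1 the complement of a subset of size m-r-1 has c+r elements, where [utop]
    takes the values of [h (c + r)]; the convolution becomes the alternating expansion of a hook. *)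
Lemma hook_umob c m : (0 < c)%N ->
  agree (c + m).-1 ((-1) ^+ m * umob w m) (hook h e c m).
Proof.
move=> c_gt0 F cF; rewrite sapp_sign /umob /useq_mu sconv_trunc ?utop0 // sappN.
rewrite hook_sum (reindex_inj rev_ord_inj) /= sapp_sum mulrN mulr_sumr -sumrN sapp_sum.
apply: eq_bigr => r _; have lt_rm := ltn_ord r.
rewrite sapp_sign /ualt -mulrA sapp_sign.
have cE : ((c + m).-1 = (m - r.+1) + (c + r))%N by lia.
rewrite (@agree_mul_homogeneous _ (m - r.+1) (c + r) _ _ (h (c + r)%N)
  (@homogeneous_gen _ _ _ _ _)) ?cF //; last by apply: utop_agree_le; lia.
rewrite mulrA -exprD -mulNr; congr (_ * sapp _ F).
  rewrite -[LHS]mulN1r -exprS -[LHS]signr_odd -[RHS]signr_odd.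
  by congr (_ ^+ nat_of_bool _); lia.
by rewrite mulrC; congr (h _ * e _); lia.
Qed.

Lemma hook_mul_umob c i m : (0 < c)%N ->
  agree (i + (c + m).-1) ((-1) ^+ (i + m) * (ualt w i * umob w m)) (e i * hook h e c m).
Proof.
move=> c_gt0 F cF; have -> : (-1) ^+ (i + m) * (ualt w i * umob w m) =
    e i * ((-1) ^+ m * umob w m).
  have s1 : (-1) ^+ i * (-1) ^+ i = 1 :> sfun T algC.
    by rewrite -exprD addnn -signr_odd odd_double.
  transitivity ((-1) ^+ i * (-1) ^+ i * (e i * ((-1) ^+ m * umob w m))).
    by rewrite /ualt exprD; ring.
  by rewrite s1 mul1r.
apply: agree_mul_homogeneous cF; first exact: homogeneous_gen.
exact: hook_umob.
Qed.

End HookValues.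

Lemma card_stab (T : finType) (A : {set T}) :
  #|'N(A | 'P)%g| = (#|A|`! * #|~: A|`!)%N.
Proof.
apply/eqP; rewrite -(@Num.Theory.eqr_nat algC) natrM; apply/eqP.
rewrite -[(#|A|`!)%:R]perm_sum_stb -[(#|~: A|`!)%:R]perm_sum_stb -setTD.
rewrite -perm_sum_split ?subsetT //; try exact: local_stb.
rewrite -sumr_const big_mkcond [RHS]big_mkcond; apply: eq_bigr => w _.
have -> : perm_on setT w by apply/subsetP=> t _; rewrite inE.
rewrite -[w \in _]/(stb w A) setTD stbC.
by case: (stb w A); rewrite ?mulr0 ?mulr1.
Qed.

Lemma exists_perm_imset (T : finType) (A B : {set T}) :
  #|A| = #|B| -> exists g : {perm T}, g @: A = B.
Proof.
move=> cAB; pose s (C : {set T}) := enum C ++ enum (~: C).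
have sP C x : x \in s C by rewrite mem_cat !mem_enum inE orbN.
have us C : uniq (s C).
  rewrite cat_uniq !enum_uniq andbT /=; apply/hasPn=> x.
  by rewrite !mem_enum inE.
have szs : size (s A) = size (s B).
  by rewrite !size_cat -!cardE !cardsC.
pose f x := nth x (s B) (index x (s A)).
have ltf x : (index x (s A) < size (s B))%N by rewrite -szs index_mem.
have inj_f : injective f.
  move=> x y; rewrite /f (set_nth_default x y) // => /eqP.
  rewrite nth_uniq // => /eqP eq_i.
  by rewrite -[x](nth_index x (sP A x)) eq_i nth_index.
exists (perm inj_f); apply/eqP; rewrite eqEcard card_imset; last exact: perm_inj.
rewrite cAB leqnn andbT; apply/subsetP=> _ /imsetP[x xA ->]; rewrite permE /f.
have lti : (index x (s A) < #|B|)%N.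
  by rewrite /s index_cat mem_enum xA -cAB cardE index_mem mem_enum.
by rewrite nth_cat -cardE lti -mem_enum mem_nth // -cardE.
Qed.

Section YoungSubgroup.
Variable n : nat.
Local Notation L := (lshift n @: [set: 'I_n]).
Local Notation R := (@rshift n n @: [set: 'I_n]).

Lemma card_lower : #|L| = n.
Proof. by rewrite card_imset ?cardsT ?card_ord //; apply: lshift_inj. Qed.

Lemma lower_compl : ~: L = R.
Proof.
apply/setP=> x; rewrite inE; case: (split_ordP x) => i ->.
  rewrite imset_f ?inE //; apply/esym/imsetP=> -[j _ /eqP].
  by rewrite eq_lrshift.
rewrite [RHS]imset_f ?inE //; apply/imsetP=> -[j _ /eqP].
by rewrite eq_rlshift.
Qed.

Lemma young_lshift (st : 'S_n * 'S_n) x : young_perm st (lshift n x) = lshift n (st.1 x).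
Proof. by rewrite permE /young_fun (unsplitK (inl x)). Qed.

Lemma young_rshift (st : 'S_n * 'S_n) x : young_perm st (rshift n x) = rshift n (st.2 x).
Proof. by rewrite permE /young_fun (unsplitK (inr x)). Qed.

(** As the stabiliser of the lower half, the Young subgroup falls under [cfInd_orbit], applied to
    the action on subsets. *)
Lemma young_stab : young_group n = 'N(L | 'P) :> {set 'S_(n + n)}.
Proof.
apply/eqP; rewrite eqEcard card_stab lower_compl card_lower.
rewrite card_imset ?cardsT ?card_ord; last exact: rshift_inj.
rewrite card_injm ?young_injm // cardsT card_prod card_Sn leqnn andbT.
apply/subsetP=> _ /morphimP[st _ _ ->]; apply/stbP=> x.
case: (split_ordP x) => i ->.
  by rewrite young_lshift !imset_f ?inE.
rewrite young_rshift; apply/idP/idP=> /imsetP[j _ /eqP]; by rewrite eq_rlshift.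
Qed.

Lemma cfPullE (aT rT : finGroupType) (D H : {group aT}) (f : {morphism D >-> rT})
    (a : 'CF([set: rT])) x : H \subset D -> x \in H -> cfPull f H a x = a (f x).
Proof.
move=> sHD Hx; rewrite /cfPull cfMorphE // cfResE ?subsetT //.
by rewrite mem_morphim // (subsetP sHD).
Qed.

Lemma box_tensorE (a b : 'CF([set: 'S_n])) (st : 'S_n * 'S_n) :
  box_tensor a b st = a st.1 * b st.2.
Proof. by rewrite cfunE !cfPullE ?inE ?subsetT. Qed.

Lemma relabel_gen_lower b a (st : 'S_n * 'S_n) :
  relabel (lshift n) (gen algC b (young_perm st) a) = gen algC b st.1 a.
Proof. apply: gen_intertwine; [exact: lshift_inj | exact: young_lshift]. Qed.

Lemma relabel_gen_upper b a (st : 'S_n * 'S_n) :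
  relabel (@rshift n n) (gen algC b (young_perm st) a) = gen algC b st.2 a.
Proof. apply: gen_intertwine; [exact: rshift_inj | exact: young_rshift]. Qed.

(** [relabel f] respects sums and convolutions, so matching the generators matches every polynomial
    in them. *)
Lemma zcoef_relabel (T T' : finType) (f : T -> T') c k i (u : {perm T}) (w : {perm T'}) :
    injective f -> (forall b a, relabel f (gen algC b w a) = gen algC b u a) ->
  relabel f (zcoef c k i w) = zcoef c k i u.
Proof.
move=> inj_f genE'; rewrite /zcoef relabelM // genE'; congr (_ * _).
elim: (maxn _ _) c => [|m IHm] c /=; first by apply/sfunP=> A; rewrite relabelE !sapp0.
by rewrite relabelD relabelN relabelM // !genE' IHm.
Qed.

Lemma zcoef_young c k i (st : 'S_n * 'S_n) :
  sapp (zcoef c k i (young_perm st)) L = sapp (zcoef c k i st.1) setT /\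
  sapp (zcoef c k i (young_perm st)) (~: L) = sapp (zcoef c k i st.2) setT.
Proof.
split; first by rewrite -relabelE (zcoef_relabel _ _ _ (@lshift_inj n n) (fun b a => relabel_gen_lower b a st)).
by rewrite lower_compl -relabelE
  (zcoef_relabel _ _ _ (@rshift_inj n n) (fun b a => relabel_gen_upper b a st)).
Qed.

(** The orbit of the lower half consists of all subsets of size [n], and by homogeneity only these
    contribute to the convolution on the full set. *)
Lemma Ind_young_zcoef c k i j (a b : 'CF([set: 'S_n])) (w : 'S_(n + n)) :
    (forall s, a s = sapp (zcoef c k i s) setT) ->
    (forall s, b s = sapp (zcoef c k j s) setT) ->
    (forall u : 'S_(n + n), homogeneous (zcoef c k i u) n) -> (0 < c)%N ->
  'Ind[[set: 'S_(n + n)]] (cfPull (young_id n) (young_group n) (box_tensor a b)) w =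
  sapp (zcoef c k i w * zcoef c k j w) setT.
Proof.
move=> aE bE hom c_gt0.
pose z i (u : 'S_(n + n)) := zcoef c k i u.
have nz l : natural (z l) by case: (honest_zcoef 'I_(n + n) c_gt0 k l).
pose psi B (u : 'S_(n + n)) := sapp (z i u) B * sapp (z j u) (~: B).
have fixE (B : {set 'I_(n + n)}) u : ('P^*%act B u == B) = stb u B.
  by rewrite /stb -astab1_set; apply/eqP/idP=> /astab1P.
rewrite (@cfInd_orbit _ _ 'P^* [set: 'S_(n + n)]%G L (young_group n) _ psi) ?inE //.
- rewrite sappM; apply/esym; rewrite (bigID (fun B : {set 'I_(n + n)} => (#|B| == n) && stb w B)) /=.
  rewrite [X in _ + X]big1 ?addr0 => [|B /andP[_]]; last first.
    rewrite negb_and => /orP[nB|nB]; first by rewrite hom ?mul0r.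
    by rewrite (local_out (natural_local (nz i))) // mul0r.
  apply: eq_big => [B|B _]; last by rewrite /psi setTD.
  rewrite subsetT fixE /=; congr (_ && _); apply/eqP/orbitP=> [cB|[g _ <-]].
    have [g gL] : exists g : 'S_(n + n), g @: L = B.
      by apply: exists_perm_imset; rewrite card_lower cB.
    by exists g; rewrite ?inE.
  by rewrite card_setact card_lower.
- by rewrite young_stab /= setTI astab1_set.
- move=> g u _ _; rewrite /psi (natural_conj (nz i)); congr (_ * _).
  rewrite -[in RHS](natural_conj (nz j) u g); congr sapp.
  by rewrite -!setTD imset_setD // stbT.
move=> u; case/morphimP=> st _ _ ->.
rewrite cfPullE ?mem_morphim ?inE //.
rewrite /young_id /= invmE ?inE // box_tensorE aE bE /psi.
by have [<- _] := zcoef_young c k i st; have [_ <-] := zcoef_young c k j st.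
Qed.

End YoungSubgroup.

Lemma uniformE n k : uniform n k = unif [set: 'I_n] k.
Proof. by apply: eq_matroid => // A; rewrite !inE subsetT. Qed.

Lemma homogeneous_zcoef (T : finType) (w : {perm T}) n k i :
  (0 < k)%N -> (i <= k)%N -> (k <= n)%N -> homogeneous (zcoef (n - k).+1 k i w) n.
Proof.
move=> k_gt0 le_ik le_kn.
by apply: (homogeneousM (@homogeneous_gen _ _ _ _ _) (@homogeneous_hook _ _ _ _ _)); lia.
Qed.

Theorem theorem1p5 (n k : nat) (hk : (1 <= k)%N) (hkn : (k <= n)%N)
    (mu : forall W : {group 'S_n}, matroid 'I_n -> 'CF(W))
    (P Q : forall W : {group 'S_n}, matroid 'I_n -> {poly 'CF(W)})
    (hmu : is_equivariant_mobius 'P%act mu)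
    (hP : is_equivariant_KL 'P%act mu P)
    (hQ : is_equivariant_inverse_KL 'P%act P Q) :
  strongly_inductively_log_concave (young_id n) k
    (fun i => (inverse_Z_poly 'P%act mu Q [set: 'S_n]%G (uniform n k))`_i).
Proof.
move=> i j i_gt0 le_ij le_jk.
pose C l := (inverse_Z_poly 'P%act mu Q [set: 'S_n]%G (uniform n k))`_l.
pose IndC a b := 'Ind[[set: 'S_(n + n)]]
  (cfPull (young_id n) (young_group n) (box_tensor (C a) (C b))).
suff : IndC i j - IndC i.-1 j.+1 \is a character by [].
(* The value for which c+k-1 = n: on a set of size [n], [hook_mul_umob] then yields hooks with first
   row [c]. *)
pose c := (n - k).+1.
have CE l s : (l <= k)%N -> C l s = sapp (zcoef c k l s) setT.
  move=> le_lk; rewrite /C uniformE (inverse_Z_unif hmu hP hQ) ?cardsT ?card_ord ?inE //; last first.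
    by apply/subsetP=> u _; apply: stbT.
  rewrite -sapp_sign; case: ifP => [lt_lk|/negbT]; last rewrite -leqNgt => le_kl.
    have -> : ((-1) ^+ k : sfun 'I_n algC) = (-1) ^+ (l + (k - l)) by rewrite subnKC.
    rewrite (@hook_mul_umob _ _ c) ?cardsT ?card_ord //; last by rewrite /c; lia.
    by rewrite zcoef_low //; lia.
  have -> : ((-1) ^+ k : sfun 'I_n algC) = (-1) ^+ (k - l + l) by rewrite subnK.
  rewrite (@hook_mul_umob _ _ c) ?cardsT ?card_ord //; last by rewrite /c; lia.
  by rewrite zcoef_high // subKn.
have hom l (u : 'S_(n + n)) : (l <= k)%N -> homogeneous (zcoef c k l u) n.
  by move=> le_lk; apply: homogeneous_zcoef.
have IndE a b w : (a <= k)%N -> (b <= k)%N ->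
    IndC a b w = sapp (zcoef c k a w * zcoef c k b w) setT.
  move=> le_ak le_bk; apply: Ind_young_zcoef => // [s|s|u]; [exact: CE | exact: CE |].
  exact: hom.
have lt_jk : (j < k)%N by lia.
have [_ /(_ setT)[chi chiC chiE]] := @honest_zcoef_sub 'I_(n + n) c isT k i j i_gt0 le_ij lt_jk.
(* The stabiliser of the full set is the whole group, so the restriction only changes the type of
   [chi]. *)
suff -> : IndC i j - IndC i.-1 j.+1 = 'Res[[set: 'S_(n + n)]] chi by apply: cfRes_char.
apply/cfunP=> w; rewrite !cfunE !IndE; try lia.
rewrite cfResE ?inE //; last by apply/subsetP=> u _; apply: stbT.
by rewrite chiE ?sappD ?sappN //; apply: stbT.
Qed.
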